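(* The following hold. (1) If $k<n$ then $$H^\ell(\mathfrak{so}(n,1),\mathrm{SO}(n);\mathcal{P}_k)=\begin{cases}\mathcal{R}_k\,\varphi_k & \text{if }\ell=k,\\ \mathcal{S}_k/(c_1,\ldots,c_k)\,\mathrm{vol} & \text{if }\ell=n,\\ 0&\text{otherwise.}\end{cases}$$ (2) If $k=n$ then $$H^\ell(\mathfrak{so}(n,1),\mathrm{SO}(n);\mathcal{P}_k)=\begin{cases}\mathcal{R}_k\,\varphi_k\oplus \mathcal{S}_k/(c_1,\ldots,c_k)\,\mathrm{vol} & \text{if }\ell=n,\\ 0&\text{otherwise.}\end{cases}$$ (3) If $k>n$ then $$H^\ell(\mathfrak{so}(n,1),\mathrm{SO}(n);\mathcal{P}_k)=\begin{cases}\big(\mathcal{P}_k/(q_1,\ldots,q_n)\big)^K\,\mathrm{vol} & \text{if }\ell=n,\\ 0&\text{otherwise.}\end{cases}$$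
   Context: Let $n,k\ge1$, $V=\mathbb{R}^{n,1}$ with orthogonal basis $e_1,\ldots,e_{n+1}$, $(e_\alpha,e_\alpha)=1$ for $1\le\alpha\le n$, $(e_{n+1},e_{n+1})=-1$; $V_+=\mathrm{span}(e_1,\ldots,e_n)$; $K=\mathrm{SO}(n)$ is the subgroup of $\mathrm{SO}_0(n,1)$ fixing $e_{n+1}$. Write $\mathfrak{so}(n,1)=\mathfrak{so}(n)\oplus\mathfrak{p}_0$ (orthogonal for the Killing form); $\mathfrak{p}_0$ has basis $e_{\alpha,n+1}=-e_\alpha\wedge e_{n+1}$, $1\le\alpha\le n$ ($u\wedge v$ acts by $w\mapsto(u,w)v-(v,w)u$), and $\omega_1,\ldots,\omega_n$ is the dual basis of $\mathfrak{p}_0^*$. $\mathcal{P}_k=\mathrm{Pol}((V\otimes\mathbb{C})^k)$ is the complex polynomial ring in $z_{\alpha i}$ ($1\le\alpha\le n$, $1\le i\le k$) and $w_i$ ($1\le i\le k$), where $(z_{1i},\ldots,z_{ni},w_i)$ are the coordinates of the $i$-th vector. It is the Fock model of the Weil representation; $K$ acts by $(gf)(\mathbf{v})=f(g^{-1}\mathbf{v})$. The relative Lie algebra complex is $C^\ell=(\bigwedge^\ell\mathfrak{p}_0^*\otimes\mathcal{P}_k)^{\mathrm{SO}(n)}$ with $$d=\sum_{j=1}^k\sum_{\alpha=1}^n A(\omega_\alpha)\otimes\Big(\frac{\partial^2}{\partial z_{\alpha j}\partial w_j}-z_{\alpha j}w_j\Big),$$ $A(\omega)$ being left exterior multiplication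 by $\omega$; its cohomology is $H^\ell(\mathfrak{so}(n,1),\mathrm{SO}(n);\mathcal{P}_k)$. Put $r_{ij}=\sum_{\alpha=1}^n z_{\alpha i}z_{\alpha j}$; $\mathcal{R}_k=\mathrm{Pol}((V_+\otimes\mathbb{C})^k)^{\mathrm{O}(n)}$ is the algebra generated by the $r_{ij}$ ($1\le i,j\le k$), and $\mathcal{S}_k=\mathcal{P}_k^{\mathrm{O}(n)}=\mathcal{R}_k[w_1,\ldots,w_k]$. Put $c_j=\sum_{i=1}^k r_{ij}w_i$ for $1\le j\le k$, $q_\alpha=\sum_{i=1}^k z_{\alpha i}w_i$ for $1\le\alpha\le n$, $\mathrm{vol}=\omega_1\wedge\cdots\wedge\omega_n$, $\varphi_1^{(i)}=\sum_{\alpha=1}^n z_{\alpha i}\,\omega_\alpha$, and $\varphi_k=\varphi_1^{(1)}\wedge\cdots\wedge\varphi_1^{(k)}\in C^k$ (the cocycle of Kudla and Millson). Here $(c_1,\ldots,c_k)$ is the ideal generated in $\mathcal{S}_k$ and $(q_1,\ldots,q_n)$ the ideal generated in $\mathcal{P}_k$. *)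

(* Defs.v *)
From HB Require Import structures.
From mathcomp Require Import all_boot all_order all_algebra.
From mathcomp Require Import reals complex mpoly.
Set Implicit Arguments.
Unset Strict Implicit.
Unset Printing Implicit Defensive.
Import GRing.Theory.
Local Open Scope ring_scope.

(* The vector space [sq_num / sq_den], given by its numerator and denominator. *)
Record subquot (F : fieldType) (V : lmodType F) := SubQuot {
  sq_num : V -> Prop;
  sq_den : V -> Prop
}.

Definition sq_zero (F : fieldType) (V : lmodType F) (Y : subquot V) : Prop :=
  forall y, sq_num Y y -> sq_den Y y.

Definition sq_prod (F : fieldType) (U V : lmodType F)
    (X : subquot U) (Y : subquot V) : subquot (U * V)%type :=
  SubQuot (fun p : U * V => sq_num X p.1 /\ sq_num Y p.2)
          (fun p : U * V => sq_den X p.1 /\ sq_den Y p.2).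

(* [f] acts on representatives and induces a linear isomorphism from
   [sq_num X / sq_den X] onto [sq_num Y / sq_den Y]. *)
Definition sq_iso (F : fieldType) (U V : lmodType F)
    (X : subquot U) (Y : subquot V) (f : U -> V) : Prop :=
  [/\ linear f,
      forall u, sq_num X u -> sq_num Y (f u),
      forall u, sq_num X u -> (sq_den Y (f u) <-> sq_den X u) &
      forall v, sq_num Y v -> exists2 u, sq_num X u & sq_den Y (v - f u)].

Notation Pk R n k := {mpoly R[i][(n * k + k)%N]}.

Definition zidx (n k : nat) (a : 'I_n) (i : 'I_k) : 'I_(n * k + k) :=
  lshift k (mxvec_index a i).
Definition widx (n k : nat) (i : 'I_k) : 'I_(n * k + k) := rshift (n * k) i.

Definition zvar (R : realType) (n k : nat) (a : 'I_n) (i : 'I_k) : Pk R n k :=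
  'X_(zidx a i).
Definition wvar (R : realType) (n k : nat) (i : 'I_k) : Pk R n k :=
  'X_(widx n i).

Definition orthogonal_mx (R : realType) (n : nat) (g : 'M[R]_n) : Prop :=
  g *m g^T = 1%:M.
Definition special_orthogonal_mx (R : realType) (n : nat) (g : 'M[R]_n) : Prop :=
  orthogonal_mx g /\ \det g = 1.

Definition constmx (R : realType) (n k : nat) (g : 'M[R]_n) : 'M[Pk R n k]_n :=
  map_mx (fun x : R => (real_complex R x)%:MP) g.

(* The coordinates of [g^-1 v], as polynomials in those of [v]: the matrix
   [z] becomes [g^-1 z] while [w] is fixed, as [g] fixes e_{n+1}. *)
Definition inv_coords (R : realType) (n k : nat) (g : 'M[R]_n) :
    'rV[Pk R n k]_(n * k + k) :=
  row_mx (mxvec (constmx k (invmx g) *m \matrix_(a, i) zvar R a i))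
         (\row_i wvar R n i).

(* (g f)(v) = f(g^-1 v) *)
Definition poly_act (R : realType) (n k : nat) (g : 'M[R]_n) (f : Pk R n k) :
    Pk R n k :=
  f \mPo [tuple inv_coords k g 0 l | l < n * k + k].

Definition O_invariant (R : realType) (n k : nat) (f : Pk R n k) : Prop :=
  forall g : 'M[R]_n, orthogonal_mx g -> poly_act g f = f.
Definition SO_invariant (R : realType) (n k : nat) (f : Pk R n k) : Prop :=
  forall g : 'M[R]_n, special_orthogonal_mx g -> poly_act g f = f.

(* Pol((V_+ (x) C)^k): the polynomials in which no w_i occurs. *)
Definition z_only (R : realType) (n k : nat) (f : Pk R n k) : Prop :=
  forall m, m \in msupp f -> forall i : 'I_k, m (widx n i) = 0%N.

Definition inRk (R : realType) (n k : nat) (f : Pk R n k) : Prop :=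
  z_only f /\ O_invariant f.
Definition inSk (R : realType) (n k : nat) (f : Pk R n k) : Prop :=
  O_invariant f.

Definition rpol (R : realType) (n k : nat) (i j : 'I_k) : Pk R n k :=
  \sum_(a < n) zvar R a i * zvar R a j.
Definition cpol (R : realType) (n k : nat) (j : 'I_k) : Pk R n k :=
  \sum_(i < k) rpol R n i j * wvar R n i.
Definition qpol (R : realType) (n k : nat) (a : 'I_n) : Pk R n k :=
  \sum_(i < k) zvar R a i * wvar R n i.

(* The ideal (c_1, ..., c_k) of S_k. *)
Definition c_ideal (R : realType) (n k : nat) (f : Pk R n k) : Prop :=
  exists s : 'I_k -> Pk R n k,
    (forall j, inSk (s j)) /\ f = \sum_(j < k) cpol R n j * s j.

(* The ideal (q_1, ..., q_n) of P_k. *)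
Definition q_ideal (R : realType) (n k : nat) (f : Pk R n k) : Prop :=
  exists s : 'I_n -> Pk R n k, f = \sum_(a < n) qpol R k a * s a.

Definition Rk (R : realType) (n k : nat) : subquot (Pk R n k) :=
  SubQuot (@inRk R n k) (fun f => f = 0).
Definition Sk_mod_c (R : realType) (n k : nat) : subquot (Pk R n k) :=
  SubQuot (@inSk R n k) (@c_ideal R n k).
(* (P_k / (q_1, ..., q_n))^K: the classes fixed by K in the quotient. *)
Definition Pk_mod_q_K (R : realType) (n k : nat) : subquot (Pk R n k) :=
  SubQuot (fun f : Pk R n k => forall g : 'M[R]_n,
             special_orthogonal_mx g -> q_ideal (poly_act g f - f))
          (@q_ideal R n k).

(* The exterior algebra of p_0^* tensored with P_k. The value of a form at
   S = {a_1 < ... < a_l} is its coefficient on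
   omega_{a_1} /\ ... /\ omega_{a_l}. *)
Notation forms R n k := {ffun {set 'I_n} -> Pk R n k}.

Definition pscale (R : realType) (n k : nat) (p : Pk R n k) (eta : forms R n k) :
    forms R n k :=
  [ffun S => p * eta S].

Definition inversions (n : nat) (S T : {set 'I_n}) : nat :=
  #|[set p : 'I_n * 'I_n | [&& p.1 \in S, p.2 \in T & (p.2 < p.1)%N]]|.

Definition wedge (R : realType) (n k : nat) (eta theta : forms R n k) :
    forms R n k :=
  [ffun U : {set 'I_n} => \sum_(S : {set 'I_n} | S \subset U)
     (-1) ^+ inversions S (U :\: S) * (eta S * theta (U :\: S))].

Definition form1 (R : realType) (n k : nat) : forms R n k :=
  [ffun S => (S == set0)%:R].
Definition omega (R : realType) (n k : nat) (a : 'I_n) : forms R n k :=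
  [ffun S => (S == [set a])%:R].

Definition vol (R : realType) (n k : nat) : forms R n k :=
  \big[@wedge R n k/form1 R n k]_(a < n) omega R k a.

Definition phi1 (R : realType) (n k : nat) (i : 'I_k) : forms R n k :=
  \sum_(a < n) pscale (zvar R a i) (omega R k a).
Definition phik (R : realType) (n k : nat) : forms R n k :=
  \big[@wedge R n k/form1 R n k]_(i < k) phi1 R n i.

(* The action on p_0^* is dual to the adjoint action of K on p_0, which is
   given by the matrix [g] in the basis e_{a,n+1}. *)
Definition omega_act (R : realType) (n k : nat) (g : 'M[R]_n) (a : 'I_n) :
    forms R n k :=
  \sum_(b < n) real_complex R (invmx g a b) *: omega R k b.
Definition form_act (R : realType) (n k : nat) (g : 'M[R]_n)
    (eta : forms R n k) : forms R n k :=
  \sum_(S : {set 'I_n})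
    pscale (poly_act g (eta S))
           (\big[@wedge R n k/form1 R n k]_(a in S) omega_act k g a).

Definition has_degree (R : realType) (n k : nat) (l : nat) (eta : forms R n k) :
    Prop :=
  forall S, eta S != 0 -> #|S| = l.

Definition cochain (R : realType) (n k : nat) (l : nat) (eta : forms R n k) :
    Prop :=
  has_degree l eta /\
  forall g : 'M[R]_n, special_orthogonal_mx g -> form_act g eta = eta.

Definition Dop (R : realType) (n k : nat) (a : 'I_n) (j : 'I_k) (f : Pk R n k) :
    Pk R n k :=
  mderiv (zidx a j) (mderiv (widx n j) f) - zvar R a j * wvar R n j * f.

Definition dform (R : realType) (n k : nat) (eta : forms R n k) : forms R n k :=
  \sum_(j < k) \sum_(a < n)
    wedge (omega R k a) [ffun S => Dop a j (eta S)].

Definition cocycle (R : realType) (n k : nat) (l : nat) (eta : forms R n k) :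
    Prop :=
  cochain l eta /\ dform eta = 0.

Definition coboundary (R : realType) (n k : nat) (l : nat) (eta : forms R n k) :
    Prop :=
  match l with
  | 0 => eta = 0
  | l'.+1 => exists2 theta, cochain l' theta & eta = dform theta
  end.

(* H^l(so(n,1), SO(n); P_k) *)
Definition cohom (R : realType) (n k : nat) (l : nat) : subquot (forms R n k) :=
  SubQuot (@cocycle R n k l) (@coboundary R n k l).

(* The class of [Psi f] in H^n is that of [f vol] up to terms of lower
   polynomial degree: it is the class of [(f + h) vol] with [h] in [A] and
   deg h < deg f ([msize] is 1 + degree; [h = 0] when [f] is constant).
   The correction is needed: [dform] is not homogeneous, so [f |-> [f vol]] does
   not itself factor through the quotient that H^n is identified with. For
   n = k = 1, c_1 = z^2 w and z^4 w^2 vol = 3 z^2 vol - dform (z^3 w) is not a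
   coboundary. *)
Definition leading_term_vol (R : realType) (n k : nat) (A : Pk R n k -> Prop)
    (Psi : Pk R n k -> forms R n k) : Prop :=
  forall f, A f ->
    exists h, [/\ A h, (msize h <= (msize f).-1)%N &
                  coboundary n (Psi f - pscale (f + h) (vol R n k))].

(* Main.v *)
(** The differential is d = - (q /\ _) + L, where q = sum_a q_a omega_a raises the
    polynomial degree by 2 while L = sum_a omega_a /\ sum_j d^2/dz_aj dw_j lowers
    it. Hence exactness of q /\ _ on invariant forms passes to d, and classes are
    detected by leading terms. For a weight in which z_aa is heavy, q_a has leading
    term z_aa w_a (a <= min(n,k)), so q /\ _ is exact on P_k-forms of degree
    < min(n,k); an invariant primitive is obtained from any primitive by orthogonal
    projection for Fischer's inner product, on which O(n) acts by isometries.

    SO(n)-invariant forms split into O(n)-invariant and det-semi-invariant ones. For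
    k <= n the O(n)-invariant forms are Theta(b) = sum_J b_J phi^J with b_J in S_k: at
    real points, a reflection fixing the k vectors kills the contraction with any
    normal vector, which gives the formula after multiplication by a power of the
    Gram determinant; this power is divided out by means of two coprime minors of z.
    As q /\ Theta(b) = Theta(w /\ b), this part contributes R_k phi_k. The Hodge star
    maps the det-semi-invariant forms to the Theta(b) again, and q /\ _ to the
    contraction with (c_1, ..., c_k), which is a regular sequence; this contributes
    S_k/(c) vol. Psi f is (f - p) vol with p the orthogonal projection of f on the
    ideal. *)

Require Import Defs.
From HB Require Import structures.
From mathcomp Require Import all_boot all_order all_algebra.
From mathcomp Require Import fingroup perm zify ring.
From mathcomp Require Import ssrcomplements reals complex mpoly.
From mathcomp Require boolp.
Set Implicit Arguments.
Unset Strict Implicit.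
Unset Printing Implicit Defensive.
Import Order.TTheory GRing.Theory Num.Theory.
Local Open Scope ring_scope.

(** * Exterior algebra over a commutative ring *)

(** The group enters only through elements that can be written down: reflections normal to the
    vectors at points with natural coordinates, which are Zariski dense; one fixed reflection, which
    separates the two characters of O(n)/SO(n); and rotations with rational entries. The rotations
    serve d^2 = 0: the components of d do not commute, and their commutator vanishes against
    invariant forms only by so(n)-invariance, which is read off as the coefficient of X in a
    polynomial curve of scaled rotations.

    Every exactness statement, for q, for c and for the two minors, has one source: leading
    monomials that are pairwise coprime, for which contraction with division is an explicit
    homotopy.

    When k = n there is no room for two windows of k rows. Covariants are then established in
    degrees 1 and n, the ones that enter, from the divisibility of det-semi-invariant polynomials by
    det z; the coprime minors are those of size n - 1.

    [Psi] has to be linear although d is inhomogeneous. This works because a polynomial orthogonal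
    to a homogeneous ideal and with leading component in it is zero. *)

Notation KF A N := {ffun {set 'I_N} -> (A : comNzRingType)^o}.

Section Signs.
Variables (A : comNzRingType) (N : nat).
Definition sg (a : 'I_N) (U : {set 'I_N}) : A := (-1) ^+ #|[set b in U | (b < a)%N]|.
Definition vsgn (U : {set 'I_N}) : A := (-1) ^+ (\sum_(b in U) (b : nat))%N.
End Signs.

HB.lock Definition ext (A : comNzRingType) (N : nat) (a : 'I_N) (eta : KF A N) : KF A N :=
  [ffun U : {set 'I_N} => if a \in U then sg A a U * eta (U :\ a) else 0].
HB.lock Definition int (A : comNzRingType) (N : nat) (a : 'I_N) (eta : KF A N) : KF A N :=
  [ffun U : {set 'I_N} => if a \in U then 0 else sg A a U * eta (a |: U)].
(* The sign [vsgn] makes [star \o ext a = int a \o star] hold without sign. *)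
HB.lock Definition star (A : comNzRingType) (N : nat) (eta : KF A N) : KF A N :=
  [ffun U : {set 'I_N} => vsgn A U * eta (~: U)].
HB.lock Definition extv (A : comNzRingType) (N : nat) (x : 'rV[A]_N) (eta : KF A N) : KF A N :=
  \sum_a x 0 a *: ext a eta.
HB.lock Definition intv (A : comNzRingType) (N : nat) (x : 'rV[A]_N) (eta : KF A N) : KF A N :=
  \sum_a x 0 a *: int a eta.

Section Exterior.
Variables (A : comNzRingType) (N : nat).
Implicit Types (a b : 'I_N) (U S : {set 'I_N}) (eta theta : KF A N).
Implicit Types (x y : 'rV[A]_N).

Local Notation sg := (@sg A N).
Local Notation vsgn := (@vsgn A N).
Local Notation ext := (@ext A N).
Local Notation int := (@int A N).
Local Notation star := (@star A N).
Local Notation extv := (@extv A N).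
Local Notation intv := (@intv A N).

Lemma sgU1 a b U : b \notin U ->
  sg a (b |: U) = (if (b < a)%N then - sg a U else sg a U).
Proof.
move=> bU; rewrite /sg.
have -> : [set c in b |: U | (c < a)%N] =
    if (b < a)%N then b |: [set c in U | (c < a)%N] else [set c in U | (c < a)%N].
  apply/setP=> c; rewrite !inE; case: ifP => ba; rewrite !inE.
    by case: eqP => [->|] //=; rewrite ba.
  by case: eqP => [->|] //=; rewrite ba (negbTE bU).
case: ifP => // ba; rewrite cardsU1 inE (negbTE bU) /= add1n exprS mulN1r //.
Qed.

Lemma sgD1 a b U : b \in U ->
  sg a (U :\ b) = (if (b < a)%N then - sg a U else sg a U).
Proof.
move=> bU; have := sgU1 a (b := b) (U := U :\ b).
by rewrite setD1K // setD11 => /(_ isT) ->; case: (b < a)%N; rewrite ?opprK.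
Qed.

Lemma sgK a U : sg a U * sg a U = 1.
Proof. by rewrite /sg -exprD addnn -mul2n exprM sqrrN expr1n expr1n. Qed.

Lemma extE a eta U : ext a eta U = if a \in U then sg a U * eta (U :\ a) else 0.
Proof. by rewrite ext.unlock ffunE. Qed.
Lemma intE a eta U : int a eta U = if a \in U then 0 else sg a U * eta (a |: U).
Proof. by rewrite int.unlock ffunE. Qed.
Lemma starE eta U : star eta U = vsgn U * eta (~: U).
Proof. by rewrite star.unlock ffunE. Qed.
Lemma extvE x eta : extv x eta = \sum_a x 0 a *: ext a eta.
Proof. by rewrite extv.unlock. Qed.
Lemma intvE x eta : intv x eta = \sum_a x 0 a *: int a eta.
Proof. by rewrite intv.unlock. Qed.

Fact ext_linear a : linear (ext a).
Proof.
move=> c u v; apply/ffunP=> U; rewrite !(ffunE, extE, intE, starE); case: ifP => _.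
  by rewrite /GRing.scale /= mulrDr mulrCA.
by rewrite /GRing.scale /= mulr0 addr0.
Qed.
HB.instance Definition _ a :=
  GRing.isLinear.Build A (KF A N) (KF A N) *:%R (ext a) (ext_linear a).

Fact int_linear a : linear (int a).
Proof.
move=> c u v; apply/ffunP=> U; rewrite !(ffunE, extE, intE, starE); case: ifP => _.
  by rewrite /GRing.scale /= mulr0 addr0.
by rewrite /GRing.scale /= mulrDr mulrCA.
Qed.
HB.instance Definition _ a :=
  GRing.isLinear.Build A (KF A N) (KF A N) *:%R (int a) (int_linear a).

Lemma extC a b eta : ext a (ext b eta) = - ext b (ext a eta).
Proof.
apply/ffunP=> U; rewrite !(ffunE, extE, intE, starE) !inE.
have [->|ab] := eqVneq a b; first by case: ifP => _; rewrite ?eqxx /= ?mulr0 ?oppr0.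
rewrite /=.
case aU : (a \in U); case bU : (b \in U); rewrite ?mulr0 ?oppr0 //.
rewrite !sgD1 // setDDl [in RHS]setDDl (setUC [set a]).
case: (ltngtP a b) => [h|h|/val_inj h]; last by rewrite h eqxx in ab.
- by rewrite mulNr mulrN mulrCA.
- by rewrite mulNr mulrN opprK mulrCA.
Qed.

Lemma extint a b eta : ext a (int b eta) + int b (ext a eta) = (a == b)%:R *: eta.
Proof.
apply/ffunP=> U; rewrite !(ffunE, extE, intE, starE) !inE /GRing.scale /=.
have [<-|ab] := eqVneq a b.
  rewrite /= mul1r; case aU : (a \in U); rewrite ?addr0 ?add0r.
    by rewrite setD1K // sgD1 // ltnn mulrA sgK mul1r.
  by rewrite setU1K ?aU // sgU1 ?aU // ltnn mulrA sgK mul1r.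
rewrite mul0r.
case aU : (a \in U); case bU : (b \in U); rewrite ?mulr0 ?addr0 //= ?(eq_sym b) ?(negbTE ab) //= ?mulr0 ?addr0 //.
have -> : (b |: U) :\ a = b |: U :\ a.
  by rewrite setDUl; congr (_ :|: _); apply/setDidPl; rewrite disjoints1 inE eq_sym.
rewrite sgD1 // sgU1 ?bU //.
case: (ltngtP a b) => [h|h|/val_inj h]; last by rewrite h eqxx in ab.
- by rewrite mulNr mulrN mulrCA addNr.
- by rewrite mulNr mulrN mulrCA addrN.
Qed.

Fact star_linear : linear star.
Proof.
move=> c u v; apply/ffunP=> U; rewrite !(ffunE, extE, intE, starE) /GRing.scale /=.
by rewrite mulrDr mulrCA.
Qed.
HB.instance Definition _ :=
  GRing.isLinear.Build A (KF A N) (KF A N) *:%R star star_linear.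

Lemma card_lt a : #|[set b : 'I_N | (b < a)%N]| = a.
Proof.
rewrite cardsE -sum1_card -(big_ord_widen N (fun=> 1%N)) ?sum1_card ?card_ord //.
exact: ltnW.
Qed.

Lemma sgC a U : a \notin U -> sg a U * sg a (~: U) = (-1) ^+ a.
Proof.
move=> aU; rewrite /sg -exprD -cardsUI.
rewrite [X in (_ + X)%N](_ : _ = 0%N) ?addn0.
  congr (_ ^+ _); rewrite -[RHS]card_lt; congr #|pred_of_set _|.
  by apply/setP=> b; rewrite !inE -andb_orl orbN.
by apply/eqP; rewrite cards_eq0 -subset0; apply/subsetP=> b; rewrite !inE => /andP[/andP[-> _]].
Qed.

(** Adding a to U changes [vsgn] by (-1)^a, and by [sgC] this is the product of the signs of a
    relative to U and to its complement; hence the sum over the elements of U in [vsgn]. *)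
Lemma star_ext a eta : star (ext a eta) = int a (star eta).
Proof.
apply/ffunP=> U; rewrite !(ffunE, extE, intE, starE) !inE; case aU : (a \in U); rewrite ?mulr0 //=.
rewrite setCU setIC -setDE mulrA mulrA; congr (_ * _).
rewrite /vsgn big_setU1 ?aU //= exprD mulrA.
rewrite -(sgC (a := a) (U := U)) ?aU // mulrA sgK mul1r mulrC.
by [].
Qed.

Lemma vsgnC U : vsgn U * vsgn (~: U) = vsgn setT.
Proof.
rewrite /vsgn -exprD; congr (_ ^+ _).
rewrite [RHS](eq_bigl xpredT); last by move=> b; rewrite inE.
rewrite [RHS](bigID (mem U)) /=; congr (_ + _)%N.
by apply: eq_bigl => b; rewrite inE.
Qed.

Lemma starK eta : star (star eta) = vsgn setT *: eta.
Proof. by apply/ffunP=> U; rewrite !(ffunE, extE, intE, starE) setCK mulrA vsgnC. Qed.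

Lemma vsgnTK : vsgn setT * vsgn setT = 1.
Proof. by rewrite /vsgn -exprD addnn -mul2n exprM sqrrN expr1n expr1n. Qed.

Lemma star_int a eta : star (int a eta) = ext a (star eta).
Proof.
have -> : eta = vsgn setT *: star (star eta).
  by rewrite starK scalerA vsgnTK scale1r.
rewrite !linearZ /= -star_ext !starK !linearZ /= !scalerA vsgnTK !scale1r.
by [].
Qed.

Lemma starKK eta : star (vsgn setT *: star eta) = eta.
Proof. by rewrite linearZ /= starK scalerA vsgnTK scale1r. Qed.

Lemma star_inj : injective star.
Proof.
move=> u v /(congr1 star); rewrite !starK => /(congr1 (GRing.scale (vsgn setT))).
by rewrite !scalerA vsgnTK !scale1r.
Qed.

Lemma intext a b eta : int a (ext b eta) = (a == b)%:R *: eta - ext b (int a eta).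
Proof. by rewrite eq_sym -extint addrC addKr. Qed.

Fact extv_linear x : linear (extv x).
Proof.
move=> c u v; rewrite !extvE scaler_sumr -big_split; apply: eq_bigr => a _ /=.
by rewrite linearP scalerDr !scalerA mulrC.
Qed.
HB.instance Definition _ x :=
  GRing.isLinear.Build A (KF A N) (KF A N) *:%R (extv x) (extv_linear x).

Fact intv_linear x : linear (intv x).
Proof.
move=> c u v; rewrite !intvE scaler_sumr -big_split; apply: eq_bigr => a _ /=.
by rewrite linearP scalerDr !scalerA mulrC.
Qed.
HB.instance Definition _ x :=
  GRing.isLinear.Build A (KF A N) (KF A N) *:%R (intv x) (intv_linear x).

Lemma extvDl x y eta : extv (x + y) eta = extv x eta + extv y eta.
Proof. by rewrite !extvE -big_split; apply: eq_bigr => a _; rewrite mxE scalerDl. Qed.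
Lemma extvZl p x eta : extv (p *: x) eta = p *: extv x eta.
Proof. by rewrite !extvE scaler_sumr; apply: eq_bigr => a _; rewrite mxE scalerA. Qed.
Lemma intvDl x y eta : intv (x + y) eta = intv x eta + intv y eta.
Proof. by rewrite !intvE -big_split; apply: eq_bigr => a _; rewrite mxE scalerDl. Qed.
Lemma intvZl p x eta : intv (p *: x) eta = p *: intv x eta.
Proof. by rewrite !intvE scaler_sumr; apply: eq_bigr => a _; rewrite mxE scalerA. Qed.
Lemma extvBl x y eta : extv (x - y) eta = extv x eta - extv y eta.
Proof. by rewrite extvDl -[- y]scaleN1r extvZl scaleN1r. Qed.
Lemma intvBl x y eta : intv (x - y) eta = intv x eta - intv y eta.
Proof. by rewrite intvDl -[- y]scaleN1r intvZl scaleN1r. Qed.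

Lemma extv_delta a eta : extv (delta_mx 0 a) eta = ext a eta.
Proof.
rewrite !extvE (bigD1 a) //= mxE !eqxx scale1r big1 ?addr0 // => b ba.
by rewrite mxE eqxx /= (negbTE ba) scale0r.
Qed.
Lemma intv_delta a eta : intv (delta_mx 0 a) eta = int a eta.
Proof.
rewrite !intvE (bigD1 a) //= mxE !eqxx scale1r big1 ?addr0 // => b ba.
by rewrite mxE eqxx /= (negbTE ba) scale0r.
Qed.

Lemma star_extv x eta : star (extv x eta) = intv x (star eta).
Proof. by rewrite extvE intvE linear_sum; apply: eq_bigr => a _; rewrite linearZ /= star_ext. Qed.
Lemma star_intv x eta : star (intv x eta) = extv x (star eta).
Proof. by rewrite extvE intvE linear_sum; apply: eq_bigr => a _; rewrite linearZ /= star_int. Qed.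

Lemma extv_extv x y eta :
  extv x (extv y eta) = \sum_a \sum_b (x 0 a * y 0 b) *: ext a (ext b eta).
Proof.
rewrite [LHS]extvE; apply: eq_bigr => a _; rewrite extvE linear_sum scaler_sumr.
by apply: eq_bigr => b _; rewrite linearZ /= scalerA.
Qed.

Lemma extvC x y eta : extv x (extv y eta) = - extv y (extv x eta).
Proof.
rewrite !extv_extv exchange_big -sumrN; apply: eq_bigr => b _ /=.
by rewrite -sumrN; apply: eq_bigr => a _; rewrite extC scalerN mulrC.
Qed.

(** [extvC] only gives twice this, and 2 may be a zero divisor: the terms (a, b) and (b, a) are
    cancelled in pairs, and the diagonal ones vanish separately. *)
Lemma extvv x eta : extv x (extv x eta) = 0.
Proof.
have dia a : ext a (ext a eta) = 0.
  apply/ffunP=> U; rewrite !(ffunE, extE, intE, starE) !inE eqxx /=; case: ifP => // _.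
  by rewrite mulr0.
pose F (p : 'I_N * 'I_N) := (x 0 p.1 * x 0 p.2) *: ext p.1 (ext p.2 eta).
transitivity (\sum_(p : 'I_N * 'I_N) F p).
  by rewrite extv_extv pair_big_dep.
rewrite (bigID (fun p : 'I_N * 'I_N => (p.1 < p.2)%N)) /=.
rewrite [X in _ + X](bigID (fun p : 'I_N * 'I_N => (p.2 < p.1)%N)) /=.
rewrite [X in _ + (_ + X)]big1 ?addr0; last first.
  move=> [a b] /=; rewrite -!leqNgt => /andP[h1 h2].
  have -> : a = b by apply/val_inj/eqP; rewrite eqn_leq h1 h2.
  by rewrite /F /= dia scaler0.
rewrite [X in _ + X](reindex (fun p : 'I_N * 'I_N => (p.2, p.1))) /=; last first.
  by exists (fun p : 'I_N * 'I_N => (p.2, p.1)) => -[].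
rewrite [X in _ + X](eq_bigl (fun p : 'I_N * 'I_N => (p.1 < p.2)%N)); last first.
  by move=> [a b] /=; rewrite -leqNgt; case: (ltngtP a b).
rewrite -big_split big1 //= => -[a b] _ /=; rewrite /F /=.
by rewrite extC mulrC scalerN addNr.
Qed.

Lemma intvv x eta : intv x (intv x eta) = 0.
Proof. by apply: star_inj; rewrite linear0 !star_intv extvv. Qed.

Lemma intv_extv x y eta :
  intv x (extv y eta) = (\sum_a x 0 a * y 0 a) *: eta - extv y (intv x eta).
Proof.
rewrite !intvE !extvE.
transitivity (\sum_a \sum_b (x 0 a * y 0 b) *: ((a == b)%:R *: eta - ext b (int a eta))).
  apply: eq_bigr => a _; rewrite linear_sum scaler_sumr; apply: eq_bigr => b _.
  by rewrite linearZ /= scalerA intext.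
rewrite scaler_suml.
have -> : \sum_b y 0 b *: ext b (\sum_a x 0 a *: int a eta) =
   \sum_a \sum_b (x 0 a * y 0 b) *: ext b (int a eta).
  rewrite exchange_big; apply: eq_bigr => b _; rewrite linear_sum scaler_sumr.
  by apply: eq_bigr => a _; rewrite linearZ /= scalerA mulrC.
rewrite -sumrB; apply: eq_bigr => a _.
under eq_bigr => b _ do rewrite scalerBr.
rewrite sumrB; congr (_ - _).
rewrite (bigD1 a) //= eqxx scale1r big1 ?addr0 // => b ba.
by rewrite eq_sym (negbTE ba) scale0r scaler0.
Qed.

Definition dlt S : KF A N := [ffun U : {set 'I_N} => (U == S)%:R].

Lemma ext_dlt a S : ext a (dlt S) = if a \in S then 0 else sg a S *: dlt (a |: S).
Proof.
apply/ffunP=> U; rewrite !(ffunE, extE, intE, starE); case aS : (a \in S); rewrite !ffunE.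
  case: ifP => // aU; rewrite (_ : (U :\ a == S) = false) ?mulr0 //.
  by apply/eqP=> /setP/(_ a); rewrite !inE eqxx aS.
rewrite /GRing.scale /=.
case: (boolP (a \in U)) => aU.
  have -> : (U :\ a == S) = (U == a |: S).
    apply/eqP/eqP => [<-|->]; first by rewrite setD1K.
    by rewrite setU1K ?aS.
  by case: eqP => [->|]; rewrite ?mulr0 ?mulr1 ?sgU1 ?aS ?ltnn.
case: eqP => [e|]; rewrite ?mulr0 //.
by rewrite e !inE eqxx in aU.
Qed.

Lemma dlt_sum eta : eta = \sum_S eta S *: dlt S.
Proof.
apply/ffunP=> U; rewrite sum_ffunE (bigD1 U) //= !(ffunE, extE, intE, starE) eqxx /GRing.scale /= mulr1.
rewrite big1 ?addr0 // => S SU; rewrite !(ffunE, extE, intE, starE) eq_sym (negbTE SU); apply: mulr0.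
Qed.

(** Forms arise from the unit form by sums, scalings and the [ext a], so identities between
    operators are checked on these generators, without an algebra structure on forms. *)
Lemma KF_ind (P : KF A N -> Prop) :
  P (dlt set0) -> (forall u v, P u -> P v -> P (u + v)) ->
  (forall c u, P u -> P (c *: u)) -> (forall a u, P u -> P (ext a u)) ->
  forall eta, P eta.
Proof.
move=> P1 PD PZ Pe eta.
have P0 : P 0 by rewrite -(scale0r (dlt set0)); apply: PZ.
have Pd m S : #|S| = m -> P (dlt S).
  elim: m S => [|m IH] S; first by move/eqP; rewrite cards_eq0 => /eqP->.
  move=> Sm; have /card_gt0P[a aS] : (0 < #|S|)%N by rewrite Sm.
  have -> : dlt S = sg a (S :\ a) *: ext a (dlt (S :\ a)).
    by rewrite ext_dlt !inE eqxx /= setD1K // scalerA sgK scale1r.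
  apply/PZ/Pe/IH; have := cardsD1 a S; rewrite aS Sm; by case.
rewrite (dlt_sum eta); apply: big_ind => // S _; exact/PZ/(Pd _ _ erefl).
Qed.

Definition isdeg l eta := [forall S : {set 'I_N}, (eta S != 0) ==> (#|S| == l)].

End Exterior.

Section Degree.
Variables (A : comNzRingType) (N : nat).
Implicit Types (eta theta : KF A N) (x : 'rV[A]_N) (S U : {set 'I_N}) (l : nat).

Lemma isdegP (l : nat) eta : isdeg l eta <-> (forall S : {set 'I_N}, #|S| != l -> eta S = 0).
Proof.
split=> [/forallP h S Sl|h].
  by apply/eqP; apply: contraNT Sl => e; apply: (implyP (h S)).
by apply/forallP=> S; apply/implyP; apply: contraNT => /h ->.
Qed.

Lemma isdeg0 l : isdeg l (0 : KF A N).
Proof. by apply/isdegP=> S _; rewrite !(ffunE, extE, intE, starE). Qed.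
Lemma isdegD l eta theta : isdeg l eta -> isdeg l theta -> isdeg l (eta + theta).
Proof.
move=> /isdegP h1 /isdegP h2; apply/isdegP=> S Sl.
by rewrite !(ffunE, extE, intE, starE) h1 ?h2 ?addr0.
Qed.
Lemma isdegZ l c eta : isdeg l eta -> isdeg l (c *: eta).
Proof.
by move=> /isdegP h1; apply/isdegP=> S Sl; rewrite !(ffunE, extE, intE, starE) h1 //; apply: mulr0.
Qed.
Lemma isdegB l eta theta : isdeg l eta -> isdeg l theta -> isdeg l (eta - theta).
Proof. by move=> h1 h2; rewrite -scaleN1r; apply/isdegD/isdegZ. Qed.
Lemma isdeg_sum l (I : Type) (r : seq I) (P : pred I) (F : I -> KF A N) :
  (forall i, P i -> isdeg l (F i)) -> isdeg l (\sum_(i <- r | P i) F i).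
Proof. by move=> h; apply: (big_ind (isdeg l)) => //; [exact: isdeg0|exact: isdegD]. Qed.

Lemma isdeg_dlt S : isdeg #|S| (dlt A S).
Proof. by apply/isdegP=> U US; rewrite !(ffunE, extE, intE, starE); case: (eqVneq U S) US => // ->; rewrite eqxx. Qed.

Lemma isdeg_ext a l eta : isdeg l eta -> isdeg l.+1 (ext a eta).
Proof.
move=> /isdegP h; apply/isdegP=> S Sl; rewrite !(ffunE, extE, intE, starE); case: ifP => // aS.
rewrite h ?mulr0 //; apply: contraNneq Sl => <-.
by rewrite (cardsD1 a S) aS.
Qed.
Lemma isdeg_int a l eta : isdeg l.+1 eta -> isdeg l (int a eta).
Proof.
move=> /isdegP h; apply/isdegP=> S Sl; rewrite !(ffunE, extE, intE, starE); case: ifP => // aS.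
by rewrite h ?mulr0 // cardsU1 aS.
Qed.
Lemma isdeg_extv x l eta : isdeg l eta -> isdeg l.+1 (extv x eta).
Proof. by move=> h; rewrite extvE; apply: isdeg_sum => a _; apply/isdegZ/isdeg_ext. Qed.
Lemma isdeg_intv x l eta : isdeg l.+1 eta -> isdeg l (intv x eta).
Proof. by move=> h; rewrite intvE; apply: isdeg_sum => a _; apply/isdegZ/isdeg_int. Qed.

Lemma isdeg_star l eta : isdeg l eta -> isdeg (N - l)%N (star eta).
Proof.
move=> /isdegP h; apply/isdegP=> S Sl; rewrite starE h ?mulr0 //.
apply: contraNneq Sl => <-; have := cardsC S; rewrite card_ord => e.
by apply/eqP; rewrite -[LHS](addnK #|~: S|) e.
Qed.

Lemma isdeg_gt l eta : (N < l)%N -> isdeg l eta -> eta = 0.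
Proof.
move=> Nl /isdegP h; apply/ffunP=> S; rewrite !(ffunE, extE, intE, starE) h //.
by rewrite neq_ltn (leq_ltn_trans (max_card _)) ?card_ord.
Qed.

(** Each a in S returns the coefficient at S once. The identity recovers a form from its
    contractions, which drives the induction on the degree in [cov_gram]. *)
Lemma euler l eta : isdeg l eta -> \sum_a ext a (int a eta) = l%:R *: eta.
Proof.
move=> /isdegP h; apply/ffunP=> S; rewrite sum_ffunE ffunE.
have [Sl|/h e] := eqVneq #|S| l; last first.
  rewrite e [RHS]mulr0 big1 // => a _; rewrite !(ffunE, extE, intE, starE); case: ifP => // aS.
  by rewrite !inE eqxx /= setD1K // e !mulr0.
transitivity (\sum_(a in S) eta S).
  rewrite [RHS]big_mkcond; apply: eq_bigr => a _; rewrite !(ffunE, extE, intE, starE); case: ifP => // aS.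
  by rewrite !inE eqxx /= setD1K // sgD1 // ltnn mulrA sgK mul1r.
by rewrite sumr_const Sl scaler_nat.
Qed.

Lemma isdegT eta : isdeg N eta -> eta = eta setT *: dlt A setT.
Proof.
move=> /isdegP h; apply/ffunP=> S; rewrite !(ffunE, extE, intE, starE) /GRing.scale /=.
case: eqP => [->|/eqP ST]; first by rewrite mulr1.
rewrite mulr0 h //; apply: contraNneq ST => e; rewrite eqEcard subsetT cardsT card_ord.
by rewrite /= e.
Qed.

Lemma intv_dlt0 x : intv x (dlt A set0) = 0.
Proof.
rewrite intvE big1 // => a _; apply/ffunP=> U; rewrite !(ffunE, extE, intE, starE); case: ifP => _; first exact: mulr0.
rewrite (_ : (a |: U == set0) = false) ?mulr0; first by apply: mulr0.
by apply/eqP=> /setP/(_ a); rewrite !inE eqxx.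
Qed.

Lemma dlt0_isdeg eta : isdeg 0 eta -> eta = eta set0 *: dlt A set0.
Proof.
move=> /isdegP h; apply/ffunP=> S; rewrite !(ffunE, extE, intE, starE) /GRing.scale /=.
case: eqP => [->|/eqP ST]; first by rewrite mulr1.
by rewrite mulr0 h // cards_eq0.
Qed.

(** Degree l - 1 without truncation: for l = 0 only the zero form qualifies, so that primitives of
    forms of degree l can be treated uniformly. *)
Definition isdeg1 l eta := [forall S : {set 'I_N}, (eta S != 0) ==> (#|S|.+1 == l)].

Lemma isdeg1P (l : nat) eta :
  isdeg1 l eta <-> (forall S : {set 'I_N}, #|S|.+1 != l -> eta S = 0).
Proof.
split=> [/forallP h S Sl|h].
  by apply/eqP; apply: contraNT Sl => e; apply: (implyP (h S)).
by apply/forallP=> S; apply/implyP; apply: contraNT => /h ->.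
Qed.

Lemma isdeg1S l eta : isdeg1 l.+1 eta = isdeg l eta.
Proof. by apply: eq_forallb => S; rewrite eqSS. Qed.

Lemma isdeg1_0 eta : isdeg1 0 eta -> eta = 0.
Proof. by move=> /isdeg1P h; apply/ffunP=> S; rewrite ffunE h. Qed.

Lemma isdeg10 l : isdeg1 l (0 : KF A N).
Proof. by apply/isdeg1P=> S _; rewrite ffunE. Qed.

Lemma isdeg1D l eta theta : isdeg1 l eta -> isdeg1 l theta -> isdeg1 l (eta + theta).
Proof.
move=> /isdeg1P h1 /isdeg1P h2; apply/isdeg1P=> S Sl.
by rewrite ffunE h1 ?h2 ?addr0.
Qed.

Lemma isdeg1_extv x l eta : isdeg1 l eta -> isdeg l (extv x eta).
Proof.
case: l => [/isdeg1_0 ->|l]; first by rewrite linear0 isdeg0.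
by rewrite isdeg1S; apply: isdeg_extv.
Qed.

(** Scalars enter only at the unit form, so the principle serves properties not stable under
    multiplication by A, such as identities for Fischer's product. *)
Lemma KF_ind2 (Q : KF A N -> Prop) : (forall p, Q (p *: dlt A set0)) ->
  (forall u v, Q u -> Q v -> Q (u + v)) -> (forall a u, Q u -> Q (ext a u)) ->
  forall u, Q u.
Proof.
move=> Q1 QD Qe u.
have Q0 : Q 0 by rewrite -(scale0r (dlt A set0)).
have Qd m S p : #|S| = m -> Q (p *: dlt A S).
  elim: m S p => [|m IH] S p; first by move/eqP; rewrite cards_eq0 => /eqP->.
  move=> Sm; have /card_gt0P[a aS] : (0 < #|S|)%N by rewrite Sm.
  have -> : p *: dlt A S = ext a ((p * sg A a (S :\ a)) *: dlt A (S :\ a)).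
    by rewrite linearZ /= ext_dlt !inE eqxx /= setD1K // scalerA -mulrA sgK mulr1.
  apply/Qe/IH; have := cardsD1 a S; rewrite aS Sm; by case.
rewrite (dlt_sum u); apply: big_ind => // S _; exact: (Qd _ _ _ erefl).
Qed.

Lemma scE p eta S : (p *: eta) S = p * eta S.
Proof. by rewrite ffunE. Qed.

End Degree.

(** * Morphisms of exterior algebras and determinants *)

HB.lock Definition wprod (A : comNzRingType) (K N : nat) (h : 'M[A]_(K, N))
    (J : {set 'I_K}) : KF A N :=
  foldr (fun j eta => extv (row j h) eta) (dlt A set0) (enum J).
(* [wprod h J] is the product of the rows of [h] indexed by [J], so [Theta h] is
   the ring morphism of exterior algebras induced by [h]. *)
HB.lock Definition Theta (A : comNzRingType) (K N : nat) (h : 'M[A]_(K, N))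
    (b : KF A K) : KF A N := \sum_J b J *: wprod h J.

Section Wedge.
Variables (A : comNzRingType).

Section One.
Variables (K N : nat) (h : 'M[A]_(K, N)).

Local Notation wprod := (@wprod A K N h).
Local Notation Theta := (@Theta A K N h).

Lemma wprodE J :
  wprod J = foldr (fun j eta => extv (row j h) eta) (dlt A set0) (enum J).
Proof. by rewrite wprod.unlock. Qed.
Lemma ThetaE b : Theta b = \sum_J b J *: wprod J.
Proof. by rewrite Theta.unlock. Qed.

Fact Theta_linear : linear Theta.
Proof.
move=> c u v; rewrite !ThetaE scaler_sumr -big_split; apply: eq_bigr => J _ /=.
by rewrite !(ffunE, extE, intE, starE) scalerDl scalerA.
Qed.
HB.instance Definition _ :=
  GRing.isLinear.Build A (KF A K) (KF A N) *:%R Theta Theta_linear.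

Lemma Theta_dlt J : Theta (dlt A J) = wprod J.
Proof.
rewrite !ThetaE (bigD1 J) //= ffunE eqxx scale1r big1 ?addr0 // => S SJ.
by rewrite !(ffunE, extE, intE, starE) (negbTE SJ) scale0r.
Qed.

Lemma wprod0 : wprod set0 = dlt A set0.
Proof. by rewrite !wprodE enum_set0. Qed.

Lemma extv_foldr j s u :
  extv (row j h) (foldr (fun j eta => extv (row j h) eta) u s) =
  (-1) ^+ size s *: foldr (fun j eta => extv (row j h) eta) (extv (row j h) u) s.
Proof.
elim: s => [|i s IH] /=; first by rewrite scale1r.
by rewrite extvC IH linearZ /= exprS mulN1r scaleNr.
Qed.

Lemma foldr_extv0 s : foldr (fun j eta => extv (row j h) eta) 0 s = 0.
Proof. by elim: s => //= j s ->; rewrite linear0. Qed.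

Lemma enum_filterE (J : {set 'I_K}) : enum J = filter (mem J) (enum 'I_K).
Proof. by rewrite enumT. Qed.

(** The enumeration is cut at j. Moving the new factor past the elements of J below j costs one sign
    each, which is [sg A j J]; if j is already in J, two equal factors meet. *)
Lemma extv_wprod j J :
  extv (row j h) (wprod J) = if j \in J then 0 else sg A j J *: wprod (j |: J).
Proof.
set s1 := take j (enum 'I_K); set s2 := drop j.+1 (enum 'I_K).
have lj : (j < size (enum 'I_K))%N by rewrite size_enum_ord.
have E : enum 'I_K = s1 ++ j :: s2.
  by rewrite -[LHS](cat_take_drop j) (drop_nth j) // nth_ord_enum.
have h1 i : i \in s1 -> (i < j)%N.
  move=> /(nthP j)[m]; rewrite size_take lj => mj <-.
  by rewrite nth_take // nth_enum_ord // (ltn_trans mj).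
have h2 i : i \in s2 -> (j < i)%N.
  move=> /(nthP j)[m]; rewrite size_drop size_enum_ord => mj <-.
  rewrite nth_drop nth_enum_ord; first by rewrite addSn ltnS leq_addr.
  by rewrite -ltn_subRL.
have enumE (J' : {set 'I_K}) : enum J' = filter (mem J') s1 ++
    (if j \in J' then [:: j] else [::]) ++ filter (mem J') s2.
  rewrite enum_filterE E filter_cat /=; congr (_ ++ _); by case: ifP.
have key (J' : {set 'I_K}) : size (filter (mem J') s1) = #|[set i in J' | (i < j)%N]|.
  rewrite cardE [in RHS]enum_filterE E filter_cat /= !inE ltnn andbF.
  rewrite [X in _ ++ X](_ : _ = [::]) ?cats0; last first.
    apply/eqP; rewrite -(negbK (_ == _)) -has_filter; apply/hasPn=> i /h2 ij.
    by rewrite !inE ltnNge ltnW ?andbF.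
  congr size; apply: eq_in_filter => i /h1 ij; by rewrite !inE ij andbT.
rewrite !wprodE enumE !foldr_cat extv_foldr.
case: ifP => jJ.
  by rewrite /= extvv foldr_extv0 scaler0.
rewrite enumE !inE eqxx /= !foldr_cat /= key /sg.
congr (_ *: _).
have f1 s : j \notin s -> filter (mem (j |: J)) s = filter (mem J) s.
  by move=> js; apply: eq_in_filter => i is_; rewrite !inE; case: eqP is_ js => // -> ->.
rewrite !f1 //; first by apply/negP=> /h1; rewrite ltnn.
by apply/negP=> /h2; rewrite ltnn.
Qed.

End One.
End Wedge.

Section WedgeTheory.
Variables (A : comNzRingType).

Section One.
Variables (K N : nat) (h : 'M[A]_(K, N)).

Lemma Theta0 : Theta h (dlt A set0) = dlt A set0.
Proof. by rewrite Theta_dlt wprod0. Qed.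

Lemma Theta_ext j b : Theta h (ext j b) = extv (row j h) (Theta h b).
Proof.
rewrite {1}(dlt_sum b) 2!linear_sum /= [in RHS]ThetaE linear_sum; apply: eq_bigr => J _.
rewrite !linearZ /= ext_dlt extv_wprod; case: ifP => _; first by rewrite linear0.
by rewrite linearZ /= Theta_dlt.
Qed.

Lemma Theta_extv x b : Theta h (extv x b) = extv (x *m h) (Theta h b).
Proof.
rewrite [extv x b]extvE linear_sum.
transitivity (\sum_j \sum_a (x 0 j * h j a) *: ext a (Theta h b)).
  apply: eq_bigr => j _; rewrite linearZ /= Theta_ext extvE scaler_sumr.
  by apply: eq_bigr => a _; rewrite mxE scalerA.
rewrite exchange_big [RHS]extvE; apply: eq_bigr => a _; rewrite mxE scaler_suml //.
Qed.

(** Contraction is dual to multiplication, hence the transposed matrix; the induction rests on the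
    anticommutation rule [intv_extv]. *)
Lemma Theta_intv y b : intv y (Theta h b) = Theta h (intv (y *m h^T) b).
Proof.
move: b; apply: KF_ind => [|u v hu hv|c u hu|j u hu].
- by rewrite Theta0 !intv_dlt0 linear0.
- by rewrite !linearD /= hu hv.
- by rewrite !linearZ /= hu.
rewrite -extv_delta [in RHS]intv_extv linearB linearZ /= !Theta_extv intv_extv hu.
congr (_ *: _ - _).
rewrite -rowE (bigD1 j) //= [X in _ + X]big1 ?addr0 => [|i ij].
  by rewrite !mxE !eqxx mulr1; apply: eq_bigr => a _; rewrite !mxE.
by rewrite [delta_mx _ _ _ _]mxE eqxx (negbTE ij) mulr0.
Qed.

Lemma isdeg_wprod (J : {set 'I_K}) : isdeg #|J| (wprod h J).
Proof.
rewrite !wprodE cardE; elim: (enum J) => [|j s IH] /=; last exact: isdeg_extv.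
by have := @isdeg_dlt A N set0; rewrite cards0.
Qed.

Lemma isdeg_Theta l b : isdeg l b -> isdeg l (Theta h b).
Proof.
move=> /isdegP hb; rewrite ThetaE; apply: isdeg_sum => J _.
have [Jl|/hb ->] := eqVneq #|J| l; last by rewrite scale0r; apply: isdeg0.
by apply: isdegZ; rewrite -Jl; apply: isdeg_wprod.
Qed.

End One.

Lemma Theta_comp K M N (h : 'M[A]_(K, M)) (g : 'M[A]_(M, N)) b :
  Theta g (Theta h b) = Theta (h *m g) b.
Proof.
move: b; apply: KF_ind => [|u v hu hv|c u hu|j u hu].
- by rewrite !Theta0.
- by rewrite !linearD /= hu hv.
- by rewrite !linearZ /= hu.
by rewrite !Theta_ext Theta_extv hu row_mul.
Qed.

Lemma Theta_id N (b : KF A N) : Theta 1%:M b = b.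
Proof.
move: b; apply: KF_ind => [|u v hu hv|c u hu|j u hu].
- by rewrite Theta0.
- by rewrite linearD /= hu hv.
- by rewrite linearZ /= hu.
by rewrite Theta_ext hu row1 extv_delta.
Qed.

(** Restriction of forms to the coordinate hyperplane omitting a. It turns a product of rows into
    the product of the rows without column a, that is, into the minors of a Laplace expansion. *)
Definition pullf N (a : 'I_N.+1) (eta : KF A N.+1) : KF A N :=
  [ffun U : {set 'I_N} => eta (lift a @: U)].

Lemma pullf_extv N (a : 'I_N.+1) x (eta : KF A N.+1) :
  pullf a (extv x eta) = extv (col' a x) (pullf a eta).
Proof.
apply/ffunP=> U; rewrite ffunE !extvE !sum_ffunE (bigD1_ord a) //=.
have na : a \notin lift a @: U.
  by apply/imsetP => -[b _ /eqP]; rewrite (negbTE (neq_lift a b)).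
rewrite !(ffunE, extE, intE, starE) (negbTE na) [X in X + _]mulr0 add0r; apply: eq_bigr => b _.
rewrite !(ffunE, extE, intE, starE) !mxE; congr (_ * _); rewrite (mem_imset _ _ (@lift_inj _ a)).
case: ifP => // bU; congr (_ * _).
  congr (_ ^+ _); rewrite -[RHS](card_imset _ (@lift_inj _ a)).
  apply: eq_card => c; rewrite !inE; apply/andP/imsetP.
    move=> [/imsetP[d dU ->] lt]; exists d => //; rewrite inE dU /=.
    by move: lt; rewrite /= /bump; case: leqP; case: leqP; lia.
  move=> [d]; rewrite inE => /andP[dU lt] ->; split; first exact: imset_f.
  by move: lt; rewrite /= /bump; case: leqP; case: leqP; lia.
congr (eta _); apply/setP=> c; rewrite !inE; apply/andP/imsetP.
  move=> [cb /imsetP[d dU e]]; exists d => //; rewrite !inE dU andbT.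
  by apply: contraNneq cb => <-; rewrite e.
move=> [d]; rewrite !inE => /andP[db dU] ->; split; last exact: imset_f.
by rewrite (inj_eq (@lift_inj _ a)).
Qed.

(** The top coefficient of the product of the rows obeys Laplace expansion along row 0: the sign of
    a in the full set is (-1)^a, the cofactor sign. *)
Lemma Theta_det N (h : 'M[A]_N) : Theta h (dlt A setT) = \det h *: dlt A setT.
Proof.
have dT : isdeg N (dlt A [set: 'I_N]).
  by have := @isdeg_dlt A N setT; rewrite cardsT card_ord.
rewrite [LHS](isdegT (isdeg_Theta h dT)); congr (_ *: _); rewrite Theta_dlt {dT}.
rewrite !wprodE [enum _](_ : _ = enum 'I_N); last by apply: eq_enum => i; rewrite inE.
elim: N h => [|N IH] h.
  by rewrite det_mx00 enum_ord0 /= ffunE (_ : setT = set0) ?eqxx //; apply/setP=> -[].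
rewrite enum_ordSl /= foldr_map (expand_det_row _ ord0) extvE sum_ffunE; apply: eq_bigr => a _.
rewrite !(ffunE, extE, intE, starE) inE mxE; congr (_ * _); rewrite /cofactor add0n; congr (_ * _).
  rewrite /sg; congr (_ ^+ _); rewrite -[RHS](card_lt (N := N.+1)).
  by apply: eq_card => b; rewrite !inE.
set F := foldr _ _ _; have -> : F (setT :\ a) = pullf a F setT.
  rewrite !(ffunE, extE, intE, starE); congr (F _); apply/setP=> c; rewrite !inE andbT; apply/idP/imsetP.
    by rewrite eq_sym => /unlift_some[d -> _]; exists d; rewrite ?inE.
  by move=> [d _ ->]; rewrite eq_sym neq_lift.
rewrite -IH /F; congr (fun_of_fin _ _); elim: (enum 'I_N) => [|j s IHs] /=.
  by apply/ffunP=> U; rewrite !(ffunE, extE, intE, starE) imset_eq0.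
by rewrite pullf_extv IHs; congr (extv _ _); apply/rowP=> b; rewrite !mxE.
Qed.

End WedgeTheory.

HB.lock Definition mapf (A B : comNzRingType) (f : A -> B) (N : nat) (eta : KF A N) : KF B N :=
  [ffun U : {set 'I_N} => f (eta U)].

Section BaseChange.
Variables (A B : comNzRingType) (f : {rmorphism A -> B}).

Local Notation mapf := (@mapf A B f).

Lemma mapfE N (eta : KF A N) U : mapf eta U = f (eta U).
Proof. by rewrite mapf.unlock ffunE. Qed.

Fact mapf_additive N : additive (@mapf N).
Proof. by move=> u v; apply/ffunP=> U; rewrite !(ffunE, extE, intE, starE, mapfE) rmorphB. Qed.
HB.instance Definition _ N :=
  GRing.isAdditive.Build (KF A N) (KF B N) (@mapf N) (@mapf_additive N).

Lemma mapfZ N p (eta : KF A N) : mapf (p *: eta) = f p *: mapf eta.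
Proof. by apply/ffunP=> U; rewrite !(ffunE, extE, intE, starE, mapfE) /GRing.scale /= rmorphM. Qed.

Lemma mapf_dlt N (S : {set 'I_N}) : mapf (dlt A S) = dlt B S.
Proof. by apply/ffunP=> U; rewrite !(ffunE, extE, intE, starE, mapfE) rmorph_nat. Qed.

Lemma mapf_ext N a (eta : KF A N) : mapf (ext a eta) = ext a (mapf eta).
Proof.
apply/ffunP=> U; rewrite !(ffunE, extE, intE, starE, mapfE); case: ifP => _; last by rewrite rmorph0.
by rewrite rmorphM /sg rmorphXn rmorphN rmorph1.
Qed.

Lemma mapf_int N a (eta : KF A N) : mapf (int a eta) = int a (mapf eta).
Proof.
apply/ffunP=> U; rewrite !(ffunE, extE, intE, starE, mapfE); case: ifP => _; first by rewrite rmorph0.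
by rewrite rmorphM /sg rmorphXn rmorphN rmorph1.
Qed.

Lemma mapf_star N (eta : KF A N) : mapf (star eta) = star (mapf eta).
Proof.
by apply/ffunP=> U; rewrite !(ffunE, extE, intE, starE, mapfE) rmorphM /vsgn rmorphXn rmorphN rmorph1.
Qed.

Lemma mapf_extv N x (eta : KF A N) : mapf (extv x eta) = extv (map_mx f x) (mapf eta).
Proof.
by rewrite !extvE raddf_sum; apply: eq_bigr => a _; rewrite /= mapfZ mapf_ext mxE.
Qed.

Lemma mapf_intv N x (eta : KF A N) : mapf (intv x eta) = intv (map_mx f x) (mapf eta).
Proof.
by rewrite !intvE raddf_sum; apply: eq_bigr => a _; rewrite /= mapfZ mapf_int mxE.
Qed.

Lemma mapf_wprod K N (h : 'M[A]_(K, N)) (J : {set 'I_K}) : mapf (wprod h J) = wprod (map_mx f h) J.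
Proof.
rewrite !wprodE; elim: (enum J) => [|j s IH] /=; first exact: mapf_dlt.
by rewrite mapf_extv IH map_row.
Qed.

Lemma mapf_Theta K N (h : 'M[A]_(K, N)) b :
  mapf (Theta h b) = Theta (map_mx f h) (mapf b).
Proof.
by rewrite !ThetaE raddf_sum; apply: eq_bigr => J _; rewrite /= mapfZ mapf_wprod mapfE.
Qed.

Lemma isdeg_mapf N l (eta : KF A N) : isdeg l eta -> isdeg l (mapf eta).
Proof. by move=> /isdegP h; apply/isdegP=> S /h e; rewrite !(ffunE, extE, intE, starE, mapfE) e rmorph0. Qed.

End BaseChange.

(** * Filtrations and Koszul complexes *)

Section Weights.
Variables (F : fieldType) (v : nat) (mf : measure v).
Implicit Types (p q : {mpoly F[v]}) (m u : 'X_{1..v}).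

(** [mmeasure] is one more than the largest weight: the bound W means weights strictly below W, and
    W = 0 leaves only the zero polynomial. *)
Lemma mmeasure_leP W p :
  (mmeasure mf p <= W)%N <-> (forall m, (W <= mf m)%N -> p@_m = 0).
Proof.
split=> [h m Wm|h].
  by apply/memN_msupp_eq0/(mmeasure_mnm_ge (mf := mf))/(leq_trans h).
rewrite /mmeasure; apply/bigmax_leqP_seq => m; rewrite mcoeff_msupp => pm _.
by rewrite ltnNge; apply: contraNN pm => /h ->.
Qed.

Lemma mcoeff_pihomog d p m : (pihomog mf d p)@_m = if mf m == d then p@_m else 0.
Proof.
rewrite pihomogE raddf_sum /= (eq_bigr (fun m' => p@_m' * (m' == m)%:R)); last first.
  by move=> m' _; rewrite mcoeffZ mcoeffX.
have [pm|/memN_msupp_eq0 pm] := boolP (m \in msupp p); last first.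
  rewrite pm if_same big_seq_cond big1 // => m' /andP[m's _].
  by case: eqP => [e|]; rewrite ?mulr0 // e pm mul0r.
rewrite big_mkcond (bigD1_seq m) //= ?msupp_uniq // eqxx mulr1 big1 ?addr0 // => m' m'm.
by rewrite (negbTE m'm) mulr0 if_same.
Qed.

Lemma mmeasure_pihomog d p : (mmeasure mf (pihomog mf d p) <= d.+1)%N.
Proof.
apply/mmeasure_leP=> m; rewrite mcoeff_pihomog; case: eqP => // ->.
by rewrite ltnn.
Qed.

Lemma mmeasure_pihomog0 W p :
  (mmeasure mf p <= W.+1)%N -> pihomog mf W p = 0 -> (mmeasure mf p <= W)%N.
Proof.
move=> /mmeasure_leP h e; apply/mmeasure_leP=> m; rewrite leq_eqVlt => /predU1P[Wm|/h //].
by have := mcoeff_pihomog W p m; rewrite e mcoeff0 -Wm eqxx.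
Qed.

Lemma pihomog_idem d p : pihomog mf d (pihomog mf d p) = pihomog mf d p.
Proof. exact: pihomog_id. Qed.

Lemma mcoeff_mulX u p m :
  ('X_[u] * p)@_m = if (u <= m)%MM then p@_(m - u)%MM else 0.
Proof.
case: ifP => um; first by rewrite mulrC -{1}(submK um) addmC mcoeffMX.
rewrite mulrC; apply/memN_msupp_eq0; rewrite (perm_mem (msuppMX _ _)).
by apply/mapP=> -[m' _ e]; rewrite e lem_addr in um.
Qed.

Lemma pihomog_mulX W u p :
  pihomog mf (W + mf u) ('X_[u] * p) = 'X_[u] * pihomog mf W p.
Proof.
apply/mpolyP=> m; rewrite mcoeff_pihomog !mcoeff_mulX mcoeff_pihomog.
case: (boolP (u <= m)%MM) => um; last by rewrite if_same.
by rewrite -{1}(submK um) mfD eqn_add2r.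
Qed.

Lemma pihomog_mulX0 W u p : (W < mf u)%N -> pihomog mf W ('X_[u] * p) = 0.
Proof.
move=> Wu; apply/mpolyP=> m; rewrite mcoeff_pihomog mcoeff_mulX mcoeff0.
case: eqP => // mW; case: ifP => // um; move: Wu.
by rewrite -mW -(submK um) mfD ltnNge leq_addl.
Qed.

Lemma mmeasure_mul W1 W2 p q :
  (mmeasure mf p <= W1.+1)%N -> (mmeasure mf q <= W2.+1)%N ->
  (mmeasure mf (p * q) <= (W1 + W2).+1)%N.
Proof.
move=> h1 h2; rewrite /mmeasure; apply/bigmax_leqP_seq => m mpq _.
have /allpairsP[[m1 m2] /= [i1 i2 ->]] := msuppM_le mpq.
by rewrite mfD ltnS leq_add // -ltnS ?(leq_trans _ h1) ?(leq_trans _ h2) ?mmeasure_mnm_lt.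
Qed.

Lemma mmeasure_mul_lt e W p q :
  (mmeasure mf p <= e)%N -> (mmeasure mf q <= W.+1)%N ->
  (mmeasure mf (p * q) <= W + e)%N.
Proof.
case: e => [|e] h1 h2; last by rewrite addnS addnC; apply: mmeasure_mul.
by move: h1; rewrite leqn0 mmeasure_poly_eq0 => /eqP ->; rewrite mul0r mmeasure0.
Qed.

Lemma pihomog_big W p : (mmeasure mf p <= W)%N -> pihomog mf W p = 0.
Proof.
move=> /mmeasure_leP h; apply/mpolyP=> m; rewrite mcoeff_pihomog mcoeff0.
by case: eqP => // e; apply: h; rewrite e.
Qed.

Lemma mmeasureD_leW W p q :
  (mmeasure mf p <= W)%N -> (mmeasure mf q <= W)%N -> (mmeasure mf (p + q) <= W)%N.
Proof. by move=> h1 h2; apply: leq_trans (mmeasureD_le _ _ _) _; rewrite geq_max h1 h2. Qed.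

Lemma mmeasure_sum_leW W (I : Type) (r : seq I) (P : pred I) (G : I -> {mpoly F[v]}) :
  (forall i, P i -> mmeasure mf (G i) <= W)%N ->
  (mmeasure mf (\sum_(i <- r | P i) G i) <= W)%N.
Proof.
move=> h; apply: (big_ind (fun p => mmeasure mf p <= W)%N) => //.
  by rewrite mmeasure0.
exact: mmeasureD_leW.
Qed.

End Weights.

Section Coefs.
Variables (F : fieldType) (v : nat).
Implicit Types (p q : {mpoly F[v]}) (m u : 'X_{1..v}) (c : 'X_{1..v} -> F).

(** A diagonal operator on monomials, used to divide by the eigenvalues of the Koszul homotopy. *)
Definition cmul c p : {mpoly F[v]} := \sum_(m <- msupp p) (c m * p@_m) *: 'X_[m].

Lemma mcoeff_cmul c p m : (cmul c p)@_m = c m * p@_m.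
Proof.
rewrite raddf_sum /= (eq_bigr (fun m' => c m' * p@_m' * (m' == m)%:R)); last first.
  by move=> m' _; rewrite mcoeffZ mcoeffX.
have [pm|/memN_msupp_eq0 pm] := boolP (m \in msupp p); last first.
  rewrite pm mulr0 big_seq big1 // => m' m's.
  by case: eqP => [e|]; rewrite ?mulr0 // e pm mulr0 mul0r.
rewrite (bigD1_seq m) //= ?msupp_uniq // eqxx mulr1 big1 ?addr0 // => m' m'm.
by rewrite (negbTE m'm) mulr0.
Qed.

(** Terms not divisible by the monomial are dropped, so this is a left inverse of multiplication by
    it. *)
Definition mdivX u p : {mpoly F[v]} :=
  \sum_(m <- msupp p | (u <= m)%MM) p@_m *: 'X_[(m - u)%MM].

Lemma mcoeff_mdivX u p m : (mdivX u p)@_m = p@_(m + u)%MM.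
Proof.
rewrite raddf_sum /= (eq_bigr (fun m' => p@_m' * (m' == (m + u)%MM)%:R)); last first.
  move=> m' um; rewrite mcoeffZ mcoeffX -(eqm_add2r u); by rewrite submK.
have [pm|/memN_msupp_eq0 pm] := boolP ((m + u)%MM \in msupp p); last first.
  rewrite pm big_seq_cond big1 // => m' /andP[m's _].
  by case: eqP => [e|]; rewrite ?mulr0 // e pm mul0r.
rewrite big_mkcond (bigD1_seq (m + u)%MM) //= ?msupp_uniq // lem_addl eqxx mulr1.
by rewrite big1 ?addr0 // => m' m'm; rewrite (negbTE m'm) mulr0 if_same.
Qed.

End Coefs.

(** * Exactness of a filtered differential from that of its leading part *)

Section Filtration.
Variables (V : zmodType) (pr : nat -> V -> V) (F : nat -> V -> Prop).
Variables (d d0 : V -> V) (e : nat).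
Hypothesis prB : forall W u v, pr W (u - v) = pr W u - pr W v.
Hypothesis dB : forall u v, d (u - v) = d u - d v.
Hypothesis d00 : d0 0 = 0.
Hypothesis F0 : forall v, F 0 v -> v = 0.
Hypothesis Fex : forall v, exists W, F W v.
Hypothesis FS : forall W v, F W.+1 v -> pr W v = 0 -> F W v.
Hypothesis Fle : forall W W' v, (W <= W')%N -> F W v -> F W' v.
Hypothesis Fpr : forall W v, F W.+1 (pr W v).
Hypothesis prI : forall W v, pr W (pr W v) = pr W v.
Hypothesis pr0 : forall W v, F W v -> pr W v = 0.
Hypothesis FB : forall W u v, F W u -> F W v -> F W (u - v).
Hypothesis Fd : forall W v, F W.+1 v -> F (W + e).+1 (d v).
Hypothesis d0_pr : forall W v, d0 (pr W v) = pr (W + e) (d0 v).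
Hypothesis pr_d : forall W v, F W.+1 v -> pr (W + e) (d v) = d0 (pr W v).
Hypothesis pr_d0 : forall W v, (W < e)%N -> pr W (d0 v) = 0.

Let dz : d 0 = 0. Proof. by rewrite -[X in d X](subrr 0) dB subrr. Qed.
Let prz W : pr W 0 = 0. Proof. by rewrite -[X in pr W X](subrr 0) prB subrr. Qed.
Let dD u v : d (u + v) = d u + d v.
Proof. by rewrite -{1}[v]opprK dB -[- v]sub0r dB dz sub0r opprK. Qed.

(** [F W] stands for weight below W, [pr W] for the component of weight W, and d has leading part d0
    of weight e. The top component of a d-closed v is d0-closed, hence d0 w; subtracting d of the
    component of w of weight W - e lowers the weight of v. *)
Lemma filt_exact (C C' : V -> Prop) :
  (forall u v, C u -> C v -> C (u - v)) -> (forall W v, C v -> C (pr W v)) ->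
  (forall W v, C' v -> C' (pr W v)) -> C' 0 ->
  (forall u v, C' u -> C' v -> C' (u + v)) ->
  (forall v, C' v -> C (d v)) -> (forall v, C' v -> d (d v) = 0) ->
  (forall v, C v -> d0 v = 0 -> exists2 w, C' w & v = d0 w) ->
  forall v, C v -> d v = 0 -> exists2 w, C' w & v = d w.
Proof.
move=> CB Cpr C'pr C'0 C'D C'd C'dd ex0 v.
have [W] := Fex v; elim: W v => [|W IH] v.
  by move=> /F0 -> _ _; exists 0; rewrite ?dz.
move=> Fv Cv dv.
have [|w C'w ew] := ex0 (pr W v) (Cpr W v Cv).
  by rewrite -pr_d // dv prz.
suff [w1 C'w1 Fw1] : exists2 w1, C' w1 & F W (v - d w1).
  have [||w2 C'w2 e2] := IH _ Fw1; first exact/CB/C'd.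
    by rewrite dB dv C'dd // subrr.
  by exists (w1 + w2); [exact: C'D | rewrite dD -e2 addrC subrK].
(* For W < e no image of d0 has a component of weight W, so the top component of v is already
   zero. *)
have [eW|We] := leqP e W; last first.
  exists 0 => //; rewrite dz subr0; apply: FS => //.
  by rewrite -prI ew pr_d0.
exists (pr (W - e) w); first exact: C'pr.
have WE : (W - e + e = W)%N by rewrite subnK.
have := Fd (Fpr (W - e) w); have := pr_d (Fpr (W - e) w); rewrite WE => e1 F1.
apply: FS; first exact: FB.
by rewrite prB e1 prI d0_pr WE -ew prI subrr.
Qed.

(** The primitive w may have weight above W - e. Its top component is then d0-closed, since v has no
    component that high, and hence equal to d0 u. Subtracting d of a component of u leaves d w
    unchanged, by d d = 0, and lowers the weight of w until its leading part accounts for that of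
    v. *)
Lemma filt_lead (C' C'' : V -> Prop) :
  (forall u v, C' u -> C' v -> C' (u - v)) -> (forall W v, C' v -> C' (pr W v)) ->
  (forall W v, C'' v -> C'' (pr W v)) ->
  (forall v, C'' v -> C' (d v)) -> (forall v, C'' v -> d (d v) = 0) ->
  (forall v, C' v -> d0 v = 0 -> exists2 w, C'' w & v = d0 w) -> C' 0 ->
  forall W v w, F W.+1 v -> C' w -> v = d w ->
  exists2 w', C' w' & pr W v = d0 w'.
Proof.
move=> CB Cpr C''pr C''d C''dd ex0 C'0 W v w Fv.
have [W'] := Fex w; elim: W' w => [|W' IH] w.
  by move=> /F0 -> _ ->; exists 0; rewrite // dz prz d00.
move=> Fw C'w evw.
have := pr_d Fw; rewrite -evw.
have [<-|nW] := eqVneq (W' + e)%N W; first by move=> ->; exists (pr W' w) => //; apply: Cpr.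
(* If W' + e < W, then v itself has weight below W and the component is 0. *)
case: (ltngtP (W' + e) W) nW => // lt _ eq0.
  exists 0 => //; rewrite d00; apply: pr0.
  by have := Fd Fw; rewrite -evw; apply: Fle.
have z : d0 (pr W' w) = 0 by rewrite -eq0; apply: pr0; exact: Fle Fv.
have [u C''u eu] := ex0 _ (Cpr W' w C'w) z.
have [eW|We] := leqP e W'; last first.
  apply: (IH w) => //; apply: FS => //; by rewrite -prI eu pr_d0.
have WE : (W' - e + e = W')%N by rewrite subnK.
apply: (IH (w - d (pr (W' - e) u))).
- have := Fd (Fpr (W' - e) u); have := pr_d (Fpr (W' - e) u); rewrite WE => e1 F1.
  apply: FS; first exact: FB.
  by rewrite prB e1 prI d0_pr WE -eu prI subrr.
- by apply/CB/C''d/C''pr.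
- by rewrite dB C''dd ?subr0 //; apply: C''pr.
Qed.

End Filtration.

Section MulBy.
Variables (A : comNzRingType) (x : A).
Definition mulby (p : A) : A := x * p.
Fact mulby_additive : additive mulby.
Proof. by move=> p q; rewrite /mulby mulrBr. Qed.
HB.instance Definition _ := GRing.isAdditive.Build A A mulby mulby_additive.
End MulBy.

HB.lock Definition cw (A : comNzRingType) (N : nat) (f : A -> A) (eta : KF A N) : KF A N :=
  [ffun S : {set 'I_N} => f (eta S)].

Section Coefficientwise.
Variables (A : comNzRingType) (N : nat).

Local Notation cw := (@cw A N).

Variable f : {additive A -> A}.

Lemma cwE (f' : A -> A) eta S : cw f' eta S = f' (eta S).
Proof. by rewrite cw.unlock ffunE. Qed.

Fact cw_additive : additive (cw f).
Proof. by move=> u v; apply/ffunP=> S; rewrite !(ffunE, extE, intE, starE, cwE) raddfB. Qed.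
HB.instance Definition _ :=
  GRing.isAdditive.Build (KF A N) (KF A N) (cw f) cw_additive.

Lemma cw_ext a eta : cw f (ext a eta) = ext a (cw f eta).
Proof.
by apply/ffunP=> S; rewrite !(ffunE, extE, intE, starE, cwE); case: ifP => _; rewrite ?raddf0 // /sg raddfMsign.
Qed.

Lemma cw_int a eta : cw f (int a eta) = int a (cw f eta).
Proof.
by apply/ffunP=> S; rewrite !(ffunE, extE, intE, starE, cwE); case: ifP => _; rewrite ?raddf0 // /sg raddfMsign.
Qed.

Lemma isdeg_cw l eta : isdeg l eta -> isdeg l (cw f eta).
Proof. by move=> /isdegP h; apply/isdegP=> S /h e; rewrite !(ffunE, extE, intE, starE, cwE) e raddf0. Qed.

End Coefficientwise.

(** * Koszul complexes with pairwise coprime leading monomials *)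

Section KoszulWeights.
Variables (F : numFieldType) (v N : nat) (mf : measure v).
Local Notation P := {mpoly F[v]}.
Implicit Types (eta theta : KF P N) (S : {set 'I_N}).

Fact mdivX_additive u : additive (@mdivX F v u).
Proof. by move=> p q; apply/mpolyP=> m; rewrite mcoeffB !mcoeff_mdivX mcoeffB. Qed.
HB.instance Definition _ u := GRing.isAdditive.Build P P (@mdivX F v u) (mdivX_additive u).

Definition kpr W : KF P N -> KF P N := cw (pihomog mf W).
HB.instance Definition _ W := GRing.Additive.on (kpr W).
Definition kle W eta := forall S, (mmeasure mf (eta S) <= W)%N.

Lemma kle0 eta : kle 0 eta -> eta = 0.
Proof.
move=> h; apply/ffunP=> S; rewrite !(ffunE, extE, intE, starE, cwE); apply/eqP.
by rewrite -(mmeasure_poly_eq0 mf) -leqn0 h.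
Qed.
Lemma kle_ex eta : exists W, kle W eta.
Proof. by exists (\max_S mmeasure mf (eta S))%N => S; apply: leq_bigmax. Qed.
Lemma kleS W eta : kle W.+1 eta -> kpr W eta = 0 -> kle W eta.
Proof.
move=> h /ffunP e S; apply: mmeasure_pihomog0 => //.
by have := e S; rewrite !(ffunE, extE, intE, starE, cwE).
Qed.
Lemma kle_le W W' eta : (W <= W')%N -> kle W eta -> kle W' eta.
Proof. by move=> WW h S; apply: leq_trans WW. Qed.
Lemma kle_kpr W eta : kle W.+1 (kpr W eta).
Proof. by move=> S; rewrite !(ffunE, extE, intE, starE, cwE); apply: mmeasure_pihomog. Qed.
Lemma kprI W eta : kpr W (kpr W eta) = kpr W eta.
Proof. by apply/ffunP=> S; rewrite !(ffunE, extE, intE, starE, cwE) pihomog_idem. Qed.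
Lemma kpr0 W eta : kle W eta -> kpr W eta = 0.
Proof. by move=> h; apply/ffunP=> S; rewrite !(ffunE, extE, intE, starE, cwE) pihomog_big. Qed.
Lemma kleD W eta theta : kle W eta -> kle W theta -> kle W (eta + theta).
Proof. by move=> h1 h2 S; rewrite !(ffunE, extE, intE, starE, cwE); apply: mmeasureD_leW. Qed.
Lemma kleB W eta theta : kle W eta -> kle W theta -> kle W (eta - theta).
Proof. by move=> h1 h2 S; rewrite !(ffunE, extE, intE, starE, cwE); apply: mmeasureD_leW => //; rewrite mmeasureN. Qed.
Lemma kle_sum W (I : Type) (r : seq I) (Q : pred I) (G : I -> KF P N) :
  (forall i, Q i -> kle W (G i)) -> kle W (\sum_(i <- r | Q i) G i).
Proof.
move=> h S; rewrite sum_ffunE; apply: mmeasure_sum_leW => i Qi; exact: h.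
Qed.
Lemma kle_ext W a eta : kle W eta -> kle W (ext a eta).
Proof.
move=> h S; rewrite !(ffunE, extE, intE, starE, cwE); case: ifP => _; last by rewrite mmeasure0.
by rewrite /sg -signr_odd; case: odd; rewrite ?expr1 ?expr0 ?mulN1r ?mul1r ?mmeasureN.
Qed.

Lemma kpr_ext W a eta : kpr W (ext a eta) = ext a (kpr W eta).
Proof. exact: cw_ext. Qed.
Lemma kprE W eta S : kpr W eta S = pihomog mf W (eta S).
Proof. exact: cwE. Qed.

Variables (u : 'I_N -> 'X_{1..v}) (A0 : {set 'I_N}) (e : nat).
Hypothesis cop : forall a b m, a \in A0 -> b \in A0 -> a != b ->
  (u a <= m + u b)%MM = (u a <= m)%MM.

Definition lead_row : 'rV[P]_N := \row_a ((a \in A0)%:R * 'X_[u a]).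

(** Contraction combined with division by the leading monomials: the homotopy of the monomial Koszul
    complex. *)
Definition khom eta : KF P N := \sum_(a in A0) int a (cw (mdivX (u a)) eta).

Definition klam S (m : 'X_{1..v}) : nat := #|[set a in A0 | (a \notin S) || (u a <= m)%MM]|.

Lemma extv_lead eta : extv lead_row eta = \sum_(a in A0) ext a (cw (mulby 'X_[u a]) eta).
Proof.
rewrite extvE [RHS]big_mkcond; apply: eq_bigr => a _; rewrite mxE.
case: ifP => aA; last by rewrite mul0r scale0r.
by rewrite mul1r -linearZ; congr (ext a _); apply/ffunP=> S; rewrite !(ffunE, extE, intE, starE, cwE).
Qed.

Lemma ext_intS a eta S : ext a (int a eta) S = if a \in S then eta S else 0.
Proof.
rewrite !(ffunE, extE, intE, starE, cwE); case: ifP => // aS.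
by rewrite !inE eqxx /= setD1K // sgD1 // ltnn mulrA sgK mul1r.
Qed.

Lemma int_extS a eta S : int a (ext a eta) S = if a \in S then 0 else eta S.
Proof.
rewrite !(ffunE, extE, intE, starE, cwE); case: ifP => // aS.
by rewrite !inE eqxx /= setU1K ?aS // sgU1 ?aS // ltnn mulrA sgK mul1r.
Qed.

(** Coprimality enters here: by [cop], divisibility by one leading monomial is not affected by
    multiplication with another. *)
Lemma mulX_mdivX a b (p : P) : a \in A0 -> b \in A0 -> a != b ->
  'X_[u a] * mdivX (u b) p = mdivX (u b) ('X_[u a] * p).
Proof.
move=> aA bA ab; apply/mpolyP=> m.
have -> := mcoeff_mulX (u a) (mdivX (u b) p) m.
have -> := mcoeff_mdivX (u b) ('X_[u a] * p) m.
have -> := mcoeff_mulX (u a) p (m + u b)%MM.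
rewrite cop //; case: ifP => // um; rewrite mcoeff_mdivX; congr (_@__).
by apply/mnmP=> i; rewrite !mnmE; move/mnm_lepP: um => /(_ i); lia.
Qed.

Lemma khom0 : khom 0 = 0.
Proof. by rewrite /khom big1 // => a _; rewrite !raddf0. Qed.

(** The terms with a different from b cancel by anticommutation and coprimality. The diagonal term
    of a returns the coefficient, except when a is in S and [u a] does not divide m; so monomial
    forms are eigenvectors with eigenvalue [klam]. *)
Lemma khom_lead eta S m :
  ((extv lead_row (khom eta) + khom (extv lead_row eta)) S)@_m =
  (klam S m)%:R * (eta S)@_m.
Proof.
pose X a := cw (N := N) (mulby ('X_[u a] : P)); pose Y a := cw (N := N) (@mdivX F v (u a)).
have XY a b : a \in A0 -> b \in A0 -> a != b -> X a (Y b eta) = Y b (X a eta).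
  by move=> aA bA ab; apply/ffunP=> U; rewrite !(ffunE, extE, intE, starE, cwE) /mulby mulX_mdivX.
have YX a : Y a (X a eta) = eta.
  apply/ffunP=> U; rewrite !(ffunE, extE, intE, starE, cwE) /mulby; apply/mpolyP=> m'.
  by rewrite mcoeff_mdivX mcoeff_mulX lem_addl addmK.
have -> : extv lead_row (khom eta) + khom (extv lead_row eta) =
    \sum_(a in A0) (ext a (int a (X a (Y a eta))) + int a (ext a eta)).
  transitivity (\sum_(a in A0) \sum_(b in A0)
      (ext a (int b (X a (Y b eta))) + int b (ext a (Y b (X a eta))))).
    under [RHS]eq_bigr => a _ do rewrite big_split.
    rewrite big_split /=; congr (_ + _).
      rewrite extv_lead; apply: eq_bigr => a _; rewrite /khom 2!raddf_sum.
      by apply: eq_bigr => b _; rewrite /= cw_int.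
    rewrite exchange_big; apply: eq_bigr => b _; rewrite extv_lead 2!raddf_sum.
    by apply: eq_bigr => a _; rewrite /= cw_ext.
  apply: eq_bigr => a aA; rewrite (bigD1 a) //= YX [X in _ + X]big1 ?addr0 // => b /andP[bA ba].
  by rewrite XY // 1?eq_sym // extint eq_sym (negbTE ba) scale0r.
rewrite sum_ffunE raddf_sum /=.
rewrite (eq_bigr (fun a => if (a \notin S) || (u a <= m)%MM then (eta S)@_m else 0)); last first.
  move=> a _; rewrite ffunE ext_intS int_extS; case: (a \in S) => /=; rewrite ?add0r ?addr0 //.
  rewrite !cwE /mulby mcoeff_mulX mcoeff_mdivX; case: ifP => // um; by rewrite submK.
rewrite -big_mkcondr /= sumr_const -[_ *+ _]mulr_natl; congr (_%:R * _).
by rewrite /klam; apply: eq_card => a; rewrite !inE.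
Qed.

(** A set S with fewer elements than [A0] misses one of them, so [klam] is positive there and can be
    divided out in characteristic 0. *)
Lemma lead_exact l eta : isdeg l eta -> (l < #|A0|)%N -> extv lead_row eta = 0 ->
  exists2 theta, isdeg1 l theta & eta = extv lead_row theta.
Proof.
move=> /isdegP dl lA z.
pose lam (c : nat -> F) (zeta : KF P N) : KF P N :=
  [ffun S => cmul (fun m => c (klam S m)) (zeta S)].
have lamE c zeta S m : (lam c zeta S)@_m = c (klam S m) * (zeta S)@_m.
  by rewrite !(ffunE, extE, intE, starE, cwE) mcoeff_cmul.
clearbody lam.
have hl zeta : extv lead_row (khom zeta) + khom (extv lead_row zeta) = lam (fun i => i%:R) zeta.
  by apply/ffunP=> S; apply/mpolyP=> m; rewrite khom_lead lamE.
have klam_gt S m : (#|S| < #|A0|)%N -> (0 < klam S m)%N.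
  move=> SA; rewrite /klam card_gt0; apply/set0Pn.
  have /subsetPn[a aA aS] : ~~ (A0 \subset S).
    by apply: contraL SA => /subset_leq_card; rewrite leqNgt.
  by exists a; rewrite inE aA aS.
have hdeg S : #|S|.+1 != l -> khom eta S = 0.
  move=> Sl; rewrite sum_ffunE big1 // => a _; rewrite !(ffunE, extE, intE, starE, cwE); case: ifP => // aS.
  by rewrite dl ?raddf0 ?mulr0 // cardsU1 aS.
(* [khom eta] has degree l - 1, where the eigenvalues are positive as well. *)
pose theta := lam (fun i => i%:R^-1) (khom eta).
have lt : lam (fun i => i%:R) theta = khom eta.
  apply/ffunP=> S; apply/mpolyP=> m; rewrite !lamE.
  have [Sl|/hdeg ->] := eqVneq #|S|.+1 l; last by rewrite mcoeff0 !mulr0.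
  by rewrite mulVKf // pnatr_eq0 -lt0n klam_gt // ltnW // Sl.
have th0 S : #|S|.+1 != l -> theta S = 0.
  by move=> /hdeg e0; apply/mpolyP=> m; rewrite lamE e0 mcoeff0 mulr0.
clearbody theta; exists theta; first by apply/isdeg1P.
(* The anticommutator commutes with [extv lead_row] because the latter squares to zero. *)
have ee : extv lead_row (lam (fun i => i%:R) theta) = lam (fun i => i%:R) (extv lead_row theta).
  transitivity (extv lead_row (khom (extv lead_row theta))).
    have e1 : lam (fun i => i%:R) theta = extv lead_row (khom theta) + khom (extv lead_row theta).
      by symmetry; apply: hl.
    apply: (etrans (congr1 (extv lead_row) e1)).
    apply: (etrans (linearD _ _ _)).
    by apply: (etrans (congr1 (fun z => z + _) (extvv _ _))); apply: add0r.
  apply: etrans (hl _).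
  apply/esym/(etrans (congr1 (fun z => _ + khom z) (extvv _ _))).
  by apply: (etrans (congr1 (fun z => _ + z) khom0)); apply: addr0.
apply/ffunP=> S; apply/mpolyP=> m.
have [Sl|Sl] := eqVneq #|S| l; last first.
  rewrite dl // extvE sum_ffunE big1 // => a _; rewrite !(ffunE, extE, intE, starE, cwE); case: ifP => aS; last exact: mulr0.
  rewrite th0; first by rewrite mulr0; apply: mulr0.
  by move: Sl; rewrite (cardsD1 a) aS.
have e1 : lam (fun i => i%:R) (extv lead_row theta) = lam (fun i => i%:R) eta.
  apply: etrans (esym ee) _; apply: etrans (congr1 _ lt) _.
  apply: etrans (hl eta); apply/esym/(etrans (congr1 (fun zz => _ + khom zz) z)).
  by apply: (etrans (congr1 (fun zz => _ + zz) khom0)); apply: addr0.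
have e2 := congr1 (fun zz : KF P N => (zz S)@_m) e1.
have e3 := etrans (esym (lamE _ _ S m)) (etrans e2 (lamE _ _ S m)).
by apply/esym/(mulfI _ e3); rewrite pnatr_eq0 -lt0n klam_gt ?Sl.
Qed.

Variable x : 'rV[P]_N.
Hypothesis xlead : forall a, (mmeasure mf (x 0 a - (a \in A0)%:R * 'X_[u a])%R <= e)%N.
Hypothesis mfu : forall a, a \in A0 -> mf (u a) = e.

(** [filt_exact] for the weight mf: the entries of x differ from the leading monomials, all of
    weight e, by terms of weight below e, and the entries outside [A0] consist of such terms
    only. *)
Lemma koszul_exact l eta : isdeg l eta -> (l < #|A0|)%N -> extv x eta = 0 ->
  exists2 theta, isdeg1 l theta & eta = extv x theta.
Proof.
move=> dl lA; pose y := x - lead_row.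
have xE zeta : extv x zeta = extv lead_row zeta + extv y zeta.
  by rewrite -extvDl addrC subrK.
have ley W zeta : kle W.+1 zeta -> kle (W + e) (extv y zeta).
  move=> h; rewrite extvE; apply: kle_sum => a _ S; rewrite ffunE.
  apply: mmeasure_mul_lt; first by rewrite !mxE; apply: xlead.
  exact: kle_ext.
have lelead W zeta : kle W.+1 zeta -> kle (W + e).+1 (extv lead_row zeta).
  move=> h; rewrite extv_lead; apply: kle_sum => a aA; apply: kle_ext => S.
  rewrite cwE /mulby addnC; apply: (@mmeasure_mul _ _ mf e W) => //.
  by rewrite mmeasureX mfu.
have prlead W zeta : extv lead_row (kpr W zeta) = kpr (W + e) (extv lead_row zeta).
  rewrite !extv_lead [RHS]raddf_sum; apply: eq_bigr => a aA; rewrite /= kpr_ext.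
  congr (ext a _); apply/ffunP=> S; rewrite /kpr !cwE -(mfu aA) /= /mulby.
  by rewrite pihomog_mulX.
have prlead0 W zeta : (W < e)%N -> kpr W (extv lead_row zeta) = 0.
  move=> We; rewrite extv_lead raddf_sum big1 // => a aA; rewrite /= kpr_ext.
  rewrite (_ : kpr _ _ = 0) ?raddf0 //; apply/ffunP=> S; rewrite /kpr !cwE ffunE /= /mulby.
  by rewrite pihomog_mulX0 // mfu.
have fd W zeta : kle W.+1 zeta -> kle (W + e).+1 (extv x zeta).
  move=> h; rewrite xE; apply: kleD; first exact: lelead.
  exact: kle_le (ley _ _ h).
have prd W zeta : kle W.+1 zeta -> kpr (W + e) (extv x zeta) = extv lead_row (kpr W zeta).
  move=> h; apply: (etrans (congr1 (kpr (W + e)) (xE zeta))).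
  apply: (etrans (raddfD _ _ _)).
  apply: (etrans (congr1 (fun zz => _ + zz) (kpr0 (ley _ _ h)))).
  by apply: (etrans (addr0 _)); apply/esym/prlead.
move=> z; refine (@filt_exact _ kpr kle (extv x) (extv lead_row) e
  (fun W => raddfB (kpr W)) (fun w1 w2 => linearB (extv x) w1 w2) kle0 kle_ex kleS kle_kpr kprI kleB fd prlead prd prlead0
  (isdeg l) (isdeg1 l) _ _ _ _ _ _ _ _ eta dl z).
- by move=> *; apply: isdegB.
- by move=> *; apply: isdeg_cw.
- by move=> W w /isdeg1P h; apply/isdeg1P=> S /h hS; rewrite cwE hS raddf0.
- exact: isdeg10.
- by move=> *; apply: isdeg1D.
- by move=> *; apply: isdeg1_extv.
- by move=> *; apply: extvv.
- by move=> w dw; apply: lead_exact.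
Qed.

End KoszulWeights.

(** * Fischer's inner product *)

Section OrthogonalProjection.
Variables (C : numClosedFieldType) (V : lmodType C) (ip : V -> V -> C).
Hypothesis ipDZ : forall c u v w, ip (c *: u + v) w = c * ip u w + ip v w.
Hypothesis ipC : forall u v, ip u v = (ip v u)^*.
Hypothesis ip_eq0 : forall u, ip u u = 0 -> u = 0.

Lemma ip0l w : ip 0 w = 0.
Proof. by rewrite -[0 : V](addr0 0) -[X in X + _](scale0r 0) ipDZ mul0r add0r; move: (ipDZ 1 0 0 w); rewrite scaler0 addr0 mul1r => /eqP; rewrite -subr_eq0 opprD addrA subrr sub0r oppr_eq0 => /eqP. Qed.
Lemma ipDl u v w : ip (u + v) w = ip u w + ip v w.
Proof. by rewrite -[u]scale1r ipDZ mul1r scale1r. Qed.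
Lemma ipZl c u w : ip (c *: u) w = c * ip u w.
Proof. by rewrite -[c *: u]addr0 ipDZ ip0l addr0. Qed.
Lemma ipBl u v w : ip (u - v) w = ip u w - ip v w.
Proof. by rewrite ipDl -scaleN1r ipZl mulN1r. Qed.
Lemma ipDr u v w : ip w (u + v) = ip w u + ip w v.
Proof. by rewrite ipC ipDl rmorphD /= -!ipC. Qed.
Lemma ipZr c u w : ip w (c *: u) = c^* * ip w u.
Proof. by rewrite ipC ipZl rmorphM /= -ipC. Qed.

Definition subspace (W : V -> Prop) :=
  W 0 /\ forall c u v, W u -> W v -> W (c *: u + v).

Lemma subspaceB W u v : subspace W -> W u -> W v -> W (u - v).
Proof. by move=> [_ h] hu hv; rewrite -scaleN1r addrC; apply: h. Qed.
Lemma subspaceD W u v : subspace W -> W u -> W v -> W (u + v).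
Proof. by move=> [_ h] hu hv; rewrite -[u]scale1r; apply: h. Qed.
Lemma subspaceZ W c u : subspace W -> W u -> W (c *: u).
Proof. by move=> [h0 h] hu; rewrite -[_ *: _]addr0; apply: h. Qed.

Definition is_proj (W : V -> Prop) v p := W p /\ forall w, W w -> ip (v - p) w = 0.

(** A finite list of functionals separating the points of W stands in for finite dimension. By
    induction, projections exist on the kernel W' of one functional; if W is larger, it is spanned
    by W' and a vector u' orthogonal to W', obtained by one Gram-Schmidt step. *)
Lemma ortho_proj (I : eqType) (s : seq I) (x : I -> V -> C) (W : V -> Prop) :
  (forall i c u v, x i (c *: u + v) = c * x i u + x i v) ->
  subspace W -> (forall w, W w -> (forall i, i \in s -> x i w = 0) -> w = 0) ->
  forall v, exists p, is_proj W v p.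
Proof.
move=> xl; elim: s W => [|j s IH] W sW hW v.
  exists 0; split; first by case: sW.
  move=> w Ww; rewrite (hW w Ww) //.
  by rewrite ipC ip0l rmorph0.
pose W' w := W w /\ x j w = 0.
have sW' : subspace W'.
  have x0 : x j 0 = 0.
    have := xl j (-1) 0 0; rewrite scaler0 addr0 mulN1r => ->.
    by rewrite addNr.
  split; first by split=> //; case: sW.
  move=> c u w [Wu xu] [Ww xw]; split; first by case: sW => _; apply.
  by rewrite xl xu xw mulr0 addr0.
have hW' w : W' w -> (forall i, i \in s -> x i w = 0) -> w = 0.
  move=> [Ww xw] h; apply: hW => // i; rewrite inE => /orP[/eqP -> //|]; exact: h.
have [[u [Wu xu]]|nex] := boolp.EM (exists u, W u /\ x j u <> 0); last first.
  have al w : W w -> x j w = 0.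
    by move=> Ww; apply: boolp.contrapT => h; apply: nex; exists w.
  have [p [[Wp _] hp]] := IH W' sW' hW' v.
  by exists p; split=> // w Ww; apply: hp; split=> //; apply: al.
have [p [[Wp xp] hp]] := IH W' sW' hW' u.
have [pv [[Wpv xpv] hpv]] := IH W' sW' hW' v.
pose u' := u - p.
have Wu' : W u' by apply: subspaceB.
have xu' : x j u' = x j u.
  by rewrite /u' -scaleN1r addrC xl xp mulr0 add0r.
have uu : ip u' u' != 0.
  apply/eqP=> /ip_eq0 u'0; apply: xu; rewrite -xu' u'0.
  have := xl j (-1) 0 0; rewrite scaler0 addr0 mulN1r => ->.
  by rewrite addNr.
exists (pv + (ip v u' / ip u' u') *: u'); split.
  by apply: subspaceD => //; apply: subspaceZ.
move=> w Ww; pose c := x j w / x j u'.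
have Ww' : W' (w - c *: u').
  split; first by apply: subspaceB => //; apply: subspaceZ.
  rewrite -scaleN1r addrC scalerA xl mulN1r /c mulNr divfK ?addNr //.
  by rewrite xu'; apply/eqP.
have E : ip (v - (pv + (ip v u' / ip u' u') *: u')) u' = 0.
  rewrite ipBl ipDl ipZl divfK // ipC (ipC pv) -!ipC.
  by rewrite [ip pv u']ipC (hp pv) ?rmorph0 ?add0r ?subrr.
rewrite -[w](subrK (c *: u')) ipDr ipZr E mulr0 addr0.
by rewrite opprD addrA ipBl hpv // ipZl (hp _ Ww') mulr0 subrr.
Qed.

Lemma is_proj_uniq W v p q : subspace W -> is_proj W v p -> is_proj W v q -> p = q.
Proof.
move=> sW [Wp hp] [Wq hq]; apply/eqP; rewrite -subr_eq0; apply/eqP/ip_eq0.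
have Wpq : W (p - q) by apply: subspaceB.
have e : (v - q) - (v - p) = p - q by rewrite opprB addrC addrA subrK.
by rewrite -{1}e ipBl hp // hq // subrr.
Qed.

Lemma is_proj_linear W c u v p q : subspace W ->
  is_proj W u p -> is_proj W v q -> is_proj W (c *: u + v) (c *: p + q).
Proof.
move=> sW [Wp hp] [Wq hq]; split; first by case: sW => _; apply.
move=> w Ww; rewrite opprD addrACA -scalerBr ipDl ipZl hp // hq //.
by rewrite mulr0 addr0.
Qed.

(* Weyl's unitary trick without integration: the component of v orthogonal to
   an invariant subspace W is fixed as soon as v is fixed modulo W. *)
Lemma proj_fixed W v p (g : V -> V) : subspace W -> is_proj W v p ->
  (forall u w, ip (g u) (g w) = ip u w) -> (forall u w, g (u - w) = g u - g w) ->
  (forall w, W w -> W (g w)) -> (forall w, W w -> exists2 w1, W w1 & w = g w1) ->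
  W (g v - v) -> g (v - p) = v - p.
Proof.
move=> sW [Wp hp] gi gB gW gW' Wv.
have Wd : W (g (v - p) - (v - p)).
  have -> : g (v - p) - (v - p) = (g v - v) - (g p - p).
    by rewrite gB !opprB addrACA [RHS]addrACA; congr (_ + _); apply: addrC.
  by apply: subspaceB => //; apply: subspaceB => //; apply: gW.
apply/eqP; rewrite -subr_eq0; apply/eqP/ip_eq0.
rewrite {1}ipBl (hp _ Wd) subr0; have [w Ww ->] := gW' _ Wd.
by rewrite gi hp.
Qed.

End OrthogonalProjection.

Section Fischer.
Variables (C : numClosedFieldType) (v : nat).
Local Notation P := {mpoly C[v]}.
Implicit Types (p q r : P) (m : 'X_{1..v}).

Definition mfact m : nat := (\prod_(i < v) (m i)`!)%N.

(** Fischer's product. The factor m! makes multiplication by a variable adjoint to differentiation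
    ([fisXl]), which is why orthogonal substitutions are isometries. *)
Definition fis p q : C := \sum_(m <- msupp p) (mfact m)%:R * p@_m * (q@_m)^*.

Lemma fisw k p q : (msize p <= k)%N ->
  fis p q = \sum_(m : 'X_{1..v < k}) (mfact m)%:R * p@_m * (q@_m)^*.
Proof.
move=> lt_pk; pose I : subFinType _ := 'X_{1..v < k}.
rewrite /fis (big_mksub I) /=; first last.
- by move=> m /msize_mdeg_lt /leq_trans; apply.
- exact: msupp_uniq.
rewrite big_rmcond //= => m /memN_msupp_eq0 ->.
by rewrite mulr0 mul0r.
Qed.

Lemma fisDZ c p q r : fis (c *: p + q) r = c * fis p r + fis q r.
Proof.
pose k := maxn (msize (c *: p + q)) (maxn (msize p) (msize q)).
rewrite !(fisw (k := k)) ?leq_max ?leqnn ?orbT //.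
rewrite mulr_sumr -big_split; apply: eq_bigr => m _ /=.
by rewrite mcoeffD mcoeffZ; ring.
Qed.

Lemma fisC p q : fis p q = (fis q p)^*.
Proof.
pose k := maxn (msize p) (msize q).
rewrite !(fisw (k := k)) ?leq_max ?leqnn ?orbT // rmorph_sum; apply: eq_bigr => m _ /=.
by rewrite !rmorphM /= conjCK conjC_nat mulrAC.
Qed.

Lemma mfact_gt0 m : (0 < mfact m)%N.
Proof. by apply: prodn_gt0 => i; apply: fact_gt0. Qed.

Lemma fis_ge0 p : 0 <= fis p p.
Proof.
rewrite /fis sumr_ge0 // => m _; rewrite -mulrA mulr_ge0 ?ler0n //.
exact: mul_conjC_ge0.
Qed.

Lemma fis_eq0 p : fis p p = 0 -> p = 0.
Proof.
rewrite /fis => /eqP; rewrite psumr_eq0 => [/allP h|m _]; last first.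
  by rewrite -mulrA mulr_ge0 ?ler0n // mul_conjC_ge0.
apply/eqP; rewrite -msupp_eq0; case e : (msupp p) => [|m s] //.
have /h : m \in msupp p by rewrite e mem_head.
rewrite -mulrA mulf_eq0 mul_conjC_eq0 pnatr_eq0 => /orP[|].
  by rewrite eqn0Ngt mfact_gt0.
by rewrite mcoeff_eq0 e mem_head.
Qed.

Lemma fis_disj p q : (forall m, p@_m != 0 -> q@_m = 0) -> fis p q = 0.
Proof.
move=> h; rewrite /fis big_seq big1 // => m; rewrite mcoeff_msupp => /h ->.
by rewrite conjC0 mulr0.
Qed.

Lemma fisXl i p q : fis ('X_i * p) q = fis p (mderiv i q).
Proof.
elim/mpolyind: p => [|c m p _ _ IH].
  by rewrite mulr0 /fis !msupp0 !big_nil.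
rewrite mulrDr -scalerAr !fisDZ IH; congr (_ * _ + _).
rewrite -mpolyXD /fis !msuppX !big_seq1 !mcoeffX !eqxx !mulr1 mcoeff_mderiv.
rewrite addmC rmorphMn /= [RHS]mulrnAr -mulrnAl -mulrnA; congr (_%:R * _).
rewrite /mfact [LHS](bigD1 i) // [in RHS](bigD1 i) //= !mnmE eqxx addn1 factS.
rewrite [RHS]mulnAC; congr (_ * _)%N; first by rewrite mulnC.
by apply: eq_bigr => j ji; rewrite !mnmE eq_sym (negbTE ji) addn0.
Qed.

Lemma fis1l q : fis 1 q = (q@_0)^*.
Proof.
rewrite /fis msupp1 big_seq1 mcoeff1 eqxx mulr1 /mfact big1 ?mul1r // => i _.
by rewrite mnm0E.
Qed.

Lemma fis0l q : fis 0 q = 0.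
Proof. by rewrite /fis msupp0 big_nil. Qed.
Lemma fisZl c p q : fis (c *: p) q = c * fis p q.
Proof. by have := fisDZ c p 0 q; rewrite fis0l !addr0. Qed.
Lemma fisZr c p q : fis p (c *: q) = c^* * fis p q.
Proof. by rewrite fisC fisZl rmorphM /= -fisC. Qed.
Lemma fisDl p q r : fis (p + q) r = fis p r + fis q r.
Proof. by rewrite -[p]scale1r fisDZ mul1r scale1r. Qed.
Lemma fisNl p q : fis (- p) q = - fis p q.
Proof. by rewrite -scaleN1r fisZl mulN1r. Qed.
Lemma fisNr p q : fis p (- q) = - fis p q.
Proof. by rewrite -scaleN1r fisZr rmorphN1 mulN1r. Qed.
Lemma fis_suml I (s : seq I) (G : I -> P) q :
  fis (\sum_(t <- s) G t) q = \sum_(t <- s) fis (G t) q.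
Proof.
elim: s => [|t s IH]; first by rewrite !big_nil fis0l.
by rewrite !big_cons fisDl IH.
Qed.
Lemma fis_sumr I (s : seq I) (G : I -> P) q :
  fis q (\sum_(t <- s) G t) = \sum_(t <- s) fis q (G t).
Proof. by rewrite fisC fis_suml rmorph_sum; apply: eq_bigr => t _; rewrite /= -fisC. Qed.

End Fischer.

Section FischerForms.
Variables (C : numClosedFieldType) (v N : nat).
Local Notation P := {mpoly C[v]}.
Implicit Types (eta theta zeta : {ffun {set 'I_N} -> P}).

Definition kip eta theta : C := \sum_S fis (eta S) (theta S).

Lemma kipDZ c eta theta zeta :
  kip (c *: eta + theta) zeta = c * kip eta zeta + kip theta zeta.
Proof.
rewrite /kip mulr_sumr -big_split; apply: eq_bigr => S _.
by rewrite !ffunE fisDZ.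
Qed.

Lemma kipC eta theta : kip eta theta = (kip theta eta)^*.
Proof. by rewrite /kip rmorph_sum; apply: eq_bigr => S _; apply: fisC. Qed.

Lemma kip_eq0 eta : kip eta eta = 0 -> eta = 0.
Proof.
move=> /eqP; rewrite psumr_eq0 => [/allP h|S _]; last exact: fis_ge0.
apply/ffunP=> S; rewrite ffunE; apply: fis_eq0; apply/eqP.
by apply: (h S); rewrite mem_index_enum.
Qed.

End FischerForms.

Section HomogeneousProjection.
Variables (C : numClosedFieldType) (v N : nat).
Local Notation P := {mpoly C[v]}.
Local Notation FF := {ffun {set 'I_N} -> P}.
Implicit Types (eta theta zeta : FF).

(** The space is infinite-dimensional, but W contains the homogeneous components of its elements and
    distinct degrees are orthogonal: projecting on the part of W of degree below M gives the
    projection on W of a form of degree below M. *)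
Lemma homog_proj (W : FF -> Prop) : subspace W ->
  (forall d w, W w -> W (kpr mdeg d w)) ->
  forall M eta, kle mdeg M eta -> exists2 p, is_proj (@kip C v N) W eta p & kle mdeg M p.
Proof.
move=> sW hW M eta eM.
pose WM w := W w /\ kle mdeg M w.
have sWM : subspace WM.
  split; first by split; [case: sW | move=> S; rewrite ffunE mmeasure0].
  move=> c u w [Wu Mu] [Ww Mw]; split; first by case: sW => _; apply.
  move=> S; rewrite !ffunE; apply: mmeasureD_leW => //.
  exact: leq_trans (mmeasureZ_le _ _ _) (Mu S).
pose x (i : {set 'I_N} * 'X_{1..v < M}) (w : FF) := (w i.1)@_(val i.2).
have [|||p [[Wp Mp] hp]] := @ortho_proj C FF (@kip C v N) (@kipDZ C v N)
    (@kipC C v N) (@kip_eq0 C v N) _ (enum {: {set 'I_N} * 'X_{1..v < M}}) x WM _ _ _ eta.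
- by move=> i c u w; rewrite /x !ffunE mcoeffD mcoeffZ.
- exact: sWM.
- move=> w [_ Mw] h; apply/ffunP=> S; rewrite ffunE; apply/mpolyP=> m; rewrite mcoeff0.
  case: (ltnP (mdeg m) M) => [mM|]; last by move/(mmeasure_leP mdeg): (Mw S); apply.
  by apply: (h (S, BMultinom mM)); rewrite mem_enum.
exists p => //; split=> // w Ww.
have sumW (r : seq nat) : W (\sum_(d <- r) kpr mdeg d w).
  apply: big_ind; [by case: sW | by move=> *; apply: (subspaceD (W := W)) | by move=> d _; apply: hW].
(* The truncation of w to degrees below M; the remainder of w is orthogonal to [eta - p]. *)
pose w1 := \sum_(d <- iota 0 M) kpr mdeg d w.
have w1E S m : (w1 S)@_m = if (mdeg m < M)%N then (w S)@_m else 0.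
  rewrite sum_ffunE raddf_sum /=.
  rewrite (eq_bigr (fun d => if mdeg m == d then (w S)@_m else 0)); last first.
    by move=> d _; rewrite kprE mcoeff_pihomog.
  case: ifP => mM.
    rewrite (bigD1_seq (mdeg m)) ?iota_uniq ?mem_iota //= eqxx big1 ?addr0 //.
    by move=> d dm; rewrite eq_sym (negbTE dm).
  rewrite big_seq big1 // => d; rewrite mem_iota /= add0n => dM.
  by case: eqP => // e; rewrite -e mM in dM.
have Ww1 : WM w1.
  split; first exact: sumW.
  by move=> S; apply/(mmeasure_leP mdeg) => m Mm; rewrite w1E ltnNge Mm.
rewrite -(hp w1 Ww1) /kip; apply: eq_bigr => S _.
apply/eqP; rewrite -subr_eq0; apply/eqP.
have -> : fis ((eta - p) S) (w S) - fis ((eta - p) S) (w1 S) =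
    (fis (w S - w1 S) ((eta - p) S))^*.
  have -> : w S - w1 S = (-1 : C) *: (w1 S : P) + w S by rewrite scaleN1r addrC.
  by rewrite fisDZ rmorphD rmorphM rmorphN1 mulN1r addrC /= -!fisC.
rewrite fis_disj ?conjC0 // => m; rewrite mcoeffB w1E.
case: ltnP => [|Mm _]; first by rewrite subrr eqxx.
rewrite !ffunE mcoeffB.
by rewrite (proj1 (mmeasure_leP mdeg _ _) (eM S)) // (proj1 (mmeasure_leP mdeg _ _) (Mp S)) // subrr.
Qed.

End HomogeneousProjection.

(** * The action of the orthogonal group *)

Lemma mpoly_indX (F : nzRingType) v (Q : {mpoly F[v]} -> Prop) :
  Q 1 -> (forall c p q, Q p -> Q q -> Q (c *: p + q)) ->
  (forall l p, Q p -> Q ('X_l * p)) -> forall p, Q p.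
Proof.
move=> Q1 QD QX.
have Q0 : Q 0 by have := QD (-1) 1 1 Q1 Q1; rewrite scaleN1r addNr.
have Qm d m : mdeg m = d -> Q 'X_[m].
  elim: d m => [|d IH] m; first by move/eqP; rewrite mdeg_eq0 => /eqP ->; rewrite mpolyX0.
  move=> md; have [l ml] : exists l, m l != 0%N.
    apply/existsP; rewrite -negb_forall; apply/negP=> /forallP h.
    have m0 : m = 0%MM by apply/mnmP=> i; rewrite mnm0E; apply/eqP.
    by move: md; rewrite m0 mdeg0.
  rewrite -lep1mP in ml; rewrite -(submK ml) addmC mpolyXD; apply/QX/IH.
  apply/eqP; rewrite -(eqn_add2r 1) -(mdeg1 l) -mdegD submK // md mdeg1 addn1 //.
elim/mpolyind=> // c m p _ _ Qp; exact/QD/Qp/(Qm _ _ erefl).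
Qed.

Section PolyVars.
Variables (C : numClosedFieldType) (n k : nat).
Local Notation P := {mpoly C[(n * k + k)%N]}.

Definition zX (a : 'I_n) (i : 'I_k) : P := 'X_(zidx a i).
Definition wX (i : 'I_k) : P := 'X_(widx n i).
Definition cm m1 m2 (A : 'M[C]_(m1, m2)) : 'M[P]_(m1, m2) := map_mx (fun x => x%:MP) A.

Definition actv (h : 'M[C]_n) : 'rV[P]_(n * k + k) :=
  row_mx (mxvec (cm h *m \matrix_(a, i) zX a i)) (\row_i wX i).

End PolyVars.

(* [poly_act g] is [act h] for [h = g^-1], so [h] acts on the right. *)
HB.lock Definition act (C : numClosedFieldType) (n k : nat) (h : 'M[C]_n)
    (f : {mpoly C[(n * k + k)%N]}) : {mpoly C[(n * k + k)%N]} :=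
  f \mPo [tuple actv k h 0 l | l < n * k + k].

Section PolyAction.
Variables (C : numClosedFieldType) (n k : nat).
Local Notation P := {mpoly C[(n * k + k)%N]}.
Implicit Types (h : 'M[C]_n) (f p q : P) (a b : 'I_n) (i j : 'I_k).

Lemma var_case (l : 'I_(n * k + k)) :
  (exists a i, l = zidx a i) \/ (exists i, l = widx n i).
Proof.
case: (split_ordP l) => [l' ->|i ->]; last by right; exists i.
by left; case/mxvec_indexP: l' => a i; exists a, i.
Qed.

Local Notation zX := (@zX C n k).
Local Notation wX := (@wX C n k).
Local Notation act := (@act C n k).

Fact act_linear h : linear (act h).
Proof. by move=> c p q; rewrite act.unlock; apply: linearP. Qed.
HB.instance Definition _ h := GRing.isLinear.Build C P P *:%R (act h) (act_linear h).
Fact act_monoid h : monoid_morphism (act h).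
Proof.
by split=> [|p q]; rewrite act.unlock; [apply: rmorph1 | apply: rmorphM].
Qed.
HB.instance Definition _ h := GRing.isMonoidMorphism.Build P P (act h) (act_monoid h).

Lemma actP h c p q : act h (c *: p + q) = c *: act h p + act h q.
Proof. exact: linearP. Qed.

Lemma actM h p q : act h (p * q) = act h p * act h q.
Proof. exact: rmorphM. Qed.

Lemma act_z h a i : act h (zX a i) = \sum_b (h a b)%:MP * zX b i.
Proof.
rewrite act.unlock /zX comp_mpolyXU -tnth_nth tnth_mktuple /actv row_mxEl mxvecE mxE.
by apply: eq_bigr => b _; rewrite !mxE.
Qed.

Lemma act_w h i : act h (wX i) = wX i.
Proof.
by rewrite act.unlock /wX comp_mpolyXU -tnth_nth tnth_mktuple /actv row_mxEr mxE.
Qed.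

Lemma actC h c : act h (c%:MP : P) = c%:MP.
Proof. by rewrite act.unlock; apply: comp_mpolyC. Qed.

Lemma zidx_eq a b i j : (zidx a i == zidx b j) = (a == b) && (i == j).
Proof.
rewrite /zidx (inj_eq (@lshift_inj _ _)) /mxvec_index.
by rewrite (inj_eq (@cast_ord_inj _ _ _)) (inj_eq enum_rank_inj) xpair_eqE.
Qed.
Lemma widx_eq i j : (@widx n k i == widx n j) = (i == j).
Proof. by rewrite /widx (inj_eq (@rshift_inj _ _)). Qed.
Lemma zwidx_eq a i j : (zidx a i == widx n j) = false.
Proof. exact: eq_lrshift. Qed.
Lemma wzidx_eq a i j : (widx n j == zidx a i) = false.
Proof. by rewrite eq_sym zwidx_eq. Qed.

Lemma mderivXU (l l' : 'I_(n * k + k)) : mderiv l ('X_l' : P) = (l' == l)%:R.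
Proof.
rewrite mderivX mnmE; case: eqP => [->|_]; last by rewrite scale0r.
rewrite scale1r (_ : (U_(l) - U_(l))%MM = 0%MM) ?mpolyX0 //.
by apply/mnmP=> t; rewrite !mnmE subnn.
Qed.

Let mderivP' l c p q : mderiv l (c *: p + q) = c *: mderiv l p + mderiv l q.
Proof. exact: linearP. Qed.

Lemma mderiv_act_w h i f :
  mderiv (widx n i) (act h f) = act h (mderiv (widx n i) f).
Proof.
elim/mpoly_indX: f => [|c p q hp hq|l p hp].
- by rewrite rmorph1 -mpolyC1 mderivC rmorph0.
- by rewrite actP mderivP' (mderivP' _ c p q) actP hp hq.
rewrite rmorphM !mderivM rmorphD !rmorphM /= hp; congr (_ * _ + _).
case: (var_case l) => [[a [j ->]]|[j ->]].
  rewrite act_z linear_sum mderivXU zwidx_eq rmorph0 big1 //= => b _.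
  by rewrite mderiv_mulC mderivXU zwidx_eq mulr0.
by rewrite act_w !mderivXU rmorph_nat.
Qed.

Lemma mderiv_act_z h b i f :
  mderiv (zidx b i) (act h f) =
  \sum_a (h a b)%:MP * act h (mderiv (zidx a i) f).
Proof.
elim/mpoly_indX: f => [|c p q hp hq|l p hp].
- by rewrite rmorph1 -mpolyC1 mderivC big1 // => a _; rewrite mderivC rmorph0 mulr0.
- rewrite actP mderivP' hp hq scaler_sumr -big_split; apply: eq_bigr => a _ /=.
  by rewrite (mderivP' _ c p q) actP mulrDr -scalerAr.
rewrite rmorphM mderivM hp mulr_sumr /=.
under [RHS]eq_bigr => a _ do rewrite mderivM rmorphD !rmorphM /= mulrDr.
rewrite big_split /=; congr (_ + _); last by apply: eq_bigr => a _; rewrite mulrCA.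
under [RHS]eq_bigr => a _ do rewrite mulrA.
rewrite -mulr_suml; congr (_ * _).
case: (var_case l) => [[a [j ->]]|[j ->]].
  rewrite act_z linear_sum.
  under eq_bigr => c _ do rewrite /= mderiv_mulC mderivXU zidx_eq.
  under [RHS]eq_bigr => c _ do rewrite mderivXU zidx_eq rmorph_nat.
  rewrite (bigD1 b) //= [in RHS](bigD1 a) //= !eqxx /=.
  rewrite !big1 // => c cb; first by rewrite eq_sym (negbTE cb) mulr0.
  by rewrite (negbTE cb) mulr0.
rewrite act_w mderivXU wzidx_eq big1 // => a _.
by rewrite mderivXU wzidx_eq rmorph0 mulr0.
Qed.

Lemma act_comp h1 h2 f : act h1 (act h2 f) = act (h2 *m h1) f.
Proof.
elim/mpoly_indX: f => [|c p q hp hq|l p hp].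
- by rewrite !rmorph1.
- by rewrite (actP _ c p q) actP hp hq (actP _ c p q).
suff e : act h1 (act h2 'X_l) = act (h2 *m h1) 'X_l.
  have e1 := actM h2 'X_l p; have e2 := actM h1 (act h2 'X_l) (act h2 p).
  by rewrite e1 e2 e hp actM.
case: (var_case l) => [[a [j ->]]|[j ->]]; last by rewrite 2!act_w [RHS]act_w.
rewrite act_z linear_sum [RHS]act_z /=.
under eq_bigr => b _ do rewrite actM actC act_z mulr_sumr.
rewrite exchange_big; apply: eq_bigr => b _ /=.
under eq_bigr => c _ do rewrite mulrA.
rewrite -mulr_suml mxE raddf_sum; congr (_ * _); apply: eq_bigr => c _.
by rewrite /= mpolyCM.
Qed.

Lemma act1 f : act 1%:M f = f.
Proof.
elim/mpoly_indX: f => [|c p q hp hq|l p hp]; first by rewrite rmorph1.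
  by rewrite actP hp hq.
rewrite rmorphM /= hp; congr (_ * _).
case: (var_case l) => [[a [j ->]]|[j ->]]; last by rewrite !act_w.
rewrite act_z (bigD1 a) //= mxE eqxx mpolyC1 mul1r.
by rewrite big1 ?addr0 // => b ba; rewrite mxE eq_sym (negbTE ba) mpolyC0 mul0r.
Qed.

Let pihomogP' d c p q :
  pihomog mdeg d (c *: p + q) = c *: pihomog mdeg d p + pihomog mdeg d q.
Proof. exact: linearP. Qed.

Lemma pihomog_act h d f : pihomog mdeg d (act h f) = act h (pihomog mdeg d f).
Proof.
move: d; elim/mpoly_indX: f => [|c p q hp hq|l p hp] d.
- rewrite rmorph1 -[1 : P]mpolyX0 pihomogX; case: ifP => _; last by rewrite linear0.
  by rewrite mpolyX0 rmorph1.
- by rewrite actP pihomogP' (pihomogP' _ c p q) actP hp hq.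
(* The image of a variable is a linear form, given as a list of coefficients and variables; this
   covers z and w at once. *)
have key (s : seq (C * 'I_(n * k + k))) :
    act h 'X_l = \sum_(t <- s) t.1%:MP * 'X_t.2 ->
    pihomog mdeg d (act h ('X_l * p)) = act h (pihomog mdeg d ('X_l * p)).
  have pi0 (r : P) (l' : 'I_(n * k + k)) : pihomog mdeg 0 ('X_l' * r) = 0.
    by rewrite pihomog_mulX0 //= mdeg1.
  have piS (d' : nat) (r : P) (l' : 'I_(n * k + k)) :
      pihomog mdeg d'.+1 ('X_l' * r) = 'X_l' * pihomog mdeg d' r.
    by have := pihomog_mulX mdeg d' U_(l')%MM r; rewrite /= mdeg1 addn1.
  move=> e; case: d => [|d].
    rewrite pi0 raddf0 actM e mulr_suml linear_sum big1 // => t _.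
    by rewrite /= -mulrA mul_mpolyC linearZ /= pi0 scaler0.
  rewrite piS !actM e !mulr_suml linear_sum.
  apply: eq_bigr => t _ /=; rewrite -!mulrA !mul_mpolyC linearZ /=.
  by rewrite piS hp.
case: (var_case l) key => [[a [j ->]]|[j ->]] key.
  apply: (key [seq (h a b, zidx b j) | b <- index_enum 'I_n]).
  by rewrite act_z big_map.
by apply: (key [:: (1, widx n j)]); rewrite act_w big_seq1 mpolyC1 mul1r.
Qed.

Definition orth h := h *m h^T = 1%:M.
(** Real matrices are singled out by conjugation, the form in which the Hermitian product meets
    them. *)
Definition realmx h := forall a b, (h a b)^* = h a b.

Lemma orth_tr h : orth h -> orth h^T.
Proof. by move=> oh; rewrite /orth trmxK; apply: mulmx1C. Qed.
Lemma orth_mul h1 h2 : orth h1 -> orth h2 -> orth (h1 *m h2).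
Proof.
by move=> o1 o2; rewrite /orth trmx_mul mulmxA -(mulmxA h1) o2 mulmx1.
Qed.

Lemma realmx_tr h : realmx h -> realmx h^T.
Proof. by move=> rh a b; rewrite mxE. Qed.
Lemma realmx_mul h1 h2 : realmx h1 -> realmx h2 -> realmx (h1 *m h2).
Proof.
move=> r1 r2 a b; rewrite mxE rmorph_sum; apply: eq_bigr => c _.
by rewrite rmorphM /= r1 r2.
Qed.

(** A variable on the left becomes a derivative on the right. By the chain rule and h h^T = 1 the
    derivative of the transformed polynomial is the transform of the derivative; reality of h moves
    its entries through the conjugation. *)
Lemma fis_act h p q : orth h -> realmx h -> fis (act h p) (act h q) = fis p q.
Proof.
move=> oh rh; move: q; elim/mpoly_indX: p => [|c p1 p2 h1 h2|l p hp] q.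
- rewrite rmorph1 !fis1l; congr (_^*).
  elim/mpoly_indX: q => [|c q1 q2 h1 h2|l q hq]; first by rewrite rmorph1.
    by rewrite actP !mcoeffD !mcoeffZ h1 h2.
  rewrite !rmorphM /= hq; congr (_ * _).
  case: (var_case l) => [[a [j ->]]|[j ->]]; last by rewrite act_w.
  rewrite act_z raddf_sum /= big1 => [|b _]; first by rewrite mcoeffX mnm1_eq0.
  by rewrite mcoeffCM mcoeffX mnm1_eq0 mulr0.
- by rewrite actP !fisDZ h1 h2.
rewrite fisXl rmorphM /=.
case: (var_case l) => [[a [j ->]]|[j ->]]; last first.
  by rewrite act_w fisXl mderiv_act_w hp.
rewrite act_z mulr_suml fis_suml.
transitivity (\sum_c (\sum_b (h a b * h c b)) * fis p (mderiv (zidx c j) q)); last first.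
  have hE c : \sum_b h a b * h c b = (a == c)%:R.
    have /(congr1 (fun A : 'M_n => A a c)) := oh.
    by rewrite !mxE => <-; apply: eq_bigr => b _; rewrite !mxE.
  rewrite (bigD1 a) //= hE eqxx mul1r big1 ?addr0 // => c ca.
  by rewrite hE eq_sym (negbTE ca) mul0r.
transitivity (\sum_b \sum_c h a b * h c b * fis p (mderiv (zidx c j) q)).
  apply: eq_bigr => b _; rewrite -mulrA mul_mpolyC fisZl fisXl mderiv_act_z fis_sumr mulr_sumr.
  by apply: eq_bigr => c _; rewrite mul_mpolyC fisZr hp mulrA rh.
by rewrite exchange_big; apply: eq_bigr => c _; rewrite mulr_suml.
Qed.

End PolyAction.

(** * The action on forms and equivariant operators *)

HB.lock Definition fa (C : numClosedFieldType) (n k : nat) (h : 'M[C]_n)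
    (eta : KF {mpoly C[(n * k + k)%N]} n) : KF {mpoly C[(n * k + k)%N]} n :=
  Theta (cm n k h) (mapf (act (k := k) h) eta).

(** The common shape of d ([T] = [DL]) and of q /\ _ ([T] = [qL]), so that equivariance is proved
    once, in [dop_fa]. *)
HB.lock Definition dop (A : comNzRingType) (n : nat) (T : 'I_n -> A -> A) (eta : KF A n) : KF A n :=
  \sum_a ext a (cw (T a) eta).

Section LinearDop.
Variables (A : comNzRingType) (n : nat).

Lemma dopE (T : 'I_n -> A -> A) eta : dop T eta = \sum_a ext a (cw (T a) eta).
Proof. by rewrite dop.unlock. Qed.

Variable (T : 'I_n -> {additive A -> A}).

Fact dop_additive : additive (dop T).
Proof.
move=> u v; rewrite !dopE -sumrB; apply: eq_bigr => a _.
by rewrite !raddfB.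
Qed.
HB.instance Definition _ := GRing.isAdditive.Build (KF A n) (KF A n) (dop T) dop_additive.

Lemma isdeg_dop l eta : isdeg l eta -> isdeg l.+1 (dop T eta).
Proof.
by move=> h; rewrite dopE; apply: isdeg_sum => a _; apply/isdeg_ext/isdeg_cw.
Qed.

Lemma isdeg1_dop l eta : isdeg1 l eta -> isdeg l (dop T eta).
Proof.
case: l => [/isdeg1_0 ->|l]; first by rewrite raddf0 isdeg0.
by rewrite isdeg1S; apply: isdeg_dop.
Qed.

(** Exchanging a and b shows that the square is its own opposite. Commutation is asked only after
    multiplication by omega_a and omega_b, because the components of d commute only modulo forms
    killed by this multiplication. *)
Lemma dop_sq_comm eta : (forall x : A, x *+ 2 = 0 -> x = 0) ->
  (forall a b, ext a (ext b (cw (T b) (cw (T a) eta))) = ext a (ext b (cw (T a) (cw (T b) eta)))) ->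
  dop T (dop T eta) = 0.
Proof.
move=> ch cT; have e : dop T (dop T eta) = - dop T (dop T eta).
  have dd : dop T (dop T eta) = \sum_a \sum_b ext a (ext b (cw (T a) (cw (T b) eta))).
    rewrite [LHS]dopE; apply: eq_bigr => a _; rewrite dopE raddf_sum raddf_sum.
    by apply: eq_bigr => b _; rewrite /= cw_ext.
  rewrite {1}dd exchange_big dd -sumrN; apply: eq_bigr => b _.
  rewrite -sumrN; apply: eq_bigr => a _ /=.
  by rewrite extC -cT.
apply/ffunP=> U; rewrite [RHS]ffunE; apply: ch; rewrite mulr2n.
by rewrite {1}e ffunE addNr.
Qed.

End LinearDop.

Section FormAction.
Variables (C : numClosedFieldType) (n k : nat).
Local Notation P := {mpoly C[(n * k + k)%N]}.
Local Notation fa := (@fa C n k).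
Local Notation act := (@act C n k).
Local Notation cM := (@cm C n k _ _).
Implicit Types (h : 'M[C]_n) (f p q : P) (a b : 'I_n) (i j : 'I_k).
Implicit Types (eta theta : KF P n).

Lemma faE h eta : fa h eta = Theta (cM h) (mapf (act h) eta).
Proof. by rewrite fa.unlock. Qed.

Fact fa_additive h : additive (fa h).
Proof. by move=> u v; rewrite !faE !raddfB. Qed.
HB.instance Definition _ h := GRing.isAdditive.Build (KF P n) (KF P n) (fa h) (fa_additive h).

Lemma faZ h p eta : fa h (p *: eta) = act h p *: fa h eta.
Proof. by rewrite !faE mapfZ linearZ. Qed.

Lemma isdeg_fa h l eta : isdeg l eta -> isdeg l (fa h eta).
Proof. by move=> d; rewrite faE; apply/isdeg_Theta/isdeg_mapf. Qed.

Lemma fa_ext h a eta : fa h (ext a eta) = extv (row a (cM h)) (fa h eta).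
Proof. by rewrite !faE mapf_ext Theta_ext. Qed.

Lemma cm_mul h1 h2 : cM (h1 *m h2) = cM h1 *m cM h2.
Proof.
apply/matrixP=> a b; rewrite !mxE raddf_sum; apply: eq_bigr => c _.
by rewrite !mxE /= mpolyCM.
Qed.
Lemma cm_tr h : cM h^T = (cM h)^T.
Proof. by apply/matrixP=> a b; rewrite !mxE. Qed.
Lemma cm1 : cM (1%:M : 'M[C]_n) = 1%:M.
Proof. by apply/matrixP=> a b; rewrite !mxE; case: eqP => _; rewrite ?mpolyC1 ?mpolyC0. Qed.
Lemma cm_orth h : orth h -> cM h *m (cM h)^T = 1%:M.
Proof. by move=> o; rewrite -cm_tr -cm_mul o cm1. Qed.

Lemma act_cm h1 h2 : map_mx (act h1) (cM h2) = cM h2.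
Proof. by apply/matrixP=> a b; rewrite !mxE actC. Qed.

Lemma fa_comp h1 h2 eta : fa h1 (fa h2 eta) = fa (h2 *m h1) eta.
Proof.
rewrite !faE mapf_Theta act_cm Theta_comp cm_mul; congr (Theta _ _).
by apply/ffunP=> U; rewrite !mapfE /= act_comp.
Qed.

Lemma fa1 eta : fa 1%:M eta = eta.
Proof.
rewrite faE cm1 Theta_id; apply/ffunP=> U; by rewrite mapfE /= act1.
Qed.

Lemma cw_Theta (T : {linear P -> P}) m1 m2 (h : 'M[C]_(m1, m2)) (b : KF P m1) :
  cw T (Theta (@cm C n k _ _ h) b) = Theta (@cm C n k _ _ h) (cw T b).
Proof.
rewrite !ThetaE raddf_sum; apply: eq_bigr => J _ /=; apply/ffunP=> U.
rewrite cwE [X in T X]scE [RHS]scE cwE.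
have -> : wprod (@cm C n k _ _ h) J = mapf (@mpolyC _ C) (wprod h J).
  by rewrite mapf_wprod.
by rewrite mapfE mulrC mul_mpolyC linearZ /= mulrC mul_mpolyC.
Qed.

Lemma kpr_fa d h eta : kpr mdeg d (fa h eta) = fa h (kpr mdeg d eta).
Proof.
rewrite !faE /kpr cw_Theta; congr (Theta _ _); apply/ffunP=> U.
by rewrite !(cwE, mapfE) /= pihomog_act.
Qed.

(** The unit form goes to a multiple of vol, on which h acts by det h. Each further factor turns
    into a contraction under [star], and contractions are equivariant because h h^T = 1. *)
Lemma star_fa h eta : orth h -> star (fa h eta) = (\det h)%:MP *: fa h (star eta).
Proof.
move=> oh; rewrite !faE mapf_star; move: (mapf _ _) => u {eta}.
have dd : (\det h)%:MP = \det (cM h) :> P by rewrite [RHS]det_map_mx.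
have d2 : \det (cM h) * \det (cM h) = 1.
  by rewrite -{2}det_tr -det_mulmx cm_orth // det1.
rewrite dd; elim/KF_ind: u => [|u v hu hv|c u hu|a u hu].
- rewrite Theta0.
  have -> : star (dlt P (set0 : {set 'I_n})) = vsgn P [set: 'I_n] *: dlt P setT.
    apply/ffunP=> U; rewrite starE !ffunE /GRing.scale /= -(inj_eq (@setC_inj _)) setCK setC0.
    by case: eqP => [->|]; rewrite ?mulr0.
  by rewrite linearZ /= Theta_det !scalerA mulrAC d2 mul1r.
- by rewrite !linearD /= hu hv.
- have z1 : Theta (cM h) (c *: u) = c *: Theta (cM h) u by apply: linearZ.
  have z2 : star (c *: Theta (cM h) u) = c *: star (Theta (cM h) u) by apply: linearZ.
  have z3 : star (c *: u) = c *: star u by apply: linearZ.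
  have z4 : Theta (cM h) (c *: star u) = c *: Theta (cM h) (star u) by apply: linearZ.
  rewrite z1 z2 hu z3 z4 scalerA [RHS]scalerA; congr (_ *: _); exact: mulrC.
rewrite Theta_ext star_extv hu linearZ /= star_ext; congr (_ *: _).
by rewrite Theta_intv -row_mul cm_orth // row1 intv_delta.
Qed.

Lemma kip_ext a eta theta : kip (ext a eta) theta = kip eta (int a theta).
Proof.
rewrite /kip (bigID (fun S : {set 'I_n} => a \in S)) /= [X in _ + X]big1 ?addr0; last first.
  by move=> S aS; rewrite extE (negbTE aS) fis0l.
rewrite [RHS](bigID (fun S : {set 'I_n} => a \in S)) /= [X in _ = X + _]big1 ?add0r; last first.
  by move=> S aS; rewrite intE aS fisC fis0l conjC0.
rewrite [RHS](reindex_onto (fun S => S :\ a) (fun S => a |: S)) /=; last first.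
  by move=> S aS; rewrite setU1K.
rewrite (eq_bigl (fun S : {set 'I_n} => (a \notin S :\ a) && (a |: S :\ a == S))); last first.
  move=> S; rewrite !inE eqxx /=; apply/idP/eqP => [/setD1K //|<-].
  by rewrite !inE eqxx.
apply: eq_bigr => S /andP[_ /eqP aS]; rewrite extE intE !inE eqxx /= -aS !inE eqxx /= aS.
rewrite sgD1 ?ltnn ?aS; last by rewrite -aS !inE eqxx.
rewrite /sg -signr_odd; case: odd; last by rewrite expr0 !mul1r.
by rewrite expr1 !mulN1r fisNl fisNr.
Qed.

Lemma kip_suml I (s : seq I) (G : I -> KF P n) theta :
  kip (\sum_(t <- s) G t) theta = \sum_(t <- s) kip (G t) theta.
Proof.
rewrite /kip exchange_big; apply: eq_bigr => S _.
by rewrite sum_ffunE fis_suml.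
Qed.

Lemma kip_cscale c eta theta : kip (c%:MP *: eta) theta = c * kip eta theta.
Proof.
rewrite /kip mulr_sumr; apply: eq_bigr => S _.
by rewrite ffunE [X in fis X _]mul_mpolyC fisZl.
Qed.

Lemma kip_cscaler c eta theta : kip eta (c%:MP *: theta) = c^* * kip eta theta.
Proof. by rewrite kipC kip_cscale rmorphM /= -kipC. Qed.

Lemma kip_sumr I (s : seq I) (G : I -> KF P n) theta :
  kip theta (\sum_(t <- s) G t) = \sum_(t <- s) kip theta (G t).
Proof. by rewrite kipC kip_suml rmorph_sum; apply: eq_bigr => S _; rewrite /= -kipC. Qed.

(** A factor omega_a, transformed by h, moves to the other side as contraction with row a of h;
    orthogonality turns this back into [int a] before the transformation. *)
Lemma kip_fa h eta theta : orth h -> realmx h ->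
  kip (fa h eta) (fa h theta) = kip eta theta.
Proof.
move=> oh rh; rewrite !faE.
have -> : kip eta theta = kip (mapf (act h) eta) (mapf (act h) theta).
  by apply: eq_bigr => S _; rewrite !mapfE /= fis_act.
move: (mapf _ eta) (mapf _ theta) => u v {eta theta}; elim/KF_ind2: u v => [p|u1 u2 h1 h2|a u hu] v.
- have k0 w : kip (p *: dlt P set0) w = fis p (w set0).
    rewrite /kip (bigD1 set0) //= !ffunE eqxx big1 ?addr0 => [|S S0]; first by rewrite /GRing.scale /= mulr1.
    by rewrite !ffunE (negbTE S0) [X in fis X _]mulr0 fis0l.
  rewrite linearZ /= Theta0 !k0; congr (fis _ _).
  rewrite ThetaE sum_ffunE (bigD1 set0) //= wprod0 !ffunE eqxx big1 ?addr0 => [|J J0].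
    exact: mulr1.
  rewrite ffunE (proj1 (isdegP _ _) (isdeg_wprod (cM h) J)); first exact: mulr0.
  by rewrite cards0 eq_sym cards_eq0.
- have kD (w1 w2 w : KF P n) : kip (w1 + w2) w = kip w1 w + kip w2 w.
    have := kip_suml [:: w1; w2] id w; by rewrite !big_cons !big_nil !addr0.
  by rewrite linearD /= !kD h1 h2.
rewrite Theta_ext kip_ext extvE kip_suml.
transitivity (kip (Theta (cM h) u) (intv (row a (cM h)) (Theta (cM h) v))).
  rewrite intvE kip_sumr; apply: eq_bigr => b _; rewrite !mxE.
  by rewrite kip_cscale kip_cscaler kip_ext rh.
by rewrite Theta_intv -row_mul cm_orth // row1 intv_delta hu.
Qed.

(** The operators T and the omega_a transform contragrediently, so their contraction is
    equivariant. *)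
Lemma dop_fa (T : 'I_n -> {linear P -> P}) h eta :
  (forall b f, T b (act h f) = \sum_a (h a b)%:MP * act h (T a f)) ->
  dop T (fa h eta) = fa h (dop T eta).
Proof.
move=> hT; rewrite !dopE raddf_sum /=.
under [RHS]eq_bigr => a _ do rewrite fa_ext extvE.
rewrite exchange_big; apply: eq_bigr => b _ /=.
transitivity (ext b (\sum_a (h a b)%:MP *: fa h (cw (T a) eta))).
  congr (ext b _); rewrite faE cw_Theta.
  transitivity (Theta (cM h) (\sum_a (h a b)%:MP *: mapf (act h) (cw (T a) eta))).
    congr (Theta _ _); apply/ffunP=> U; rewrite cwE mapfE /= hT sum_ffunE.
    by apply: eq_bigr => a _; rewrite ffunE mapfE cwE.
  rewrite linear_sum; apply: eq_bigr => a _.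
  by rewrite linearZ /= faE.
rewrite linear_sum; apply: eq_bigr => a _.
by rewrite linearZ /= !mxE.
Qed.

End FormAction.

(** * Reflections and their effect on forms *)

Section Reflection.
Variables (A : comNzRingType) (N : nat).
Implicit Types (x : 'rV[A]_N) (eta : KF A N).

(** The reflection in x as soon as s * sqn x = 2; carrying s as a parameter avoids division, so that
    the formula makes sense over polynomial rings. *)
Definition refl (s : A) x : 'M[A]_N := 1%:M - s *: (x^T *m x).
Definition sqn x : A := \sum_a x 0 a * x 0 a.

Lemma sqnE x : x *m x^T = (sqn x)%:M.
Proof.
apply/matrixP=> i j; rewrite !ord1 !mxE eqxx mulr1n.
by apply: eq_bigr => a _; rewrite mxE.
Qed.

Lemma refl_tr s x : (refl s x)^T = refl s x.
Proof. by rewrite /refl linearB /= trmx1 linearZ /= trmx_mul trmxK. Qed.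

Lemma refl_orth s x : s * sqn x = 2 -> refl s x *m (refl s x)^T = 1%:M.
Proof.
move=> e; rewrite refl_tr /refl; set y := x^T *m x.
have yy : y *m y = sqn x *: y.
  by rewrite /y mulmxA -(mulmxA x^T) sqnE mul_mx_scalar -scalemxAl.
rewrite mulmxBl mul1mx mulmxBr mulmx1 -scalemxAl -scalemxAr yy !scalerA.
rewrite -?mulrA e mulr_natr mulr2n scalerDl.
by rewrite opprB addrK subrK.
Qed.

Lemma Theta_refl s x eta : s * sqn x = 2 ->
  Theta (refl s x) eta = eta - s *: extv x (intv x eta).
Proof.
move=> e; move: eta; apply: KF_ind => [|u v hu hv|c u hu|a u hu].
- by rewrite Theta0 intv_dlt0 linear0 scaler0 subr0.
- by rewrite !linearD /= hu hv addrACA ?opprD.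
- rewrite !linearZ /= hu scalerBr !scalerA scalerN mulrC.  by [].

rewrite Theta_ext hu.
have -> : row a (refl s x) = delta_mx 0 a - (s * x 0 a) *: x.
  by apply/rowP=> b; rewrite !mxE big_ord1 !mxE eqxx /= [b == a]eq_sym mulrA.
rewrite -[ext a u]extv_delta intv_extv extvBl extvZl.
have -> : \sum_a0 x 0 a0 * (delta_mx 0 a : 'rV_N) 0 a0 = x 0 a.
  rewrite (bigD1 a) //= mxE !eqxx mulr1 big1 ?addr0 // => b ba.
  by rewrite mxE (negbTE ba) andbF mulr0.
move: (delta_mx 0 a : 'rV_N) (intv x u) (x 0 a) => d w c.
have lB z (u1 u2 : KF A N) : extv z (u1 - u2) = extv z u1 - extv z u2 by apply: linearB.
have lZ z p (u1 : KF A N) : extv z (p *: u1) = p *: extv z u1 by apply: linearZ.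
rewrite 3!lB 3!lZ extvv scaler0 subr0 (extvC x d) opprK scalerDr scalerA opprD.
by rewrite addrA addrAC.
Qed.

(** Read off from the volume form: x /\ vol = 0 gives x /\ (x contracted with vol) = sqn x vol, so
    [Theta_refl] multiplies vol by 1 - 2. *)
Lemma det_refl s x : s * sqn x = 2 -> \det (refl s x) = -1.
Proof.
move=> e; have := Theta_refl (dlt A setT) e.
have eT : extv x (dlt A setT) = 0.
  rewrite extvE big1 // => a _; by rewrite ext_dlt inE scaler0.
have : intv x (extv x (dlt A setT)) = 0 by rewrite eT linear0.
rewrite intv_extv -[\sum_a _]/(sqn x) => /eqP; rewrite subr_eq0 => /eqP <-.
rewrite Theta_det scalerA e => /(congr1 (fun u : KF A N => u setT)).
rewrite !ffunE eqxx /GRing.scale /= !mulr1 => ->.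
by rewrite -[2]/(1 + 1) opprD addrA subrr add0r.
Qed.

Lemma Theta_scale K (p : A) (h : 'M[A]_(K, N)) l b : isdeg l b ->
  Theta (p *: h) b = p ^+ l *: Theta h b.
Proof.
move=> /isdegP hb; rewrite !ThetaE scaler_sumr; apply: eq_bigr => J _.
have [Jl|/hb ->] := eqVneq #|J| l; last by rewrite !scale0r scaler0.
rewrite scalerA mulrC -scalerA; congr (_ *: _); rewrite !wprodE -Jl cardE.
elim: (enum J) => [|j r IH] /=; first by rewrite scale1r.
by rewrite linearZ /= extvZl IH linearZ /= scalerA exprS.
Qed.

End Reflection.

(** * Infinitesimal invariance *)

Section Infinitesimal.
Variables (C : numClosedFieldType) (n k : nat).
Local Notation P := {mpoly C[(n * k + k)%N]}.
Local Notation fa := (@fa C n k).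
Local Notation act := (@act C n k).
Local Notation cM := (@cm C n k _ _).
Implicit Types (h : 'M[C]_n) (f g p q : P) (a b c e : 'I_n) (i j : 'I_k).
Implicit Types (eta theta : KF P n).

(** The generator of so(n) in the (a, b)-plane as a vector field, sending z_a to z_b and z_b to -
    z_a. *)
Definition rotop a b f : P :=
  \sum_j (zX C b j * mderiv (zidx a j) f - zX C a j * mderiv (zidx b j) f).

Lemma rotopP a b x f g : rotop a b (x *: f + g) = x *: rotop a b f + rotop a b g.
Proof.
rewrite /rotop scaler_sumr -big_split; apply: eq_bigr => j _ /=.
have dP l : mderiv l (x *: f + g) = x *: mderiv l f + mderiv l g by apply: linearP.
by rewrite !dP !mulrDr -!scalerAr scalerBr opprD addrACA.
Qed.

Lemma rotop1 a b : rotop a b 1 = 0.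
Proof. by rewrite /rotop big1 // => j _; rewrite -mpolyC1 !mderivC !mulr0 subrr. Qed.

Lemma rotopM a b f g : rotop a b (f * g) = rotop a b f * g + f * rotop a b g.
Proof.
rewrite /rotop mulr_suml mulr_sumr -big_split; apply: eq_bigr => j _ /=.
rewrite !mderivM; ring.
Qed.

Lemma rotop_z a b e j : a != b ->
  rotop a b (zX C e j) = (e == a)%:R * zX C b j - (e == b)%:R * zX C a j.
Proof.
move=> ab; rewrite /rotop (bigD1 j) //= big1 ?addr0 => [|i ij].
  by rewrite /zX !mderivXU !zidx_eq !eqxx !andbT mulrC [X in _ - X]mulrC.
rewrite /zX !mderivXU !zidx_eq [j == i]eq_sym (negbTE ij) !andbF !mulr0 subrr //.
Qed.

Lemma rotop_w a b i : rotop a b (wX C n i) = 0.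
Proof.
by rewrite /rotop big1 // => j _; rewrite /wX !mderivXU !wzidx_eq !mulr0 subrr.
Qed.

Variables (a b : 'I_n) (ab : a != b).

Definition vpol : 'rV[{poly P}]_n := delta_mx 0 a + 'X *: delta_mx 0 b.
(* [1 + X^2] times a product of two reflections: the rotation of the (a,b)-plane
   with half-angle tangent X. Its first-order term generates so(n). *)
Definition Hpol : 'M[{poly P}]_n :=
  refl 2 (delta_mx 0 a) *m ((1 + 'X^2)%:M - 2 *: (vpol^T *m vpol)).

Lemma Hpol_coef e c :
  ((Hpol e c)`_0 = (e == c)%:R) *
  ((Hpol e c)`_1 = 2 * ((e == a)%:R * (c == b)%:R - (e == b)%:R * (c == a)%:R)).
Proof.
have GE c1 c2 : ((1 + 'X^2)%:M - 2 *: (vpol^T *m vpol) : 'M[{poly P}]_n) c1 c2 =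
    (1 + 'X^2) * (c1 == c2)%:R -
    2 * (((c1 == a)%:R + 'X * (c1 == b)%:R) * ((c2 == a)%:R + 'X * (c2 == b)%:R)).
  rewrite !mxE big_ord1 !mxE !eqxx /= -[_ *+ (c1 == c2)]mulr_natr.
  by [].

have bE (t : bool) : t%:R = (t%:R : P)%:P by rewrite polyC_natr.
have aux (p1 p2 p3 p4 p5 : P) :
    let G := (1 + 'X^2) * p1%:P - 2 * ((p2%:P + 'X * p3%:P) * (p4%:P + 'X * p5%:P)) in
    (G`_0 = p1 - 2 * (p2 * p4)) * (G`_1 = - 2 * (p2 * p5 + p3 * p4)).
  have -> : (1 + 'X^2) * p1%:P - 2 * ((p2%:P + 'X * p3%:P) * (p4%:P + 'X * p5%:P)) =
     (p1 - 2 * (p2 * p4))%:P + (- 2 * (p2 * p5 + p3 * p4))%:P * 'X +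
     (p1 - 2 * (p3 * p5))%:P * 'X^2.
    rewrite !(polyCB, polyCN, polyCD, polyCM).
    ring.
  by rewrite /= !coefD !coefCM !coefC !coefX !coefXn /= !mulr0 !mulr1 !addr0 add0r.
have Gc c1 c2 : let G := ((1 + 'X^2)%:M - 2 *: (vpol^T *m vpol) : 'M[{poly P}]_n) c1 c2 in
    (G`_0 = (c1 == c2)%:R - 2 * ((c1 == a)%:R * (c2 == a)%:R)) *
    (G`_1 = - 2 * ((c1 == a)%:R * (c2 == b)%:R + (c1 == b)%:R * (c2 == a)%:R)).
  by rewrite /= GE !bE; apply: aux.
have HE : Hpol e c = ((1 + 'X^2)%:M - 2 *: (vpol^T *m vpol) : 'M[{poly P}]_n) e c -
    2 * (e == a)%:R * ((1 + 'X^2)%:M - 2 *: (vpol^T *m vpol) : 'M[{poly P}]_n) a c.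
  rewrite /Hpol /refl mulmxBl mul1mx -scalemxAl -mulmxA -rowE.
  move: ((1 + 'X^2)%:M - _) => G; rewrite !mxE big_ord1 !mxE eqxx /= mulrA //.
rewrite HE [2 * (e == a)%:R](_ : _ = (2 * (e == a)%:R : P)%:P); last first.
  by rewrite polyCM !polyC_natr.
rewrite !coefB !coefCM !Gc eqxx (negbTE ab) [a == c]eq_sym; split; case: (c == a) => /=; ring.
Qed.

End Infinitesimal.

Lemma coefM01 (A : nzRingType) (p q : {poly A}) :
  ((p * q)`_0 = p`_0 * q`_0) * ((p * q)`_1 = p`_0 * q`_1 + p`_1 * q`_0).
Proof. by split; rewrite coefM !big_ord_recl big_ord0 /= ?addr0 ?subn0. Qed.

Section PickSums.
Variables (A : comNzRingType) (N : nat) (z : 'I_N -> A).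
Implicit Types (a b c e : 'I_N).

Lemma sum_coefMC (F : 'I_N -> {poly A}) i :
  (\sum_c F c * (z c)%:P)`_i = \sum_c (F c)`_i * z c.
Proof. by rewrite coef_sum; apply: eq_bigr => c _; rewrite coefMC. Qed.

Lemma sum_pick1 e (G : 'I_N -> A) : (forall c, G c = (e == c)%:R) ->
  \sum_c G c * z c = z e.
Proof.
move=> hG; rewrite (bigD1 e) //= hG eqxx mul1r big1 ?addr0 // => c ce.
by rewrite hG eq_sym (negbTE ce) mul0r.
Qed.

Lemma sum_pick2 a b e (G : 'I_N -> A) :
  (forall c, G c = 2 * ((e == a)%:R * (c == b)%:R - (e == b)%:R * (c == a)%:R)) ->
  \sum_c G c * z c = 2 * ((e == a)%:R * z b - (e == b)%:R * z a).
Proof.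
move=> hG; under eq_bigr => c _ do rewrite hG mulrBr mulrBl.
rewrite sumrB mulrBr; congr (_ - _).
  rewrite (bigD1 b) //= eqxx mulr1 mulrA big1 ?addr0 // => c cb.
  by rewrite (negbTE cb) !mulr0 mul0r.
rewrite (bigD1 a) //= eqxx mulr1 mulrA big1 ?addr0 // => c ca.
by rewrite (negbTE ca) !mulr0 mul0r.
Qed.
End PickSums.

HB.lock Definition kcoef (A : comNzRingType) (N i : nat) (u : KF {poly A} N) : KF A N :=
  [ffun U : {set 'I_N} => (u U)`_i].

Section KCoef.
Variables (A : comNzRingType) (N : nat).
Implicit Types (u : KF {poly A} N).
Lemma kcoefE i u U : kcoef i u U = (u U)`_i.
Proof. by rewrite kcoef.unlock ffunE. Qed.
Fact kcoef_additive i : additive (@kcoef A N i).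
Proof. by move=> u v; apply/ffunP=> U; rewrite !(kcoefE, ffunE) coefB. Qed.
HB.instance Definition _ i :=
  GRing.isAdditive.Build (KF {poly A} N) (KF A N) (@kcoef A N i) (kcoef_additive i).
Lemma kcoef0Z p u : kcoef 0 (p *: u) = p`_0 *: kcoef 0 u.
Proof. by apply/ffunP=> U; rewrite kcoefE !ffunE kcoefE /GRing.scale /= coefM01. Qed.
Lemma kcoef1Z p u : kcoef 1 (p *: u) = p`_0 *: kcoef 1 u + p`_1 *: kcoef 0 u.
Proof. by apply/ffunP=> U; rewrite kcoefE !ffunE !kcoefE /GRing.scale /= coefM01. Qed.
Lemma kcoef_ext i a u : kcoef i (ext a u) = ext a (kcoef i u).
Proof.
apply/ffunP=> U; rewrite kcoefE !extE kcoefE; case: ifP => _; last by rewrite coef0.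
by rewrite /sg -[_`_i]/(coefp i _) raddfMsign.
Qed.
Lemma kcoef_dlt i S : kcoef i (dlt {poly A} S : KF {poly A} N) = if i == 0%N then dlt A S else 0.
Proof.
apply/ffunP=> U; rewrite kcoefE !ffunE; case: i => [|i]; rewrite !ffunE.
  by case: (U == S); rewrite ?coef1 ?coef0.
by case: (U == S); rewrite ?coef1 ?coef0.
Qed.
End KCoef.

(** The same generator on forms: the derivation sending omega_a to omega_b and omega_b to -
    omega_a. *)
HB.lock Definition rotform (A : comNzRingType) N (a b : 'I_N) (eta : KF A N) : KF A N :=
  ext b (int a eta) - ext a (int b eta).

Lemma rotformE (A : comNzRingType) N (a b : 'I_N) (eta : KF A N) :
  rotform a b eta = ext b (int a eta) - ext a (int b eta).
Proof. by rewrite rotform.unlock. Qed.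

Section ThetaCoef.
Variables (A : comNzRingType) (n : nat) (a b : 'I_n) (H : 'M[{poly A}]_n).
Hypothesis H0 : forall e c, (H e c)`_0 = (e == c)%:R.
Hypothesis H1 : forall e c,
  (H e c)`_1 = 2 * ((e == a)%:R * (c == b)%:R - (e == b)%:R * (c == a)%:R).

(** Up to X^2 the matrix is 1 + 2 X (E_ab - E_ba), and to first order an exterior power acts as a
    derivation. *)
Lemma Theta_coef (u : KF {poly A} n) : kcoef 0 (Theta H u) = kcoef 0 u /\
  kcoef 1 (Theta H u) = kcoef 1 u + (2 : A) *: rotform a b (kcoef 0 u).
Proof.
have rD (u1 u2 : KF A n) : rotform a b (u1 + u2) = rotform a b u1 + rotform a b u2.
  by rewrite !rotformE !raddfD /= addrACA.
have rZ p (u1 : KF A n) : rotform a b (p *: u1) = p *: rotform a b u1.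
  rewrite !rotformE scalerBr.
  have e1 : int a (p *: u1) = p *: int a u1 by apply: linearZ.
  have e2 : int b (p *: u1) = p *: int b u1 by apply: linearZ.
  rewrite e1 e2.
  have e3 : ext b (p *: int a u1) = p *: ext b (int a u1) by apply: linearZ.
  have e4 : ext a (p *: int b u1) = p *: ext a (int b u1) by apply: linearZ.
  by rewrite e3 e4.
have id0 c : int c (dlt A (set0 : {set 'I_n})) = 0.
  by rewrite -intv_delta intv_dlt0.
have kD i (u1 u2 : KF {poly A} n) : kcoef i (u1 + u2) = kcoef i u1 + kcoef i u2.
  by apply: raddfD.
elim/KF_ind: u => [|u v [u0 u1] [v0 v1]|p u [u0 u1]|c u [u0 u1]].
- by rewrite Theta0 !kcoef_dlt /= !rotformE !id0 !raddf0 !addr0 scaler0 ?addr0.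
- have -> : Theta H (u + v) = Theta H u + Theta H v by apply: linearD.
  rewrite !kD u0 u1 v0 v1 rD; split=> //.
  by rewrite [_ *: (_ + _)]scalerDr addrACA.
- have -> : Theta H (p *: u) = p *: Theta H u by apply: linearZ.
  rewrite !kcoef0Z !kcoef1Z u0 u1 rZ; split=> //.
  rewrite scalerDr -!addrA; congr (_ + _); rewrite addrC; congr (_ + _).
  by rewrite !scalerA mulrC.
rewrite Theta_ext extvE !raddf_sum /=; split.
  rewrite (bigD1 c) //= kcoef0Z kcoef_ext mxE H0 eqxx scale1r [kcoef 0 (ext c (Theta _ _))]kcoef_ext u0.
  rewrite big1 ?addr0 // => e ec; rewrite kcoef0Z mxE H0 eq_sym (negbTE ec); exact: scale0r.
under eq_bigr => e _ do rewrite kcoef1Z !kcoef_ext u0 u1 mxE H0 H1.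
rewrite big_split /=.
have -> : \sum_e (c == e)%:R *: ext e (kcoef 1 u + (2 : A) *: rotform a b (kcoef 0 u)) =
    ext c (kcoef 1 u + (2 : A) *: rotform a b (kcoef 0 u)).
  rewrite (bigD1 c) //= eqxx scale1r big1 ?addr0 // => e ec.
  by rewrite eq_sym (negbTE ec) scale0r.
rewrite !kcoef_ext raddfD /= -addrA; congr (_ + _).
have -> : ext c ((2 : A) *: rotform a b (kcoef 0 u)) = (2 : A) *: ext c (rotform a b (kcoef 0 u)).
  exact: linearZ.
move: (kcoef 0 u) => w.
have -> : \sum_e (2 * ((c == a)%:R * (e == b)%:R - (c == b)%:R * (e == a)%:R) : A) *: ext e w =
    (2 : A) *: ((c == a)%:R *: ext b w - (c == b)%:R *: ext a w).
  under eq_bigr => e _ do rewrite -scalerA scalerBl.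
  rewrite -scaler_sumr sumrB; congr (_ *: (_ - _)).
    rewrite (bigD1 b) //= eqxx mulr1 big1 ?addr0 // => e eb.
    by rewrite (negbTE eb) mulr0 scale0r.
  rewrite (bigD1 a) //= eqxx mulr1 big1 ?addr0 // => e ea.
  by rewrite (negbTE ea) mulr0 scale0r.
rewrite -scalerDr; congr (_ *: _); rewrite !rotformE !intext.
rewrite [c == a]eq_sym [c == b]eq_sym !raddfB /=.
have eZ d (t : A) : ext d (t *: w) = t *: ext d w by apply: linearZ.
rewrite !eZ [ext b (ext c _)]extC [ext a (ext c _)]extC !opprK.
by rewrite addrC addrACA.
Qed.

End ThetaCoef.

Section PhiDef.
Variables (C : numClosedFieldType) (n k : nat).
Local Notation P := {mpoly C[(n * k + k)%N]}.
(** [Hpol] is a rotation scaled by 1 + X^2. Scaling the w_i by the same factor makes the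
    substitution at X = t equal to (1 + t^2)^d times a rotation on polynomials of degree d. *)
Definition PhiX (H : 'M[{poly P}]_n) (l : 'I_(n * k + k)) : {poly P} :=
  match split l with
  | inl l' => let: (e, j) := (enum_val (cast_ord (esym (mxvec_cast n k)) l')) in
              \sum_c H e c * (zX C c j)%:P
  | inr i => (1 + 'X^2) * (wX C n i)%:P
  end.
End PhiDef.

HB.lock Definition Phi (C : numClosedFieldType) (n k : nat)
    (H : 'M[{poly {mpoly C[(n * k + k)%N]}}]_n) (f : {mpoly C[(n * k + k)%N]}) :
    {poly {mpoly C[(n * k + k)%N]}} :=
  mmap (polyC \o @mpolyC _ C) (PhiX H) f.

Section PhiTheory.
Variables (C : numClosedFieldType) (n k : nat).
Local Notation P := {mpoly C[(n * k + k)%N]}.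
Variables (a b : 'I_n) (ab : a != b) (H : 'M[{poly P}]_n).
Hypothesis H0 : forall e c, (H e c)`_0 = (e == c)%:R.
Hypothesis H1 : forall e c,
  (H e c)`_1 = 2 * ((e == a)%:R * (c == b)%:R - (e == b)%:R * (c == a)%:R).
Implicit Types (f g : P) (e c : 'I_n) (i j : 'I_k).
Local Notation Phi := (@Phi C n k H).

Fact Phi_additive : additive Phi.
Proof. by move=> f g; rewrite Phi.unlock raddfB. Qed.
HB.instance Definition _ := GRing.isAdditive.Build P {poly P} Phi Phi_additive.
Fact Phi_monoid : monoid_morphism Phi.
Proof. by split=> [|f g]; rewrite Phi.unlock; [apply: rmorph1 | apply: rmorphM]. Qed.
HB.instance Definition _ := GRing.isMonoidMorphism.Build P {poly P} Phi Phi_monoid.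

Lemma Phi_z e j : Phi (zX C e j) = \sum_c H e c * (zX C c j)%:P.
Proof.
rewrite Phi.unlock /zX mmapX mmap1U /PhiX /zidx.
by rewrite (unsplitK (inl _)) /mxvec_index cast_ordK enum_rankK.
Qed.
Lemma Phi_w i : Phi (wX C n i) = (1 + 'X^2) * (wX C n i)%:P.
Proof. by rewrite Phi.unlock /wX mmapX mmap1U /PhiX /widx (unsplitK (inr _)). Qed.
Lemma PhiC x : Phi x%:MP = (x%:MP)%:P.
Proof. by rewrite Phi.unlock mmapC. Qed.
Lemma PhiM f g : Phi (f * g) = Phi f * Phi g.
Proof. exact: rmorphM. Qed.
Lemma PhiP x f g : Phi (x *: f + g) = (x%:MP)%:P * Phi f + Phi g.
Proof. by rewrite -mul_mpolyC raddfD /= PhiM PhiC. Qed.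

Lemma Phi_coef f : ((Phi f)`_0 = f) /\ ((Phi f)`_1 = 2 * rotop a b f).
Proof.
elim/mpoly_indX: f => [|x f g [hf0 hf1] [hg0 hg1]|l p [hp0 hp1]].
- by rewrite rmorph1 !coefC rotop1 mulr0.
- rewrite PhiP !coefD !coefCM hf0 hf1 hg0 hg1 rotopP !mul_mpolyC; split=> //.
  by rewrite mulrDr -scalerAr.
have [X0 X1] : (Phi 'X_l)`_0 = 'X_l /\ (Phi 'X_l)`_1 = 2 * rotop a b 'X_l.
  case: (var_case l) => [[e [j ->]]|[j ->]]; last first.
    rewrite -[mpolyX _ _]/(wX C n j) Phi_w rotop_w mulr0 !coefMC.
    by rewrite !coefD !coefC !coefXn /= !addr0 mul1r mul0r.
  rewrite -[mpolyX _ _]/(zX C e j) Phi_z rotop_z //; split.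
    apply: etrans (sum_coefMC _ _ _) _; apply: sum_pick1 => c; exact: H0.
  apply: etrans (sum_coefMC _ _ _) _; apply: sum_pick2 => c; exact: H1.
rewrite PhiM !coefM01 hp0 hp1 X0 X1 rotopM; split=> //.
by ring.
Qed.

End PhiTheory.

Lemma map_refl (A B : comNzRingType) (f : {rmorphism A -> B}) N s (x : 'rV[A]_N) :
  map_mx f (refl s x) = refl (f s) (map_mx f x).
Proof. by rewrite /refl map_mxB map_mx1 map_mxZ map_mxM map_trmx. Qed.

Lemma poly_nat_eq0 (A : idomainType) (p : {poly A}) :
  (forall t : nat, t.+1%:R != 0 :> A) -> (forall t : nat, p.[t%:R] = 0) -> p = 0.
Proof.
move=> ch hp; apply: (@roots_geq_poly_eq0 _ p [seq t%:R | t <- iota 0 (size p)]).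
- by apply/allP=> x /mapP [t _ ->]; rewrite rootE hp.
- rewrite map_inj_in_uniq ?iota_uniq // => s t _ _.
  have aux s' t' : (s' <= t')%N -> s'%:R = t'%:R :> A -> s' = t'.
    move=> /subnKC <-; rewrite natrD -{1}[s'%:R]addr0 => /addrI /esym.
    by case: (t' - s')%N => [|d] /eqP; rewrite ?addn0 // (negbTE (ch _)).
  by case: (leqP s t) => [/aux//|/ltnW/aux h /esym/h ->].
- by rewrite size_map size_iota.
Qed.

Section Evaluation.
Variables (C : numClosedFieldType) (n k : nat).
Local Notation P := {mpoly C[(n * k + k)%N]}.
Local Notation fa := (@fa C n k).
Local Notation act := (@act C n k).
Local Notation cM := (@cm C n k _ _).
Implicit Types (h : 'M[C]_n) (f g p q : P) (a b c e : 'I_n) (i j : 'I_k).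
Implicit Types (eta theta : KF P n).

Lemma natP_neq0 (t : nat) : t.+1%:R != 0 :> P.
Proof.
by rewrite -(rmorph_nat (@mpolyC _ C)) mpolyC_eq0 pnatr_eq0.
Qed.

Lemma pihomog_scale (E : {rmorphism P -> P}) h (u : P) d f :
  (forall l, E 'X_l = u * act h 'X_l) -> (forall c : C, E c%:MP = c%:MP) ->
  E (pihomog mdeg d f) = u ^+ d * act h (pihomog mdeg d f).
Proof.
move=> EX EC; have Em m : E 'X_[m] = u ^+ mdeg m * act h 'X_[m].
  rewrite mpolyXE_id !rmorph_prod /= mdegE -prodrXr -big_split /=.
  by apply: eq_bigr => l _; rewrite !rmorphXn /= EX exprMn.
rewrite pihomogE !raddf_sum mulr_sumr; apply: eq_bigr => m /eqP <- /=.
rewrite -mul_mpolyC rmorphM EC /= Em actM actC; ring.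
Qed.

(** The value of [Hpol] at X = t divided by 1 + t^2. Natural t give real matrices and suffice to
    determine a polynomial in X. *)
Definition hrot a b (t : nat) : 'M[C]_n :=
  refl 2 (delta_mx 0 a) *m refl (2 / (1 + t%:R ^+ 2)) (delta_mx 0 a + t%:R *: delta_mx 0 b).

Lemma sqn_delta (A : comNzRingType) (N : nat) (a b : 'I_N) (t : A) : a != b ->
  sqn (delta_mx 0 a + t *: delta_mx 0 b) = 1 + t ^+ 2.
Proof.
move=> ab; rewrite /sqn (bigD1 a) //= (bigD1 b) 1?eq_sym //= big1.
  rewrite !mxE !eqxx /= (negbTE ab) [b == a]eq_sym (negbTE ab) /=; ring.
by move=> c /andP[/negbTE ca /negbTE cb]; rewrite !mxE ca cb /= mulr0 addr0 mulr0.
Qed.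

Lemma nat_u_neq0 t : (1 + t%:R ^+ 2 : C) != 0.
Proof. by rewrite -natrX addrC natr1 pnatr_eq0. Qed.

Lemma hrot_det a b t : a != b -> \det (hrot a b t) = 1.
Proof.
move=> ab; rewrite /hrot det_mulmx !det_refl ?mulrNN ?mulr1 //.
  by rewrite sqn_delta // divfK // nat_u_neq0.
by rewrite -[delta_mx 0 a]addr0 -[X in _ + X](scale0r (delta_mx 0 b)) sqn_delta // expr0n addr0 mulr1.
Qed.

Lemma hrot_orth a b t : a != b -> orth (hrot a b t).
Proof.
move=> ab; apply: orth_mul; apply: refl_orth.
  by rewrite -[delta_mx 0 a]addr0 -[X in _ + X](scale0r (delta_mx 0 b)) sqn_delta // expr0n addr0 mulr1.
by rewrite sqn_delta // divfK // nat_u_neq0.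
Qed.

Lemma realmx_refl s (x : 'rV[C]_n) : s^* = s -> (forall c, (x 0 c)^* = x 0 c) -> realmx (refl s x).
Proof.
move=> hs hx c e; rewrite /refl !mxE big_ord1 !mxE.
by rewrite rmorphB rmorphM rmorphM /= !hx hs conjC_nat.
Qed.

Lemma hrot_real a b t : realmx (hrot a b t).
Proof.
apply: realmx_mul; apply: realmx_refl.
- exact: conjC_nat.
- by move=> c; rewrite mxE conjC_nat.
- by rewrite -natrX [1 + _]addrC natr1 fmorph_div /= !conjC_nat.
- by move=> c; rewrite !mxE rmorphD rmorphM /= !conjC_nat.
Qed.

Variables (a b : 'I_n) (ab : a != b).
Local Notation H := (Hpol C k a b).
Local Notation ev t := (horner_eval (t%:R : P)).
Local Notation uC t := (1 + t%:R ^+ 2 : C).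

Lemma ev_H t : map_mx (ev t) H = (uC t)%:MP *: cM (hrot a b t).
Proof.
have e1 : map_mx (ev t) H = map_mx (ev t) (refl 2 (delta_mx 0 a)) *m
    map_mx (ev t) ((1 + 'X^2)%:M - 2 *: ((vpol C k a b)^T *m vpol C k a b)) by apply: map_mxM.
have e2 : (uC t)%:MP *: cM (hrot a b t) = cM (refl 2 (delta_mx 0 a)) *m
    ((uC t)%:MP *: cM (refl (2 / uC t) (delta_mx 0 a + t%:R *: delta_mx 0 b))).
  by rewrite /hrot cm_mul; apply: scalemxAr.
rewrite e1 e2; congr mulmx.
  rewrite /cm !map_refl !map_delta_mx.
  by congr refl; rewrite ?rmorph_nat.
rewrite /cm map_refl /refl scalerBr map_mxB map_mxZ map_mxM map_trmx map_scalar_mx.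
have ev2 : map_mx (ev t) (vpol C k a b) = map_mx (@mpolyC _ C) (delta_mx 0 a + t%:R *: delta_mx 0 b).
  rewrite /vpol !map_mxD !map_mxZ !map_delta_mx /= /horner_eval hornerX.
  by rewrite rmorph_nat.
rewrite ev2 scalerA; congr (_ - _ *: _).
  rewrite scalemx1 /= /horner_eval !hornerE; congr _%:M.
  by rewrite rmorphD rmorph1 rmorphXn rmorph_nat.
rewrite -rmorphM /= mulrC divfK ?nat_u_neq0 // rmorph_nat.
  by rewrite rmorph_nat.
by rewrite -!map_trmx; congr (_^T *m _); exact: ev2.
Qed.

Lemma ev_Phi t d f :
  horner_eval (t%:R : P) (Phi H (pihomog mdeg d f)) =
  (uC t)%:MP ^+ d * act (hrot a b t) (pihomog mdeg d f).
Proof.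
pose E : {rmorphism P -> P} := (ev t \o Phi H)%FUN.
rewrite -[LHS]/(E _); apply: pihomog_scale => [l|c]; rewrite /E /=; last first.
  by rewrite PhiC /horner_eval hornerC.
have euC : (1 + 'X^2 : {poly P}).[t%:R] = (uC t)%:MP.
  by rewrite !hornerE rmorphD rmorph1 rmorphXn rmorph_nat.
case: (var_case l) => [[e [j ->]]|[j ->]]; last first.
  rewrite -[mpolyX _ _]/(wX C n j) Phi_w act_w /horner_eval hornerM hornerC.
  by rewrite euC.
rewrite -[mpolyX _ _]/(zX C e j) Phi_z act_z /horner_eval horner_sum mulr_sumr.
apply: eq_bigr => c _; rewrite hornerM hornerC mulrA; congr (_ * _).
have /matrixP/(_ e c) := ev_H t.
by rewrite !mxE /horner_eval => ->.
Qed.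

Definition SOinv eta := forall h, orth h -> realmx h -> \det h = 1 -> fa h eta = eta.

(** By invariance the scaled curve sends eta to (1 + t^2)^(l + d) eta for each natural t, hence to
    (1 + X^2)^(l + d) eta as a polynomial. This has no linear term in X, while [Theta_coef] and
    [Phi_coef] compute that term as twice the left side. *)
Lemma infinitesimal_homog l d eta : isdeg l eta -> kpr mdeg d eta = eta -> SOinv eta ->
  cw (rotop a b) eta + rotform a b eta = 0.
Proof.
move=> deg hd inv; set T := Theta H (mapf (Phi H) eta).
have [H0 H1] : (forall e c, (H e c)`_0 = (e == c)%:R) /\
    (forall e c, (H e c)`_1 = 2 * ((e == a)%:R * (c == b)%:R - (e == b)%:R * (c == a)%:R)).
  by split=> e c; case: (Hpol_coef C k ab e c).
have evT t : mapf (ev t) T = (uC t)%:MP ^+ (l + d) *: eta.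
  rewrite /T mapf_Theta ev_H.
  have -> : mapf (ev t) (mapf (Phi H) eta) =
      (uC t)%:MP ^+ d *: mapf (act (hrot a b t)) eta.
    apply/ffunP=> U; rewrite ffunE !mapfE.
    have -> : eta U = pihomog mdeg d (eta U) by rewrite -kprE hd.
    exact: ev_Phi.
  rewrite (@Theta_scale _ _ _ _ _ l); last by apply: isdegZ; apply: isdeg_mapf.
  have -> : Theta (cM (hrot a b t)) ((uC t)%:MP ^+ d *: mapf (act (hrot a b t)) eta) =
     (uC t)%:MP ^+ d *: Theta (cM (hrot a b t)) (mapf (act (hrot a b t)) eta) by apply: linearZ.
  rewrite -faE (inv _ (hrot_orth t ab) (hrot_real a b t) (hrot_det t ab)).
  by rewrite scalerA -exprD.
have TU U : T U = (1 + 'X^2) ^+ (l + d) * (eta U)%:P.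
  apply/eqP; rewrite -subr_eq0; apply/eqP; apply: poly_nat_eq0 => t; first exact: natP_neq0.
  rewrite hornerD hornerN hornerM hornerC horner_exp.
  have -> : (1 + 'X^2 : {poly P}).[t%:R] = (uC t)%:MP.
    by rewrite !hornerE rmorphD rmorph1 rmorphXn rmorph_nat.
  have e : mapf (ev t) T U = (uC t)%:MP ^+ (l + d) * eta U by rewrite evT ffunE.
  rewrite mapfE in e; apply/eqP; rewrite subr_eq0; apply/eqP; exact: e.
have T1 : kcoef 1 T = 0.
  apply/ffunP=> U; rewrite kcoefE TU coefMC ffunE.
  suff -> : ((1 + 'X^2 : {poly P}) ^+ (l + d))`_1 = 0 by rewrite mul0r.
  suff [_ ->] : ((1 + 'X^2 : {poly P}) ^+ (l + d))`_0 = 1 /\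
    ((1 + 'X^2 : {poly P}) ^+ (l + d))`_1 = 0 by [].
  elim: (l + d)%N => [|m [IH0 IH1]]; first by rewrite expr0 !coefC.
  by rewrite exprS !coefM01 IH0 IH1 !coefD !coefC !coefXn /= !addr0 !mulr1 mulr0 addr0.
have := (Theta_coef H0 H1 (mapf (Phi H) eta)).2; rewrite -/T T1.
have -> : kcoef 0 (mapf (Phi H) eta) = eta.
  by apply/ffunP=> U; rewrite kcoefE mapfE (Phi_coef ab H0 H1 _).1.
have -> : kcoef 1 (mapf (Phi H) eta) = (2 : P) *: cw (rotop a b) eta.
  by apply/ffunP=> U; rewrite kcoefE mapfE ffunE cwE (Phi_coef ab H0 H1 _).2.
rewrite -scalerDr => /esym /ffunP e; apply/ffunP=> U.
have e2 : 2 * (cw (rotop a b) eta + rotform a b eta) U = 0 by move: (e U); rewrite scE [RHS]ffunE.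
move/eqP: e2; rewrite mulf_eq0 (negbTE (natP_neq0 1)) /= => /eqP ->.
by rewrite !ffunE.
Qed.
End Evaluation.

(** * The differential and its leading part *)

Section Differential.
Variables (C : numClosedFieldType) (n k : nat).
Local Notation P := {mpoly C[(n * k + k)%N]}.
Local Notation fa := (@fa C n k).
Local Notation act := (@act C n k).
Local Notation cM := (@cm C n k _ _).
Implicit Types (h : 'M[C]_n) (f g p q : P) (a b c e : 'I_n) (i j : 'I_k).
Implicit Types (eta theta : KF P n).

Lemma rotop_additive a b : additive (rotop a b : P -> P).
Proof. by move=> f g; rewrite addrC -scaleN1r rotopP scaleN1r addrC. Qed.
HB.instance Definition _ a b := GRing.isAdditive.Build P P (rotop a b) (rotop_additive a b).

Lemma SOinvB eta theta : SOinv eta -> SOinv theta -> SOinv (eta - theta).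
Proof.
move=> i1 i2 h oh rh dh.
have -> : fa h (eta - theta) = fa h eta - fa h theta by apply: raddfB.
by rewrite i1 ?i2.
Qed.

Lemma SOinv_kpr d eta : SOinv eta -> SOinv (kpr mdeg d eta).
Proof. by move=> i1 h oh rh dh; rewrite -kpr_fa i1. Qed.

Lemma kle_sub_kpr v N (mf : measure v) W (eta : KF {mpoly C[v]} N) :
  kle mf W.+1 eta -> kle mf W (eta - kpr mf W eta).
Proof.
move=> h; apply: kleS; first by apply: kleB => //; apply: kle_kpr.
have -> : kpr mf W (eta - kpr mf W eta) = kpr mf W eta - kpr mf W (kpr mf W eta) by apply: raddfB.
by rewrite kprI subrr.
Qed.

Lemma isdeg_kpr v N (mf : measure v) W l (eta : KF {mpoly C[v]} N) :
  isdeg l eta -> isdeg l (kpr mf W eta).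
Proof. exact: isdeg_cw. Qed.

(** The homogeneous components of an invariant form are invariant, so the graded statement is
    applied from the top degree downwards. *)
Lemma infinitesimal a b l eta : a != b -> isdeg l eta -> SOinv eta ->
  cw (rotop a b) eta + rotform a b eta = 0.
Proof.
move=> ab; have [W] := kle_ex mdeg eta.
elim: W eta => [|W IH] eta.
  move=> /kle0 -> _ _; rewrite raddf0 add0r rotformE.
  have z c : int c (0 : KF P n) = 0 by apply: raddf0.
  have z' c : ext c (0 : KF P n) = 0 by apply: raddf0.
  by rewrite !z !z' subrr.
move=> hW deg inv.
have := IH (eta - kpr mdeg W eta) (kle_sub_kpr hW)
  (isdegB deg (isdeg_kpr _ _ deg)) (SOinvB inv (SOinv_kpr _ inv)).
have := infinitesimal_homog ab (isdeg_kpr mdeg W deg) (kprI mdeg W eta) (SOinv_kpr W inv).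
set z := kpr _ _ _ => h1 h2.
have e : cw (rotop a b) eta + rotform a b eta =
   (cw (rotop a b) z + rotform a b z) + (cw (rotop a b) (eta - z) + rotform a b (eta - z)).
  have -> : cw (rotop a b) (eta - z) = cw (rotop a b) eta - cw (rotop a b) z by apply: raddfB.
  have -> : rotform a b (eta - z) = rotform a b eta - rotform a b z.
    rewrite !rotformE.
    have zB c : int c (eta - z) = int c eta - int c z by apply: raddfB.
    have zB' c (x y : KF P n) : ext c (x - y) = ext c x - ext c y by apply: raddfB.
    by rewrite !zB !zB' !opprB addrACA [X in _ + X = _]addrC [RHS]addrACA [- _ - _]addrC -opprB opprK.
  by rewrite addrACA [_ + (cw _ _ - _)]addrC subrK [_ + (rotform _ _ _ - _)]addrC subrK.
by rewrite e h1 h2 addr0.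
Qed.

Definition qX a : P := \sum_i zX C a i * wX C n i.
Definition Lop a f : P := \sum_j mderiv (zidx a j) (mderiv (widx n j) f).
Definition DX a f : P := Lop a f - qX a * f.

Fact DX_linear a : linear (DX a).
Proof.
move=> x f g; rewrite /DX /Lop scalerBr mulrDr -scalerAr opprD addrACA; congr (_ + _).
rewrite scaler_sumr -big_split; apply: eq_bigr => j _ /=.
have dP l x' f' g' : mderiv l (x' *: f' + g' : P) = x' *: mderiv l f' + mderiv l g' by apply: linearP.
by rewrite !dP.
Qed.
HB.instance Definition _ a := GRing.isLinear.Build C P P _ (DX a) (DX_linear a).
Definition DL a : {linear P -> P} := DX a.

Definition qm a f : P := qX a * f.
Fact qm_linear a : linear (qm a).
Proof. by move=> x f g; rewrite /qm mulrDr -scalerAr. Qed.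
HB.instance Definition _ a := GRing.isLinear.Build C P P _ (qm a) (qm_linear a).
Definition qL a : {linear P -> P} := qm a.
Definition qrow : 'rV[P]_n := \row_a qX a.

Lemma dop_q eta : dop qL eta = extv qrow eta.
Proof.
rewrite dopE extvE; apply: eq_bigr => a _; rewrite mxE -linearZ; congr (ext a _).
by apply/ffunP=> U; rewrite cwE ffunE.
Qed.

Lemma act_q h a : act h (qX a) = \sum_c (h a c)%:MP * qX c.
Proof.
rewrite /qX rmorph_sum /=.
under eq_bigr => i _ do rewrite actM act_z act_w mulr_suml.
rewrite exchange_big; apply: eq_bigr => c _; rewrite mulr_sumr.
by apply: eq_bigr => i _; rewrite mulrA.
Qed.

Lemma qL_act h b f : orth h -> qL b (act h f) = \sum_a (h a b)%:MP * act h (qL a f).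
Proof.
move=> /orth_tr oh; rewrite /qL /= /qm.
under eq_bigr => a _ do rewrite actM act_q mulrA mulr_sumr.
rewrite -mulr_suml exchange_big /=; congr (_ * _).
have ht c : \sum_a (h a b)%:MP * (h a c)%:MP = (b == c)%:R :> P.
  have := congr1 (fun M : 'M_n => M b c) oh; rewrite !mxE => /(congr1 (fun x => x%:MP : P)).
  rewrite rmorph_nat => <-.
  by rewrite rmorph_sum; apply: eq_bigr => a _; rewrite !mxE rmorphM.
transitivity (\sum_c (\sum_a (h a b)%:MP * (h a c)%:MP) * qX c); last first.
  by apply: eq_bigr => c _; rewrite mulr_suml; apply: eq_bigr => a _; rewrite mulrA.
rewrite (bigD1 b) //= ht eqxx mul1r big1 ?addr0 // => c cb.
by rewrite ht eq_sym (negbTE cb) mul0r.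
Qed.

Lemma Lop_act h b f : Lop b (act h f) = \sum_a (h a b)%:MP * act h (Lop a f).
Proof.
rewrite /Lop; under [RHS]eq_bigr => a _ do rewrite rmorph_sum mulr_sumr.
rewrite exchange_big; apply: eq_bigr => j _ /=.
by rewrite mderiv_act_w mderiv_act_z.
Qed.

Lemma DL_act h b f : orth h -> DL b (act h f) = \sum_a (h a b)%:MP * act h (DL a f).
Proof.
move=> oh; rewrite /DL /= /DX Lop_act.
have -> : qX b * act h f = qL b (act h f) by [].
rewrite (qL_act _ _ oh) -sumrB; apply: eq_bigr => a _.
have -> : act h (Lop a f - qX a * f) = act h (Lop a f) - act h (qX a * f) by apply: raddfB.
by rewrite mulrBr.
Qed.

Lemma mderiv_qw b j f : mderiv (widx n j) (qX b * f) = zX C b j * f + qX b * mderiv (widx n j) f.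
Proof.
rewrite mderivM; congr (_ * _ + _); rewrite /qX linear_sum (bigD1 j) //= big1 => [|i ij].
  by rewrite mderivM /zX /wX !mderivXU zwidx_eq eqxx mul0r mulr1 add0r addr0.
by rewrite mderivM /zX /wX !mderivXU zwidx_eq widx_eq (negbTE ij) mul0r mulr0 addr0.
Qed.

Lemma mderiv_qz a b j f : a != b ->
  mderiv (zidx a j) (qX b * f) = qX b * mderiv (zidx a j) f.
Proof.
move=> ab; rewrite mderivM; suff -> : mderiv (zidx a j) (qX b) = 0 by rewrite mul0r add0r.
rewrite /qX linear_sum big1 // => i _ /=.
by rewrite mderivM /zX /wX !mderivXU zidx_eq wzidx_eq eq_sym (negbTE ab) mul0r mulr0 addr0.
Qed.

Lemma Lop_q a b f : a != b ->
  Lop a (qX b * f) = qX b * Lop a f + \sum_j zX C b j * mderiv (zidx a j) f.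
Proof.
move=> ab; rewrite /Lop mulr_sumr -big_split; apply: eq_bigr => j _ /=.
have dD l f' g' : mderiv l (f' + g' : P) = mderiv l f' + mderiv l g' by apply: linearD.
rewrite mderiv_qw dD mderiv_qz // mderivM /zX mderivXU zidx_eq eq_sym (negbTE ab) mul0r add0r.
by rewrite addrC.
Qed.

Lemma Lop_comm a b f : Lop a (Lop b f) = Lop b (Lop a f).
Proof.
rewrite /Lop.
have dS l (F : 'I_k -> P) : mderiv l (\sum_j F j) = \sum_j mderiv l (F j) by apply: linear_sum.
under eq_bigr => j _ do rewrite !dS.
under [RHS]eq_bigr => j _ do rewrite !dS.
rewrite exchange_big; apply: eq_bigr => i _; apply: eq_bigr => j _ /=.
rewrite [mderiv (widx n j) (mderiv (zidx b i) _)]mderiv_comm.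
rewrite [mderiv (widx n i) (mderiv (zidx a j) _)]mderiv_comm.
rewrite [LHS]mderiv_comm; congr (mderiv _ (mderiv _ _)); exact: mderiv_comm.
Qed.

(** The second-order parts commute with each other, and so do the multiplications; the cross terms
    given by [Lop_q] add up to the rotation. *)
Lemma DX_comm a b f : a != b -> DX a (DX b f) = DX b (DX a f) - rotop a b f.
Proof.
move=> ab; rewrite /DX.
have LB c f' g' : Lop c (f' - g') = Lop c f' - Lop c g'.
  rewrite /Lop -sumrB; apply: eq_bigr => j _.
  have dB l f1 g1 : mderiv l (f1 - g1 : P) = mderiv l f1 - mderiv l g1 by apply: linearB.
  by rewrite !dB.
rewrite !LB Lop_comm Lop_q // [Lop b (qX a * f)]Lop_q 1?eq_sym // /rotop sumrB.
ring.
Qed.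

(* The [DL a] do not commute: [DL a, DL b] = - rotop a b, and d^2 = 0 only holds on
   SO(n)-invariant forms, where [rotop a b] acts as [- rotform a b]. *)
Lemma dop_DL_sq l eta : isdeg l eta -> SOinv eta -> dop DL (dop DL eta) = 0.
Proof.
move=> deg inv; apply: dop_sq_comm => [x|a b].
  by move/eqP; rewrite -mulr_natl mulf_eq0 (negbTE (natP_neq0 _ _ _ 1)) => /eqP.
have eN c (x : KF P n) : ext c (- x) = - ext c x by apply: raddfN.
have eB c (x y : KF P n) : ext c (x - y) = ext c x - ext c y by apply: raddfB.
have extaa c (x : KF P n) : ext c (ext c x) = 0 by rewrite -!extv_delta extvv.
have [->|ab] := eqVneq a b; first by rewrite !extaa.
have e : cw (DL a) (cw (DL b) eta) = cw (DL b) (cw (DL a) eta) + rotform a b eta.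
  have /eqP := infinitesimal ab deg inv; rewrite addrC addr_eq0 => /eqP ->.
  by apply/ffunP=> U; rewrite !(ffunE, cwE) /= DX_comm.
(* Each term of [rotform a b eta] has a factor omega_a or omega_b, so it dies under [ext a] after
   [ext b]. *)
rewrite e rotformE.
have eD c (x y : KF P n) : ext c (x + y) = ext c x + ext c y by apply: raddfD.
have e0 c : ext c (0 : KF P n) = 0 by apply: raddf0.
rewrite !eD !eN extaa e0 add0r [ext b (ext a _)]extC eN extaa !oppr0 addr0.
by [].
Qed.

End Differential.

Definition wgt v (w : 'I_v -> nat) (m : 'X_{1..v}) : nat := (\sum_i m i * w i)%N.

Section Weights.
Variables (v : nat) (w : 'I_v -> nat).
Fact wgt0 : wgt w 0%MM = 0%N.
Proof. by rewrite /wgt big1 // => i _; rewrite mnm0E mul0n. Qed.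
Fact wgtD : {morph wgt w : m1 m2 / (m1 + m2)%MM >-> (m1 + m2)%N}.
Proof. by move=> m1 m2; rewrite /wgt -big_split; apply: eq_bigr => i _; rewrite mnmDE mulnDl. Qed.
HB.instance Definition _ := isMeasure.Build v (wgt w) wgt0 wgtD.
Lemma wgtU l : wgt w U_(l)%MM = w l.
Proof.
rewrite /wgt (bigD1 l) //= mnm1E eqxx mul1n big1 ?addn0 // => i il.
by rewrite mnm1E eq_sym (negbTE il).
Qed.
End Weights.

Lemma disjoint_lepm v (u1 u2 m : 'X_{1..v}) : (forall l, u1 l = 0%N \/ u2 l = 0%N) ->
  (u1 <= m + u2)%MM = (u1 <= m)%MM.
Proof.
move=> dis; apply/mnm_lepP/mnm_lepP => h l; have := h l; rewrite ?mnmDE; last by lia.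
by case: (dis l) => ->; lia.
Qed.

Section ExactSequences.
Variables (C : numClosedFieldType) (n k : nat).
Local Notation P := {mpoly C[(n * k + k)%N]}.
Implicit Types (f g p q : P) (a b c e : 'I_n) (i j : 'I_k).

Definition zww (wz : 'I_n -> 'I_k -> nat) (ww : 'I_k -> nat) (l : 'I_(n * k + k)) : nat :=
  (\sum_a \sum_i (l == zidx a i) * wz a i + \sum_i (l == widx n i) * ww i)%N.

Lemma zww_z wz ww a i : zww wz ww (zidx a i) = wz a i.
Proof.
rewrite /zww [X in (_ + X)%N]big1 => [|j _]; last by rewrite zwidx_eq.
rewrite (bigD1 a) //= (bigD1 i) //= eqxx mul1n !big1 ?addn0 // => [b ba|j ji].
  by rewrite big1 // => j _; rewrite zidx_eq eq_sym (negbTE ba).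
by rewrite zidx_eq [i == j]eq_sym (negbTE ji) andbF.
Qed.
Lemma zww_w wz ww i : zww wz ww (widx n i) = ww i.
Proof.
rewrite /zww big1 ?add0n => [|a _]; last by rewrite big1 // => j _; rewrite wzidx_eq.
rewrite (bigD1 i) //= eqxx mul1n big1 ?addn0 // => j ji.
by rewrite widx_eq eq_sym (negbTE ji).
Qed.

(* z_aa has weight 2, every other variable weight 1. *)
Definition dwt := zww (fun a i => if val a == val i then 2 else 1)%N (fun=> 1%N).
Lemma dwt_z a i : wgt dwt U_(zidx a i)%MM = if val a == val i then 2%N else 1%N.
Proof. by rewrite wgtU /dwt zww_z. Qed.
Lemma dwt_w i : wgt dwt U_(widx n i)%MM = 1%N.
Proof. by rewrite wgtU /dwt zww_w. Qed.

Lemma zX_wX a i j : zX C a i * wX C n j = 'X_[U_(zidx a i) + U_(widx n j)].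
Proof. by rewrite mpolyXD. Qed.
Lemma zX_zX_wX a b i i' j : zX C a i * zX C b i' * wX C n j =
  'X_[U_(zidx a i) + U_(zidx b i') + U_(widx n j)].
Proof. by rewrite !mpolyXD. Qed.

(** The leading monomial z_aa w_a of q_a. The default is taken for a >= k, outside the index set
    [A0] of [q_exact]. *)
Definition qu a : 'X_{1..(n * k + k)} :=
  if insub (val a) is Some i then (U_(zidx a i) + U_(widx n i))%MM else 0%MM.
Lemma quE a i : val a = val i -> qu a = (U_(zidx a i) + U_(widx n i))%MM.
Proof.
move=> ai; rewrite /qu; case: insubP => [j _ ji|].
  by have -> : j = i by apply: val_inj; rewrite ji ai.
by rewrite -leqNgt ai leqNgt ltn_ord.
Qed.

(** In the weight [dwt] the monomial z_aa w_a has weight 3 and all other terms of the q_a have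
    weight 2. The leading monomials involve disjoint sets of variables, and there are min(n, k) of
    them. *)
Lemma q_exact l (eta : KF P n) : isdeg l eta -> (l < minn n k)%N -> extv (qrow C n k) eta = 0 ->
  exists2 theta, isdeg1 l theta & eta = extv (qrow C n k) theta.
Proof.
move=> deg lnk; pose A0 := [set a : 'I_n | (a < k)%N].
have A0P a : a \in A0 -> exists i : 'I_k, val a = val i.
  by rewrite inE => ak; exists (Ordinal ak).
have cA : #|A0| = minn n k.
  rewrite -sum1_card (eq_bigl (fun a : 'I_n => (a < k)%N)) => [|a]; last by rewrite inE.
  case: (leqP n k) => nk.
    rewrite (eq_bigl xpredT) ?sum1_card ?card_ord // => a.
    by rewrite (leq_trans (ltn_ord a) nk).
  by rewrite (big_ord_narrow (ltnW nk)) sum1_card card_ord.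
apply: (@koszul_exact C _ n (wgt dwt) qu A0 3) => //; last by rewrite cA.
- move=> a b m /A0P[i ai] /A0P[j bj] ab; rewrite (quE ai) (quE bj).
  apply: disjoint_lepm => l'; rewrite !mnmDE !mnm1E.
  have ij : i != j by apply: contra ab => /eqP ij; apply/eqP/val_inj; rewrite ai bj ij.
  case: (var_case l') => [[c [i' ->]]|[i' ->]]; rewrite ?zidx_eq ?wzidx_eq ?zwidx_eq ?widx_eq ?addn0 ?add0n.
    case: (eqVneq a c) => [<-|ac] /=; last by left.
    by right; rewrite eq_sym (negbTE ab).
  case: (eqVneq i i') => [<-|ii] /=; last by left.
  by right; rewrite eq_sym (negbTE ij).
- move=> a; rewrite mxE /qX; case: (boolP (a \in A0)) => [/A0P[i ai]|aA].
    rewrite mul1r (quE ai) (bigD1 i) //= zX_wX addrAC subrr add0r.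
    apply: mmeasure_sum_leW => j ji; rewrite zX_wX mmeasureX /= wgtD dwt_z dwt_w ai.
    by case: eqP => // /val_inj e; rewrite e eqxx in ji.
  rewrite mul0r subr0; apply: mmeasure_sum_leW => j _; rewrite zX_wX mmeasureX /= wgtD dwt_z dwt_w.
  by case: eqP => // e; move: aA; rewrite inE e ltn_ord.
by move=> a /A0P[i ai]; rewrite (quE ai) /= wgtD dwt_z dwt_w ai eqxx.
Qed.

Definition cX j : P := \sum_i (\sum_a zX C a i * zX C a j) * wX C n i.
Definition crow : 'rV[P]_k := \row_j cX j.

(** The leading monomial of c_j is z_jj^2 w_j, of weight 2 + 2 + 1 = 5. In any other term z_ai z_aj
    w_i at most one z is heavy, so its weight is at most 4. The row j of z exists because k <= n. *)
Lemma c_exact l (eta : KF P k) : (k <= n)%N -> isdeg l eta -> (l < k)%N -> extv crow eta = 0 ->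
  exists2 theta, isdeg1 l theta & eta = extv crow theta.
Proof.
move=> kn deg lk; pose d j := widen_ord kn j.
pose u j : 'X_{1..(n * k + k)} := (U_(zidx (d j) j) + U_(zidx (d j) j) + U_(widx n j))%MM.
have dI i j : (d i == d j) = (i == j) by [].
apply: (@koszul_exact C _ k (wgt dwt) u setT 5) => //; last by rewrite cardsT card_ord.
- move=> i j m _ _ ij; apply: disjoint_lepm => l'; rewrite !mnmDE !mnm1E.
  case: (var_case l') => [[c [i' ->]]|[i' ->]]; rewrite ?zidx_eq ?wzidx_eq ?zwidx_eq ?widx_eq ?addn0 ?add0n.
    case: (eqVneq i i') => [<-|ac] /=; last by rewrite !andbF; left.
    by right; rewrite [j == i]eq_sym (negbTE ij) !andbF.
  case: (eqVneq i i') => [<-|ii] /=; last by left.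
  by right; rewrite eq_sym (negbTE ij).
- move=> j; rewrite mxE /cX in_setT mul1r.
  have rest i a : (i != j) || (a != d j) -> 
      (mmeasure (wgt dwt) (zX C a i * zX C a j * wX C n i) <= 5)%N.
    move=> h; rewrite zX_zX_wX mmeasureX /= !wgtD !dwt_z dwt_w.
    have : (val a != val i) || (val a != val j).
      rewrite -negb_and; apply: contraL h => /andP[/eqP ai /eqP aj].
      by rewrite negb_or !negbK; apply/andP; split; apply/eqP/val_inj; rewrite /= -?ai -?aj.
    by case: (val a == val i); case: (val a == val j).
  rewrite (bigD1 j) //= mulr_suml (bigD1 (d j)) //= zX_zX_wX.
  have red (x y z : P) : x + y + z - x = y + z by ring.
  rewrite -/(u j) red; apply: mmeasureD_leW.
    by apply: mmeasure_sum_leW => a aj; apply: rest; rewrite aj orbT.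
  apply: mmeasure_sum_leW => i ij; rewrite mulr_suml; apply: mmeasure_sum_leW => a _.
  by apply: rest; rewrite ij.
by move=> j _; rewrite /u /= !wgtD !dwt_z dwt_w eqxx.
Qed.

Local Notation qrow := (qrow C n k).
Implicit Types (eta theta : KF P n).

Lemma mdegUU (l l' : 'I_(n * k + k)) : mdeg (U_(l) + U_(l'))%MM = 2%N.
Proof. by rewrite mdegD !mdeg1. Qed.

Lemma pihomog_q W a f : pihomog mdeg (W + 2) (qX C k a * f) = qX C k a * pihomog mdeg W f.
Proof.
rewrite /qX !mulr_suml raddf_sum; apply: eq_bigr => i _ /=.
by rewrite zX_wX -(mdegUU (zidx a i) (widx n i)) pihomog_mulX.
Qed.
Lemma pihomog_q0 W a f : (W < 2)%N -> pihomog mdeg W (qX C k a * f) = 0.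
Proof.
move=> W2; rewrite /qX !mulr_suml raddf_sum big1 // => i _ /=.
rewrite zX_wX; apply: pihomog_mulX0.
by apply: leq_trans W2 _; rewrite /= mdegUU.
Qed.
Lemma extv_cw x eta : extv x eta = \sum_a ext a (cw (mulby (x 0 a)) eta).
Proof.
by rewrite extvE; apply: eq_bigr => a _; rewrite -linearZ; congr (ext a _); apply/ffunP=> S; rewrite cwE ffunE.
Qed.
Lemma kpr_q W eta : kpr mdeg (W + 2) (extv qrow eta) = extv qrow (kpr mdeg W eta).
Proof.
rewrite !extv_cw raddf_sum; apply: eq_bigr => a _; rewrite /= kpr_ext; congr (ext a _).
by apply/ffunP=> S; rewrite kprE !cwE /mulby mxE pihomog_q.
Qed.
Lemma kpr_q0 W eta : (W < 2)%N -> kpr mdeg W (extv qrow eta) = 0.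
Proof.
move=> W2; rewrite extv_cw raddf_sum big1 // => a _; rewrite /= kpr_ext.
suff -> : kpr mdeg W (cw (mulby (qrow 0 a)) eta) = 0 by apply: raddf0.
by apply/ffunP=> S; rewrite kprE !cwE /mulby mxE pihomog_q0 // ffunE.
Qed.
Lemma mmeasure_deriv (l : 'I_(n * k + k)) W f :
  (mmeasure mdeg f <= W)%N -> (mmeasure mdeg (mderiv l f) <= W)%N.
Proof.
move=> /mmeasure_leP h; apply/mmeasure_leP => m Wm; rewrite mcoeff_deriv h ?mul0rn //.
apply: leq_trans Wm _.
exact: (leq_trans (leq_addr (mdeg U_(l)%MM) _) (eq_leq (esym (mdegD _ _)))).
Qed.

Lemma DL_split eta : dop (@DL C n k) eta = - extv qrow eta + \sum_a ext a (cw (@Lop C n k a) eta).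
Proof.
rewrite dopE extv_cw -sumrN -big_split; apply: eq_bigr => a _ /=.
rewrite -raddfN -raddfD; congr (ext a _); apply/ffunP=> S.
by rewrite !ffunE !cwE /= /DX /mulby mxE addrC.
Qed.
Lemma kle_L W eta : kle mdeg W eta -> kle mdeg W (\sum_a ext a (cw (@Lop C n k a) eta)).
Proof.
move=> h; apply: kle_sum => a _; apply: kle_ext => S; rewrite cwE /Lop.
by apply: mmeasure_sum_leW => j _; do 2!apply: mmeasure_deriv; apply: h.
Qed.
Lemma kle_q W eta : kle mdeg W.+1 eta -> kle mdeg (W + 2).+1 (extv qrow eta).
Proof.
move=> h; rewrite extv_cw; apply: kle_sum => a _; apply: kle_ext => S.
rewrite cwE /mulby (addnC W 2%N); apply: mmeasure_mul => //.
by rewrite mxE /qX; apply: mmeasure_sum_leW => i _; rewrite zX_wX mmeasureX /= mdegUU.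
Qed.
Lemma kle_d W eta : kle mdeg W.+1 eta -> kle mdeg (W + 2).+1 (dop (@DL C n k) eta).
Proof.
move=> h; rewrite DL_split; apply: kleD; last by apply: kle_le (kle_L h); lia.
by move=> S; rewrite ffunE mmeasureN; apply: kle_q.
Qed.
Lemma kpr_d W eta : kle mdeg W.+1 eta ->
  kpr mdeg (W + 2) (dop (@DL C n k) eta) = - extv qrow (kpr mdeg W eta).
Proof.
move=> h; rewrite DL_split raddfD /= raddfN /= kpr_q.
suff -> : kpr mdeg (W + 2) (\sum_a ext a (cw (@Lop C n k a) eta)) = 0 by rewrite addr0.
by apply: kpr0; apply: kle_le (kle_L h); lia.
Qed.

End ExactSequences.

(** The correction p is the orthogonal projection of theta on W. It depends on theta and W alone, so
    one p serves all elements of G. *)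
Lemma inv_lift (C : numClosedFieldType) v N (W : {ffun {set 'I_N} -> {mpoly C[v]}} -> Prop)
    (G : Type) (g : G -> {ffun {set 'I_N} -> {mpoly C[v]}} -> {ffun {set 'I_N} -> {mpoly C[v]}}) theta :
  subspace W -> (forall d w, W w -> W (kpr mdeg d w)) ->
  (forall x u w, kip (g x u) (g x w) = kip u w) ->
  (forall x u w, g x (u - w) = g x u - g x w) ->
  (forall x w, W w -> W (g x w)) ->
  (forall x w, W w -> exists2 w1, W w1 & w = g x w1) ->
  (forall x, W (g x theta - theta)) ->
  exists2 p, W p & forall x, g x (theta - p) = theta - p.
Proof.
move=> sW hW iso gB gW Wg gt; have [M eM] := kle_ex mdeg theta.
have [p pp _] := homog_proj sW hW eM.
exists p; first by case: pp.
move=> x; have e := (@proj_fixed C _ (@kip C v N) (@kipDZ C v N) (@kip_eq0 C v N) W theta p (g x) sW pp (iso x) (gB x) (gW x) (Wg x) (gt x)).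
exact: e.
Qed.

Lemma isdeg1B (A : comNzRingType) N l (eta theta : KF A N) :
  isdeg1 l eta -> isdeg1 l theta -> isdeg1 l (eta - theta).
Proof.
by move/isdeg1P=> h1 /isdeg1P h2; apply/isdeg1P=> S Sl; rewrite !ffunE h1 ?h2 ?subr0.
Qed.

Lemma isdeg1N (A : comNzRingType) N l (eta : KF A N) : isdeg1 l eta -> isdeg1 l (- eta).
Proof. by move=> h; rewrite -sub0r; apply: isdeg1B => //; apply: isdeg10. Qed.

Lemma isdeg1Z (A : comNzRingType) N l (p : A) (eta : KF A N) : isdeg1 l eta -> isdeg1 l (p *: eta).
Proof.
by move/isdeg1P=> h; apply/isdeg1P=> S /h hS; rewrite ffunE hS; apply: mulr0.
Qed.

(** * Invariant and det-semi-invariant forms, and their primitives *)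

Section Invariants.
Variables (C : numClosedFieldType) (n k : nat).
Local Notation P := {mpoly C[(n * k + k)%N]}.
Local Notation fa := (@fa C n k).
Local Notation act := (@act C n k).
Local Notation cM := (@cm C n k _ _).
Local Notation qrow := (qrow C n k).
Local Notation d := (dop (@DL C n k)).
Implicit Types (h : 'M[C]_n) (f g p q : P) (a b c e : 'I_n) (i j : 'I_k) (s : bool).
Implicit Types (eta theta : KF P n).

Lemma orth_detsq h : orth h -> \det h * \det h = 1.
Proof. by move=> oh; rewrite -{2}det_tr -det_mulmx oh det1. Qed.
Lemma det_real h : realmx h -> (\det h)^* = \det h.
Proof.
move=> rh; rewrite -det_map_mx; congr (\det _); apply/matrixP=> a b.
by rewrite mxE; apply: rh.
Qed.
Lemma orth_det h : orth h -> \det h = 1 \/ \det h = -1.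
Proof.
move=> /orth_detsq /eqP; rewrite -expr2 -subr_eq0 subr_sqr_1 mulf_eq0.
by rewrite subr_eq0 addr_eq0 => /orP [] /eqP ->; [left|right].
Qed.

Definition chi s h : C := (\det h) ^+ s.
Lemma chi_sq s h : orth h -> chi s h * chi s h = 1.
Proof. by move=> /orth_detsq oh; rewrite /chi -exprMn oh expr1n. Qed.
Lemma chi_real s h : realmx h -> (chi s h)^* = chi s h.
Proof. by move=> /det_real rh; rewrite /chi rmorphXn /= rh. Qed.
Lemma chi_tr s h : chi s h^T = chi s h.
Proof. by rewrite /chi det_tr. Qed.

(** For s = false these are the O(n)-invariant forms, for s = true the forms that transform by
    det. *)
Definition chinv s eta := forall h, orth h -> realmx h -> fa h eta = (chi s h)%:MP *: eta.
Definition pinv s f := forall h, orth h -> realmx h -> act h f = (chi s h)%:MP * f.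

Lemma scale_mpolyCA (x : C) (p : P) eta : p *: (x%:MP *: eta) = x%:MP *: (p *: eta).
Proof. by rewrite !scalerA mulrC. Qed.

Lemma chinv0 s : chinv s 0.
Proof. by move=> h _ _; rewrite raddf0 scaler0. Qed.
Lemma chinvB s eta theta : chinv s eta -> chinv s theta -> chinv s (eta - theta).
Proof.
move=> i1 i2 h oh rh; have -> : fa h (eta - theta) = fa h eta - fa h theta by apply: raddfB.
by rewrite i1 ?i2 // scalerBr.
Qed.
Lemma chinvD s eta theta : chinv s eta -> chinv s theta -> chinv s (eta + theta).
Proof.
move=> i1 i2 h oh rh; have -> : fa h (eta + theta) = fa h eta + fa h theta by apply: raddfD.
by rewrite i1 ?i2 // scalerDr.
Qed.
Lemma chinvN s eta : chinv s eta -> chinv s (- eta).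
Proof. by move=> i1; rewrite -sub0r; apply: chinvB => //; apply: chinv0. Qed.
Lemma chinvZ s f eta : pinv false f -> chinv s eta -> chinv s (f *: eta).
Proof.
move=> i1 i2 h oh rh; have e : act h f = f by rewrite i1 // /chi expr0 mpolyC1 mul1r.
by rewrite (faZ h f eta) e (i2 h oh rh); apply: scale_mpolyCA.
Qed.
Lemma chinvZC s x eta : chinv s eta -> chinv s (x%:MP *: eta).
Proof.
by move=> i1 h oh rh; rewrite (faZ h _ eta) actC (i1 h oh rh); apply: scale_mpolyCA.
Qed.
Lemma kprZC m x eta : kpr mdeg m (x%:MP *: eta) = x%:MP *: kpr mdeg m eta.
Proof.
by apply/ffunP=> S; rewrite ffunE !kprE ffunE /GRing.scale /= !mul_mpolyC linearZ.
Qed.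
Lemma chinv_kpr s m eta : chinv s eta -> chinv s (kpr mdeg m eta).
Proof. by move=> i1 h oh rh; rewrite -kpr_fa i1 // kprZC. Qed.
Lemma chinv_SO s eta : chinv s eta -> SOinv eta.
Proof. by move=> i1 h oh rh dh; rewrite i1 // /chi dh expr1n scale1r. Qed.

Lemma dopZC x eta : d (x%:MP *: eta) = x%:MP *: d eta.
Proof.
rewrite !dopE scaler_sumr; apply: eq_bigr => a _.
have <- : ext a (x%:MP *: cw (@DL C n k a) eta) = x%:MP *: ext a (cw (@DL C n k a) eta) by apply: linearZ.
congr (ext a _); apply/ffunP=> S; rewrite ffunE !cwE ffunE /GRing.scale /= !mul_mpolyC.
exact: linearZ.
Qed.
Lemma d_fa h eta : orth h -> d (fa h eta) = fa h (d eta).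
Proof. by move=> oh; apply: dop_fa => b f; apply: DL_act. Qed.
Lemma q_fa h eta : orth h -> extv qrow (fa h eta) = fa h (extv qrow eta).
Proof. by move=> oh; rewrite -!dop_q; apply: dop_fa => b f; apply: qL_act. Qed.
Lemma chinv_d s eta : chinv s eta -> chinv s (d eta).
Proof. by move=> i1 h oh rh; rewrite -d_fa // i1 // dopZC. Qed.
Lemma extvZC x eta : extv qrow (x%:MP *: eta) = x%:MP *: extv qrow eta.
Proof. exact: linearZ. Qed.

Lemma scaleCE (x : C) eta : x *: (eta : {ffun {set 'I_n} -> P}) = x%:MP *: eta.
Proof. by apply/ffunP=> S; rewrite !ffunE /GRing.scale /= mul_mpolyC. Qed.

(** W is the kernel of q /\ _ in degree l - 1, so the primitives of eta form a coset of W. Twisting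
    the action by the character turns semi-invariance into fixedness; the group preserves the coset,
    and theta minus its projection on W is fixed. *)
Lemma chinv_q_lift s l eta theta : chinv s eta -> isdeg1 l theta -> eta = extv qrow theta ->
  exists2 theta', chinv s theta' /\ isdeg1 l theta' & eta = extv qrow theta'.
Proof.
move=> inv deg et; pose W w := isdeg1 l w /\ extv qrow w = 0.
pose G := {h : 'M[C]_n | orth h /\ realmx h}.
pose g (x : G) w := (chi s (sval x))%:MP *: fa (sval x) w : KF P n.
have gg (x : G) w : g x (g (exist _ (sval x)^T (conj (orth_tr (proj1 (svalP x))) (realmx_tr (proj2 (svalP x))))) w) = w.
  case: x => h [oh rh]; rewrite /g /= faZ actC scalerA -rmorphM /= chi_tr chi_sq //.
  by rewrite scale1r fa_comp (mulmx1C oh) fa1.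
have gB (x : G) (u w : KF P n) : g x (u - w) = g x u - g x w.
  rewrite /g; have -> : fa (sval x) (u - w) = fa (sval x) u - fa (sval x) w by apply: raddfB.
  exact: scalerBr.
have gdeg x w : isdeg1 l w -> isdeg1 l (g x w).
  move=> dw; apply: isdeg1Z; case: l dw {W deg} => [|l]; last by rewrite !isdeg1S; apply: isdeg_fa.
  by move=> /isdeg1_0 ->; rewrite raddf0 isdeg10.
have gW x w : W w -> W (g x w).
  move=> [w1 w2]; split; first exact: gdeg.
  case: x => h [oh rh]; rewrite /g /= extvZC q_fa // w2.
  by rewrite raddf0 scaler0.
have [|||||||p [Wp1 Wp2] pp] := @inv_lift C _ n W G g theta.
- split; first by split; [exact: isdeg10 | exact: raddf0].
  have lin (c : C) (u w : KF P n) : W u -> W w -> W (c%:MP *: u + w).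
    move=> [u1 u2] [w1 w2]; split.
      exact: (isdeg1D (isdeg1Z _ u1) w1).
    have -> : extv qrow (c%:MP *: u + w) = extv qrow (c%:MP *: u) + extv qrow w by apply: raddfD.
    by rewrite extvZC u2 w2 scaler0 addr0.
  by move=> c u w Wu Ww; have := lin c u w Wu Ww; rewrite -scaleCE.
- move=> m w [w1 w2]; split; last by rewrite -kpr_q w2 raddf0.
  by apply/isdeg1P=> S Sl; rewrite kprE; move/isdeg1P: w1 => -> //; rewrite raddf0.
- move=> [h [oh rh]] u w; rewrite /g /= kip_cscale kip_cscaler kip_fa //.
  by rewrite mulrA chi_real // chi_sq // mul1r.
- exact: gB.
- exact: gW.
- by move=> x w Ww; exact: (ex_intro2 _ _ _ (gW _ _ Ww) (esym (gg x w))).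
- move=> x; split.
    have h1 : isdeg1 l (g x theta) by apply: gdeg.
    exact (isdeg1B h1 deg).
  have -> : extv qrow (g x theta - theta) = extv qrow (g x theta) - extv qrow theta by apply: raddfB.
  case: x => h [oh rh]; rewrite /g /= extvZC q_fa // -et inv // scalerA -rmorphM /= chi_sq //.
  by rewrite scale1r subrr.
exists (theta - p); last first.
  have -> : extv qrow (theta - p) = extv qrow theta - extv qrow p by apply: raddfB.
  by rewrite Wp2 subr0.
split.
  move=> h oh rh; have := pp (exist _ h (conj oh rh)); rewrite /g /= => e.
  by rewrite -{2}e scalerA -rmorphM /= chi_sq // scale1r.
exact (isdeg1B deg Wp1).
Qed.

Definition q_acyclic s l := forall eta, chinv s eta -> isdeg l eta -> extv qrow eta = 0 ->
  exists2 theta, chinv s theta /\ isdeg1 l theta & eta = extv qrow theta.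

Lemma q_acyclic_small s l : (l < minn n k)%N -> q_acyclic s l.
Proof.
move=> lnk eta inv deg z; have [theta d1 e] := q_exact deg lnk z.
exact: chinv_q_lift e.
Qed.

Lemma isdeg1_SO l eta : isdeg1 l eta -> SOinv eta -> d (d eta) = 0.
Proof.
case: l => [/isdeg1_0 -> _|l]; first by rewrite !raddf0.
by rewrite isdeg1S; apply: dop_DL_sq.
Qed.

Lemma isdeg1_kpr m l eta : isdeg1 l eta -> isdeg1 l (kpr mdeg m eta).
Proof. by move/isdeg1P=> h; apply/isdeg1P=> S /h hS; rewrite kprE hS raddf0. Qed.

Let d0 eta := - extv qrow eta.
Let d0_pr W eta : d0 (kpr mdeg W eta) = kpr mdeg (W + 2) (d0 eta).
Proof. by rewrite /d0 raddfN /= kpr_q. Qed.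
Let d0_pr0 W eta : (W < 2)%N -> kpr mdeg W (d0 eta) = 0.
Proof. by move=> W2; rewrite /d0 raddfN /= kpr_q0 // oppr0. Qed.

Lemma d_acyclic s l : q_acyclic s l -> forall eta, chinv s eta -> isdeg l eta -> d eta = 0 ->
  exists2 theta, chinv s theta /\ isdeg1 l theta & eta = d theta.
Proof.
move=> ac eta inv deg dz.
have [||||||||theta h1 h2] := @filt_exact _ (fun W => kpr mdeg W) (fun W => kle mdeg W) d d0 2
  (fun W u v => raddfB (kpr mdeg W) u v) (fun w1 w2 => raddfB d w1 w2)
  (@kle0 _ _ _ _) (@kle_ex _ _ _ _) (@kleS _ _ _ _) (@kle_kpr _ _ _ _) (@kprI _ _ _ _)
  (@kleB _ _ _ _) (@kle_d C n k) d0_pr (@kpr_d C n k) d0_pr0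
  (fun v => chinv s v /\ isdeg l v) (fun v => chinv s v /\ isdeg1 l v) _ _ _ _ _ _ _ _ eta (conj inv deg) dz.
- by move=> u v [u1 u2] [v1 v2]; split; [apply: chinvB | apply: isdegB].
- by move=> W v [v1 v2]; split; [apply: chinv_kpr | apply: isdeg_kpr].
- by move=> W v [v1 v2]; split; [apply: chinv_kpr | apply: isdeg1_kpr].
- by split; [apply: chinv0 | apply: isdeg10].
- by move=> u v [u1 u2] [v1 v2]; split; [apply: chinvD | apply: isdeg1D].
- by move=> v [v1 v2]; split; [apply: chinv_d | apply: isdeg1_dop].
- by move=> v [v1 v2]; apply: isdeg1_SO v2 (chinv_SO v1).
- move=> v [v1 v2] /eqP; rewrite /d0 oppr_eq0 => /eqP z.
  have [t [t1 t2] et] := ac v v1 v2 z; exists (- t); last by rewrite raddfN opprK.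
  split; first exact: chinvN.
  exact: isdeg1N.
- by exists theta.
Qed.

(** Primitives have degree l - 1, and lowering their weight requires exactness of q /\ _ in that
    degree. *)
Lemma d_lead s l : (forall l', l = l'.+1 -> q_acyclic s l') -> forall W eta theta,
  kle mdeg W.+1 eta -> chinv s theta -> isdeg1 l theta -> eta = d theta ->
  exists2 theta', chinv s theta' /\ isdeg1 l theta' & kpr mdeg W eta = extv qrow theta'.
Proof.
move=> ac W eta theta Fe inv deg ed.
(* The alternative w = 0 stands for the missing degree when l = 0. *)
have ex0 v : chinv s v /\ isdeg1 l v -> d0 v = 0 ->
    exists2 w, chinv s w /\ (exists2 l', l = l'.+1 & isdeg1 l' w) \/ w = 0 & v = d0 w.
  move=> [v1 v2] /eqP; rewrite /d0 oppr_eq0 => /eqP z.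
  case: l ac v2 {deg} => [|l'] ac v2.
    by exists 0; [right | rewrite (isdeg1_0 v2) raddf0 oppr0].
  have [t [t1 t2] et] := ac _ erefl v v1 v2 z; exists (- t); last by rewrite raddfN opprK.
  left; split; first exact: chinvN.
  by exists l'; [reflexivity | exact: (isdeg1N t2)].
have [|||||||w [w1 w2] ew] := @filt_lead _ (fun W => kpr mdeg W) (fun W => kle mdeg W) d d0 2
  (fun W u v => raddfB (kpr mdeg W) u v) (fun w1 w2 => raddfB d w1 w2) (etrans (congr1 -%R (raddf0 _)) (oppr0 _))
  (@kle0 _ _ _ _) (@kle_ex _ _ _ _) (@kleS _ _ _ _) (@kle_le _ _ _ _) (@kle_kpr _ _ _ _) (@kprI _ _ _ _) (@kpr0 _ _ _ _)
  (@kleB _ _ _ _) (@kle_d C n k) d0_pr (@kpr_d C n k) d0_pr0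
  (fun v => chinv s v /\ isdeg1 l v)
  (fun w => chinv s w /\ (exists2 l', l = l'.+1 & isdeg1 l' w) \/ w = 0)
  _ _ _ _ _ _ _ W eta theta Fe (conj inv deg) ed.
- by move=> u v [u1 u2] [v1 v2]; split; [apply: chinvB | apply: isdeg1B].
- by move=> W' v [v1 v2]; split; [apply: chinv_kpr | apply: isdeg1_kpr].
- move=> W' v [[v1 [l' el v2]]|->]; last by right; rewrite raddf0.
  by left; split; [apply: chinv_kpr | exists l'; [exact: el | apply: isdeg1_kpr]].
- move=> v [[v1 [l' el v2]]|->]; last by rewrite raddf0; split; [apply: chinv0 | apply: isdeg10].
  by split; [apply: chinv_d | rewrite el isdeg1S; apply: isdeg1_dop].
- move=> v [[v1 [l' el v2]]|->]; last by rewrite !raddf0.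
  exact: isdeg1_SO v2 (chinv_SO v1).
- exact: ex0.
- by split; [apply: chinv0 | apply: isdeg10].
exists (- w); last by rewrite ew raddfN.
split; first exact: chinvN.
exact: isdeg1N.
Qed.

End Invariants.

(** * Reflections at real points *)

Lemma rmorph_mpoly_ext (F : comNzRingType) v (B : comNzRingType)
    (f g : {rmorphism {mpoly F[v]} -> B}) :
  (forall c : F, f c%:MP = g c%:MP) -> (forall l, f 'X_l = g 'X_l) -> f =1 g.
Proof.
move=> hc hX; elim/mpoly_indX => [|c p q hp hq|l p hp]; first by rewrite !rmorph1.
  by rewrite -mul_mpolyC !rmorphD !rmorphM /= hc hp hq.
by rewrite !rmorphM /= hp hX.
Qed.

Section NaturalPoints.
Variables (C : numClosedFieldType) (v : nat).
Local Notation P := {mpoly C[v]}.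
Implicit Types (p : P) (y : 'I_v -> nat).

Lemma mpoly_natr_neq0 (t : nat) : t.+1%:R != 0 :> P.
Proof. by rewrite -(rmorph_nat (@mpolyC _ C)) mpolyC_eq0 pnatr_eq0. Qed.

Definition subst (t : 'I_v -> P) : P -> P := mmap (@mpolyC v C) t.
HB.instance Definition _ t := GRing.RMorphism.on (subst t).
Lemma substX t l : subst t 'X_l = t l.
Proof. by rewrite /subst mmapX mmap1U. Qed.
Lemma substC t c : subst t c%:MP = c%:MP.
Proof. by rewrite /subst mmapC. Qed.

(** With 'X_l replaced by a new indeterminate, p has all natural numbers as roots; evaluation of the
    indeterminate at 'X_l returns p. *)
Lemma subst_var_eq0 l p :
  (forall a : nat, subst (fun j => if j == l then a%:R else 'X_j) p = 0) -> p = 0.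
Proof.
move=> h; pose phi : {rmorphism P -> {poly P}} :=
  mmap (polyC \o @mpolyC v C) (fun j => if j == l then 'X else ('X_j)%:P).
have phiE (x : P) : (phi p).[x] = subst (fun j => if j == l then x else 'X_j) p.
  have := @rmorph_mpoly_ext C v P (horner_eval x \o phi)%FUN (subst (fun j => if j == l then x else 'X_j)).
  apply=> [c|j] /=; rewrite /horner_eval.
    by rewrite /phi /= mmapC /= hornerC substC.
  by rewrite /phi /= mmapX mmap1U substX; case: ifP => _; rewrite ?hornerX ?hornerC.
have phi0 : phi p = 0 by apply: poly_nat_eq0 => [t|a]; [exact: mpoly_natr_neq0 | rewrite phiE].
have := phiE 'X_l; rewrite phi0 horner0.
have -> // : subst (fun j => if j == l then 'X_l else 'X_j) p = p.
apply: (@rmorph_mpoly_ext C v P (subst (fun j => if j == l then 'X_l else 'X_j)) idfun) => [c|j] /=.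
  by rewrite substC.
by rewrite substX; case: eqP => [->|].
Qed.

Lemma mpoly_nat_eq0 p : (forall y, p.@[fun l => (y l)%:R] = 0) -> p = 0.
Proof.
move=> h; have key (r : seq 'I_v) q :
    (forall y, subst (fun j => if j \in r then (y j)%:R else 'X_j) q = 0) -> q = 0.
  elim: r q => [|l r IH] q hq.
    rewrite -(hq (fun=> 0%N)) /=.
    apply/esym/(@rmorph_mpoly_ext C v P (subst (fun j => 'X_j)) idfun) => [c|j] /=.
      by rewrite substC.
    by rewrite substX.
  apply: (@subst_var_eq0 l) => a; apply: IH => y.
  rewrite -[RHS](hq (fun j => if j == l then a else y j)).
  have := @rmorph_mpoly_ext C v P (subst (fun j => if j \in r then (y j)%:R else 'X_j) \o
    subst (fun j => if j == l then a%:R else 'X_j))%FUN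
    (subst (fun j => if j \in l :: r then (if j == l then a else y j)%:R else 'X_j)).
  apply=> [c|j] /=; first by rewrite !substC.
  rewrite !substX in_cons; case: (j == l); first by rewrite rmorph_nat.
  by rewrite substX.
apply: (key (enum 'I_v)) => y.
transitivity ((p.@[fun l => (y l)%:R])%:MP : P); last by rewrite h mpolyC0.
apply: (@rmorph_mpoly_ext C v P (subst (fun j => if j \in enum 'I_v then (y j)%:R else 'X_j))
   (@mpolyC v C \o meval (fun l => (y l)%:R))%FUN) => [c|j] /=.
  by rewrite substC mevalC.
by rewrite substX mevalXU mem_enum rmorph_nat.
Qed.

End NaturalPoints.

Section Reflections.
Variables (C : numClosedFieldType) (n k : nat).
Local Notation P := {mpoly C[(n * k + k)%N]}.
Local Notation fa := (@fa C n k).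
Local Notation act := (@act C n k).
Local Notation cM := (@cm C n k _ _).
Implicit Types (h : 'M[C]_n) (f g p q : P) (a b c e : 'I_n) (i j : 'I_k).
Implicit Types (eta theta : KF P n) (y : 'I_(n * k + k) -> C) (u : 'rV[C]_n).

(** All k vectors of the point y are orthogonal to u and therefore fixed by the reflection. *)
Lemma act_refl_eval y u s f : (forall i, \sum_a u 0 a * y (zidx a i) = 0) ->
  (act (refl s u) f).@[y] = f.@[y].
Proof.
move=> uy; have := @rmorph_mpoly_ext C _ C (meval y \o act (refl s u))%FUN (meval y).
apply=> [c|l] /=; first by rewrite actC.
case: (var_case l) => [[a [j ->]]|[j ->]]; last by rewrite -[mpolyX _ _]/(wX C n j) act_w.
rewrite -[mpolyX _ _]/(zX C a j) act_z rmorph_sum /=.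
transitivity (\sum_b ((a == b)%:R * y (zidx b j) - s * u 0 a * (u 0 b * y (zidx b j)))).
  apply: eq_bigr => b _; rewrite mevalM mevalC mevalXU /refl !mxE big_ord1 !mxE.
  ring.
rewrite sumrB -mulr_sumr uy mulr0 subr0 (bigD1 a) //= eqxx mul1r big1 ?addr0 ?mevalXU //.
by move=> b ba; rewrite eq_sym (negbTE ba) mul0r.
Qed.

Definition realrow u := forall a, (u 0 a)^* = u 0 a.

Lemma sqn_real_eq0 u : realrow u -> sqn u = 0 -> u = 0.
Proof.
move=> ru /eqP; rewrite psumr_eq0 => [/allP h|a _]; last first.
  by rewrite -{2}(ru a) mul_conjC_ge0.
apply/rowP=> a; rewrite mxE; apply/eqP.
by have := h a (mem_index_enum a); rewrite /= mulf_eq0 orbb.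
Qed.

Section RealReflection.
Variables (u : 'rV[C]_n) (ru : realrow u) (u0 : u != 0).
Let s := 2 / sqn u.
Let su : s * sqn u = 2.
Proof. by rewrite divfK //; apply: contraNneq u0 => /(sqn_real_eq0 ru) ->. Qed.
Lemma refl_real_orth : orth (refl s u).
Proof. exact: refl_orth. Qed.
Lemma refl_real_real : realmx (refl s u).
Proof.
apply: realmx_refl => //; rewrite fmorph_div /= conjC_nat; congr (_ / _).
by rewrite rmorph_sum; apply: eq_bigr => a _; rewrite rmorphM /= ru.
Qed.
Lemma refl_real_det : \det (refl s u) = -1.
Proof. exact: det_refl. Qed.
Lemma refl_real_s : s * sqn u = 2. Proof. exact: su. Qed.
End RealReflection.

(** The reflection in u fixes the point and has determinant -1, so the value is its own opposite. *)
Lemma pinv_eval0 f y u : pinv true f -> realrow u -> u != 0 ->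
  (forall i, \sum_a u 0 a * y (zidx a i) = 0) -> f.@[y] = 0.
Proof.
move=> inv ru u0 uy.
have := inv _ (refl_real_orth ru u0) (refl_real_real ru).
rewrite /chi (refl_real_det ru u0) expr1 => /(congr1 (meval y)).
rewrite /= act_refl_eval // mevalM mevalC mulN1r => /eqP.
by rewrite -addr_eq0 -mulr2n mulrn_eq0 /= => /eqP.
Qed.

(** Invariance under the reflection in u says that u /\ (u contracted with eta) vanishes at y. A
    further contraction with u leaves [sqn u] times the contraction, and [sqn u] is nonzero for a
    nonzero real u. *)
Lemma chinv_eval0 eta y u : chinv false eta -> realrow u ->
  (forall i, \sum_a u 0 a * y (zidx a i) = 0) -> intv u (mapf (meval y) eta) = 0.
Proof.
move=> inv ru uy; have [->|u0] := eqVneq u 0.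
  by rewrite intvE big1 // => a _; rewrite mxE scale0r.
have := inv _ (refl_real_orth ru u0) (refl_real_real ru).
rewrite /chi expr0 mpolyC1 scale1r faE => /(congr1 (fun z : KF P n => mapf (meval y) z)).
rewrite mapf_Theta.
have -> : map_mx (meval y) (cM (refl (2 / sqn u) u)) = refl (2 / sqn u) u.
  by apply/matrixP=> a b; rewrite !mxE mevalC.
have -> : mapf (meval y) (mapf (act (refl (2 / sqn u) u)) eta) = mapf (meval y) eta.
  by apply/ffunP=> S; rewrite !mapfE /= act_refl_eval.
rewrite Theta_refl ?refl_real_s //; move: (mapf _ eta) => w.
have s0 : 2 / sqn u != 0.
  by apply/eqP=> e; have /eqP := refl_real_s ru u0; rewrite e mul0r eq_sym pnatr_eq0.
move/eqP; rewrite -subr_eq0 addrC addKr oppr_eq0 => /eqP z.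
have {}z : extv u (intv u w) = 0.
  by rewrite -[LHS](scale1r) -(mulVf s0) -scalerA z scaler0.
have := intv_extv u u (intv u w); rewrite z intvv.
have -> : intv u (0 : KF C n) = 0 by apply: raddf0.
have -> : extv u (0 : KF C n) = 0 by apply: raddf0.
rewrite subr0 => e.
have sq0 : sqn u != 0 by apply/eqP=> e3; have /eqP := refl_real_s ru u0; rewrite e3 mulr0 eq_sym pnatr_eq0.
have e2 : sqn u *: intv u w = 0 by symmetry.
by rewrite -[LHS]scale1r -(mulVf sq0) -scalerA e2 scaler0.
Qed.

End Reflections.

(** * Covariants *)

Section RegularPair.
Variables (A : idomainType) (D0 D1 : A).
Hypothesis reg : forall f g, D0 * f = D1 * g -> exists h, f = D1 * h.
Hypothesis D1n0 : D1 != 0.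

Lemma regular_pow d e f g : D0 ^+ d * f = D1 ^+ e * g -> exists h, f = D1 ^+ e * h.
Proof.
have reg1 d' f' g' : D0 ^+ d' * f' = D1 * g' -> exists h, f' = D1 * h.
  elim: d' f' g' => [|d' IH] f' g'; first by rewrite expr0 mul1r => ->; exists g'.
  by rewrite exprS -mulrA => /reg [h]; apply: IH.
elim: e f g => [|e IH] f g; first by exists f; rewrite expr0 mul1r.
rewrite exprS -mulrA => e1; have [h eh] := reg1 _ _ _ e1.
move: e1; rewrite eh mulrCA => /(mulfI D1n0) /IH [h' eh'].
by exists h'; rewrite eh' mulrA.
Qed.

(** The quotients satisfy D0^d p1 = D1^d p0. Powers of a regular pair form a regular pair, so D1^d
    divides p1, and the cofactor is the quotient of b by M. *)
Lemma regular_dvd d M b p0 p1 : M != 0 ->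
  M * p0 = D0 ^+ d * b -> M * p1 = D1 ^+ d * b -> exists h, b = M * h.
Proof.
move=> M0 e0 e1; have e : D0 ^+ d * p1 = D1 ^+ d * p0.
  by apply: (mulfI M0); rewrite mulrCA e1 [RHS]mulrCA e0 mulrCA.
have [h eh] := regular_pow e; exists h.
apply: (mulfI (expf_neq0 d D1n0)); rewrite -e1 eh; ring.
Qed.
End RegularPair.

Section Windows.
Variables (C : numClosedFieldType) (n k m : nat) (mn : (m < n)%N) (mk : (m <= k)%N).
Local Notation P := {mpoly C[(n * k + k)%N]}.
Implicit Types (f g p q : P).

Lemma win_lt (c : 'I_2) (i : 'I_m) : (i + c < n)%N.
Proof. by have := ltn_ord c; have := ltn_ord i; move: mn; lia. Qed.
Definition wrow (c : 'I_2) (i : 'I_m) : 'I_n := Ordinal (win_lt c i).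
Definition wcol (i : 'I_m) : 'I_k := widen_ord mk i.
(* Rows 0, ..., m-1 (c = 0) or 1, ..., m (c = 1) of z. With weight 1 on z_ii and
   z_(i+1)i and 0 elsewhere, the two minors have coprime leading monomials. *)
Definition window (c : 'I_2) : 'M[P]_m := \matrix_(i, j) zX C (wrow c i) (wcol j).
Definition wdet c : P := \det (window c).

Let wb (a : 'I_n) (j : 'I_k) : bool := (a == j :> nat) || (a == j.+1 :> nat).
Let wz (a : 'I_n) (j : 'I_k) : nat := wb a j.
Let mf := wgt (zww wz (fun=> 0%N)).
Let u (c : 'I_2) : 'X_{1..(n * k + k)} := (\sum_(i < m) U_(zidx (wrow c i) (wcol i)))%MM.

Lemma prodX_sum (I : Type) (r : seq I) (F : I -> 'I_(n * k + k)) :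
  \prod_(i <- r) 'X_(F i) = 'X_[\sum_(i <- r) U_(F i)] :> P.
Proof.
by elim: r => [|x r IH]; rewrite ?big_nil ?mpolyX0 // !big_cons IH mpolyXD.
Qed.

Lemma wgt_sum v (w : 'I_v -> nat) (I : Type) (r : seq I) (F : I -> 'I_v) :
  wgt w (\sum_(i <- r) U_(F i))%MM = (\sum_(i <- r) w (F i))%N.
Proof.
elim: r => [|x r IH]; rewrite ?big_nil ?wgt0 // !big_cons wgtD IH.
by rewrite wgtU.
Qed.

(** The values of s have the same sum as the indices, so none of the inequalities can be strict. *)
Lemma perm_le_id (s : 'S_m) : (forall i : 'I_m, (s i <= i)%N) \/ (forall i : 'I_m, (i <= s i)%N) -> s = 1%g.
Proof.
move=> h; have e : (\sum_i (s i : nat) = \sum_(i < m) (i : nat))%N.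
  by rewrite [RHS](reindex_inj (@perm_inj _ s)).
apply/permP=> i; rewrite perm1; apply/val_inj/eqP.
move: e; rewrite (bigD1 i) //= [in RHS](bigD1 i) //=.
case: h => h.
  have : (\sum_(j | j != i) (s j : nat) <= \sum_(j < m | j != i) (j : nat))%N by apply: leq_sum.
  by move=> AB e; rewrite eqn_leq h /=; have := leq_add (leqnn (s i)) AB; rewrite e leq_add2r.
have : (\sum_(j < m | j != i) (j : nat) <= \sum_(j | j != i) (s j : nat))%N by apply: leq_sum.
by move=> BA e; rewrite eqn_leq h andbT; have := leq_add (leqnn (i : nat)) BA; rewrite -e leq_add2r.
Qed.

(** A product of m entries has full weight m only if every entry lies on one of the two weighted
    diagonals. For c = 0 this forces s i <= i, for c = 1 it forces i <= s i, and only the identity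
    remains. *)
Lemma wdet_lead c : (mmeasure mf (wdet c - 'X_[u c]) <= m)%N.
Proof.
rewrite /wdet /determinant (bigD1 1%g) //= odd_perm1 expr0 mul1r.
have -> : \prod_i window c i ((1%g : 'S_m) i) = 'X_[u c].
  by rewrite /u -prodX_sum; apply: eq_bigr => i _; rewrite mxE perm1.
have red (x y : P) : x + y - x = y by rewrite addrC addKr.
rewrite red; apply: mmeasure_sum_leW => s s1.
have -> : \prod_i window c i (s i) = 'X_[\sum_i U_(zidx (wrow c i) (wcol (s i)))].
  by rewrite -prodX_sum; apply: eq_bigr => i _; rewrite mxE.
rewrite -signr_odd; set X := 'X_[_].
suff h : (mmeasure mf X <= m)%N by case: odd; rewrite ?expr1 ?expr0 ?mulN1r ?mul1r ?mmeasureN.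
rewrite mmeasureX /mf /= wgt_sum.
under eq_bigr => i _ do rewrite zww_z.
have [i ni] : exists i, ~~ wb (wrow c i) (wcol (s i)).
  apply/existsP; rewrite -negb_forall; apply: contra s1 => /forallP h; apply/eqP/perm_le_id.
  have : (c = 1 :> nat) \/ (c = 0 :> nat) by have := ltn_ord c; case: (val c) => [|[|]] //; auto.
  by case=> c1; [right|left] => i; have := h i; rewrite /wb /= c1; lia.
rewrite (bigD1 i) //= {1}/wz (negbTE ni) add0n.
apply: (@leq_trans (\sum_(j < m | j != i) 1).+1).
  by rewrite ltnS; apply: leq_sum => j _; apply: leq_b1.
rewrite -[X in (_ <= X)%N](card_ord m) -sum1_card [X in (_ <= X)%N](bigD1 i) //=.
Qed.

Lemma wdet_neq0 c : wdet c != 0.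
Proof.
apply/eqP=> e; have := wdet_lead c; rewrite e sub0r mmeasureN mmeasureX /mf /= wgt_sum.
under eq_bigr => i _ do rewrite zww_z.
rewrite (eq_bigr (fun=> 1%N)) ?sum1_card ?card_ord ?ltnn // => i _.
by rewrite /wz /wb /=; have := ltn_ord c; case: (val c) => [|[|]] //= _; rewrite ?addn0 ?addn1 eqxx ?orbT.
Qed.

(** The relation makes (g, f), as a 1-form in two generators, closed in the Koszul complex of the
    two minors; [koszul_exact] applies in degree 1 < 2. *)
Lemma wdet_regular f g : wdet 0 * f = wdet 1 * g -> exists h, f = wdet 1 * h.
Proof.
move=> e; pose x : 'rV[P]_2 := \row_c wdet c; pose one := dlt P (set0 : {set 'I_2}).
pose eta : KF P 2 := g *: ext 0 one + f *: ext 1 one.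
have d0 c : isdeg 1 (ext c one).
  by apply: isdeg_ext; have := isdeg_dlt P (set0 : {set 'I_2}); rewrite cards0.
have deg : isdeg 1 eta by apply: isdegD; apply: isdegZ.
have xE (z : KF P 2) : extv x z = wdet 0 *: ext 0 z + wdet 1 *: ext 1 z.
  rewrite extvE big_ord_recl big_ord1 !mxE.
  by have -> : lift ord0 ord0 = 1 :> 'I_2 by apply: val_inj.
have extaa c (z : KF P 2) : ext c (ext c z) = 0 by rewrite -!extv_delta extvv.
have z0 : extv x eta = 0.
  rewrite xE /eta.
  have eD c (z1 z2 : KF P 2) p q : ext c (p *: z1 + q *: z2) = p *: ext c z1 + q *: ext c z2.
    have -> : ext c (p *: z1 + q *: z2) = ext c (p *: z1) + ext c (q *: z2) by apply: linearD.
    by congr (_ + _); apply: linearZ.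
  rewrite !eD !extaa !scaler0 add0r addr0 [ext 1 (ext 0 _)]extC scalerN scalerN !scalerA e.
  by rewrite subrr.
have [||||theta d1 et] := @koszul_exact C _ 2 mf u setT m _ x _ _ 1 eta deg _ z0.
- move=> a b mm _ _ ab; apply: disjoint_lepm => l; rewrite /u !mnm_sumE.
  have h (c : 'I_2) : (\sum_i U_(zidx (wrow c i) (wcol i))%MM l)%N != 0%N ->
      exists2 i, l = zidx (wrow c i) (wcol i) & True.
    move=> h; have /existsP[i hi] : [exists i, U_(zidx (wrow c i) (wcol i))%MM l != 0%N].
      rewrite -negb_forall; apply: contra h => /forallP h; rewrite big1 // => i _; exact/eqP.
    by exists i => //; move: hi; rewrite mnm1E; case: (zidx (wrow c i) (wcol i) =P l) => // <-.
  case: (eqVneq (\sum_i U_(zidx (wrow a i) (wcol i))%MM l)%N 0%N) => [->|/h [i -> _]]; first by left.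
  case: (eqVneq (\sum_i0 U_(zidx (wrow b i0) (wcol i0))%MM (zidx (wrow a i) (wcol i)))%N 0%N) => [->|]; first by right.
  rewrite sum_nat_eq0 negb_forall => /existsP[j]; rewrite /= mnm1E zidx_eq.
  rewrite eqb0 negbK => /andP[/eqP e1 /eqP e2]; move: ab.
  have ij : i = j by apply: val_inj; move/(congr1 val): e2.
  move/(congr1 val): e1; rewrite /= ij => /addnI /val_inj ->; by rewrite eqxx.
- by move=> a; rewrite mxE in_setT mul1r; apply: wdet_lead.
- move=> a _; rewrite /mf /= wgt_sum.
  under eq_bigr => i _ do rewrite zww_z.
  rewrite (eq_bigr (fun=> 1%N)) ?sum1_card ?card_ord // => i _.
  by rewrite /wz /wb /=; have := ltn_ord a; case: (val a) => [|[|]] //= _; rewrite ?addn0 ?addn1 eqxx ?orbT.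
- by rewrite cardsT card_ord.
move: d1; rewrite isdeg1S => /dlt0_isdeg; move: (theta set0) => t d1; exists t.
move: et; rewrite d1 => /(congr1 (fun z : KF P 2 => z [set 1])).
have -> : extv x (t *: one) = t *: (wdet 0 *: ext 0 one + wdet 1 *: ext 1 one).
  by rewrite -xE; apply: linearZ.
have sE p (z : KF P 2) : (p *: z) [set 1] = p * z [set 1] by rewrite ffunE.
have aE (z1 z2 : KF P 2) : (z1 + z2) [set 1] = z1 [set 1] + z2 [set 1] by rewrite ffunE.
have oE c : (ext c one) [set 1] = (c == 1)%:R.
  rewrite extE inE; case: eqP => // ->; rewrite ffunE setDv eqxx mulr1.
  rewrite /sg (_ : [set b in _ | _] = set0) ?cards0 //; apply/setP=> t0; rewrite !inE.
  by case: eqP => // ->.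
have cE p q : (p *: ext 0 one + q *: ext 1 one : KF P 2) [set 1] = q.
  apply: (etrans (aE _ _)); apply: (etrans (congr2 +%R (sE _ _) (sE _ _))).
  by rewrite (oE 0) (oE 1) mulr0 mulr1 add0r.
move=> e2; have e3 : (t *: (wdet 0 *: ext 0 one + wdet 1 *: ext 1 one)) [set 1] = wdet 1 * t.
  by apply: (etrans (sE _ _)); rewrite cE mulrC.
by rewrite -e3 -e2; apply/esym/cE.
Qed.

Lemma window_dvd d M b p0 p1 : M != 0 ->
  M * p0 = wdet 0 ^+ d * b -> M * p1 = wdet 1 ^+ d * b -> exists h, b = M * h.
Proof. by move=> M0; apply: regular_dvd => //; [exact: wdet_regular | exact: wdet_neq0]. Qed.

End Windows.

(* The Gram determinant times the component of e_b orthogonal to the rows of Z. *)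
HB.lock Definition normalv (A : comNzRingType) (k n : nat) (Z : 'M[A]_(k, n)) (b : 'I_n) : 'rV[A]_n :=
  \det (Z *m Z^T) *: delta_mx 0 b - row b (Z^T *m \adj (Z *m Z^T) *m Z).

Section Normal.
Variables (A B : comNzRingType) (k n : nat).
Implicit Types (Z : 'M[A]_(k, n)).

Lemma normalvE Z b : normalv Z b = \det (Z *m Z^T) *: delta_mx 0 b - row b (Z^T *m \adj (Z *m Z^T) *m Z).
Proof. by rewrite normalv.unlock. Qed.

Lemma map_normalv (f : {rmorphism A -> B}) Z b : map_mx f (normalv Z b) = normalv (map_mx f Z) b.
Proof.
by rewrite !normalv.unlock map_mxB map_mxZ map_delta_mx map_row !map_mxM map_mx_adj !map_mxM -det_map_mx !map_mxM -!map_trmx.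
Qed.

Lemma normalv_orth Z b : normalv Z b *m Z^T = 0.
Proof.
rewrite normalvE mulmxBl -scalemxAl -rowE -row_mul -!mulmxA mul_adj_mx mul_mx_scalar.
by rewrite linearZ subrr.
Qed.
End Normal.

Section Covariants.
Variables (C : numClosedFieldType) (n k : nat).
Local Notation P := {mpoly C[(n * k + k)%N]}.
Local Notation fa := (@fa C n k).
Local Notation act := (@act C n k).
Local Notation cM := (@cm C n k _ _).
Implicit Types (h : 'M[C]_n) (f g p q : P) (a c e : 'I_n) (i j : 'I_k).
Implicit Types (eta theta : KF P n) (b : KF P k).

Definition Zmx : 'M[P]_(k, n) := \matrix_(j, a) zX C a j.
Definition gramdet : P := \det (Zmx *m Zmx^T).

Lemma act_Z h : map_mx (act h) Zmx = Zmx *m (cM h)^T.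
Proof.
apply/matrixP=> j a; rewrite !mxE act_z; apply: eq_bigr => c _.
by rewrite !mxE mulrC.
Qed.

Lemma act_Z_orth h : orth h -> map_mx (act h) Zmx *m cM h = Zmx.
Proof.
move=> /orth_tr oh; rewrite act_Z -mulmxA.
have := cm_orth k oh; rewrite cm_tr trmxK => ->; exact: mulmx1.
Qed.

Lemma fa_ThetaZ h b : orth h -> fa h (Theta Zmx b) = Theta Zmx (mapf (act h) b).
Proof. by move=> oh; rewrite faE mapf_Theta Theta_comp act_Z_orth. Qed.

Lemma fa_intvZ h j eta : orth h -> fa h (intv (row j Zmx) eta) = intv (row j Zmx) (fa h eta).
Proof.
move=> oh; rewrite !faE mapf_intv Theta_intv; congr (Theta _ (intv _ _)).
by rewrite map_row act_Z row_mul.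
Qed.

Lemma chinv_intvZ s j eta : chinv s eta -> chinv s (intv (row j Zmx) eta).
Proof.
move=> inv h oh rh; rewrite fa_intvZ // inv //.
exact: linearZ.
Qed.

Lemma map_Z (y : 'I_(n * k + k) -> C) : map_mx (meval y) Zmx = \matrix_(j, a) y (zidx a j).
Proof. by apply/matrixP=> j a; rewrite !mxE mevalXU. Qed.

(** Evaluation at the first k unit vectors, whose Gram matrix is the identity. *)
Lemma gramdet_neq0 : (k <= n)%N -> gramdet != 0.
Proof.
move=> kn; apply/eqP=> /(congr1 (meval (fun l => (zww (fun a j => (a == j :> nat) : nat) (fun=> 0%N) l)%:R))).
rewrite /gramdet -det_map_mx map_mxM -map_trmx map_Z rmorph0.
set X := (X in \det X); suff -> : X = 1%:M by rewrite det1 => /eqP; rewrite oner_eq0.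
apply/matrixP=> i j; rewrite !mxE (bigD1 (widen_ord kn j)) //= big1 => [|a aj].
  by rewrite !mxE !zww_z /= eqxx mulr1 addr0 eq_sym.
rewrite !mxE !zww_z; case: (a =P j :> nat) => [e|_]; last by rewrite mulr0.
by case/eqP: aj; apply: val_inj.
Qed.

Lemma intv_normal e eta : chinv false eta -> intv (normalv Zmx e) eta = 0.
Proof.
move=> inv; apply/ffunP=> S; rewrite [RHS]ffunE; apply: mpoly_nat_eq0 => y.
pose yy l : C := (y l)%:R.
transitivity ((mapf (meval yy) (intv (normalv Zmx e) eta)) S); first by rewrite mapfE.
rewrite mapf_intv map_normalv map_Z (chinv_eval0 inv) ?ffunE // => [a|i].
  transitivity ((map_mx Num.conj (normalv (\matrix_(j, a) yy (zidx a j)) e)) 0 a).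
    by rewrite [RHS]mxE.
  rewrite map_normalv; congr (normalv _ _ _ _); apply/matrixP=> j c.
  by rewrite !mxE /= /yy conjC_nat.
transitivity ((normalv (\matrix_(j, a) yy (zidx a j)) e *m (\matrix_(j, a) yy (zidx a j))^T) 0 i).
  by rewrite mxE; apply: eq_bigr => a _; rewrite !mxE.
by rewrite normalv_orth mxE.
Qed.

(** [euler] multiplied by the Gram determinant. As contraction with [normalv] vanishes, contraction
    with the scaled unit vector equals contraction with its component in the span of the k vectors,
    a combination of contractions with rows of [Zmx]. *)
Lemma gram_euler m eta : chinv false eta -> isdeg m eta ->
  (m%:R * gramdet) *: eta =
  \sum_j extv (row j (\adj (Zmx *m Zmx^T))^T *m Zmx) (intv (row j Zmx) eta).
Proof.
move=> inv deg; pose X := Zmx^T *m \adj (Zmx *m Zmx^T).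
have XT j : row j (\adj (Zmx *m Zmx^T))^T *m Zmx = \row_c X c j.
  have XE : (\adj (Zmx *m Zmx^T))^T *m Zmx = X^T by rewrite /X trmx_mul trmxK.
  by rewrite -row_mul XE; apply/rowP=> c; rewrite mxE [RHS]mxE mxE.
transitivity (\sum_c ext c (\sum_j X c j *: intv (row j Zmx) eta)).
  rewrite mulrC -scalerA -(euler deg) scaler_sumr; apply: eq_bigr => c _.
  have <- : ext c (gramdet *: int c eta) = gramdet *: ext c (int c eta) by apply: linearZ.
  congr (ext c _).
  have := intv_normal c inv; rewrite normalvE intvBl intvZl intv_delta => /eqP.
  rewrite subr_eq0 => /eqP ->.
  have -> : row c (Zmx^T *m \adj (Zmx *m Zmx^T) *m Zmx) = \sum_j X c j *: row j Zmx.
    apply/rowP=> d; rewrite !mxE summxE; apply: eq_bigr => j _; by rewrite !mxE.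
  elim: (index_enum 'I_k) => [|j r IH]; first by rewrite !big_nil intvE big1 // => d _; rewrite mxE scale0r.
  by rewrite !big_cons intvDl IH intvZl.
under eq_bigr => c _ do rewrite raddf_sum.
rewrite exchange_big; apply: eq_bigr => j _; rewrite XT extvE; apply: eq_bigr => c _ /=.
by rewrite [in RHS]mxE; apply: linearZ.
Qed.

(** The contractions of eta with the rows of [Zmx] are again invariant and of smaller degree, and
    [gram_euler] reassembles eta from them. No invariance of b is claimed here; it follows later
    from injectivity. *)
Lemma cov_gram m eta : chinv false eta -> isdeg m eta ->
  exists2 b, isdeg m b & gramdet ^+ m *: eta = Theta Zmx b.
Proof.
elim: m eta => [|m IH] eta inv deg.
  exists (eta set0 *: dlt P (set0 : {set 'I_k})).
    by apply: isdegZ; have := isdeg_dlt P (set0 : {set 'I_k}); rewrite cards0.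
  rewrite expr0 scale1r {1}(dlt0_isdeg deg).
  have -> : Theta Zmx (eta set0 *: dlt P set0) = eta set0 *: Theta Zmx (dlt P set0) by apply: linearZ.
  by rewrite Theta0.
suff /boolp.choice [bb hb] : forall j, exists b, isdeg m b /\
    gramdet ^+ m *: intv (row j Zmx) eta = Theta Zmx b; last first.
  by move=> j; have [b b1 b2] := IH _ (chinv_intvZ j inv) (isdeg_intv _ deg); exists b.
pose b := \sum_j extv (row j (\adj (Zmx *m Zmx^T))^T) (bb j).
have db : isdeg m.+1 b by apply: isdeg_sum => j _; apply: isdeg_extv; case: (hb j).
have eb : Theta Zmx b = gramdet ^+ m *: ((m.+1%:R * gramdet) *: eta).
  rewrite (gram_euler inv deg) scaler_sumr /b raddf_sum; apply: eq_bigr => j _ /=.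
  rewrite Theta_extv -(proj2 (hb j)); apply: linearZ.
exists ((m.+1%:R^-1 : C)%:MP *: b); first exact: isdegZ.
have -> : Theta Zmx ((m.+1%:R^-1 : C)%:MP *: b) = (m.+1%:R^-1 : C)%:MP *: Theta Zmx b by apply: linearZ.
rewrite eb !scalerA; congr (_ *: _).
have mm : (m.+1%:R^-1 : C)%:MP * m.+1%:R = 1 :> P.
  by rewrite -(rmorph_nat (@mpolyC (n * k + k) C)) -rmorphM /= mulVf ?pnatr_eq0 // mpolyC1.
transitivity (((m.+1%:R^-1 : C)%:MP * m.+1%:R) * (gramdet ^+ m * gramdet)); last by ring.
by rewrite mm mul1r exprSr.
Qed.

Lemma Theta_scalar (A : comNzRingType) N (p : A) l (b : KF A N) : isdeg l b ->
  Theta (p%:M) b = p ^+ l *: b.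
Proof. by move=> db; rewrite -scalemx1 (Theta_scale _ _ db) Theta_id. Qed.

(** [Zmx] has the right inverse Z^T adj(Z Z^T) up to the factor [gramdet], which is nonzero for k <=
    n. *)
Lemma ThetaZ_inj l b : (k <= n)%N -> isdeg l b -> Theta Zmx b = 0 -> b = 0.
Proof.
move=> kn db e; have := Theta_comp Zmx (Zmx^T *m \adj (Zmx *m Zmx^T)) b.
rewrite e mulmxA mul_mx_adj (Theta_scalar _ db) => e2.
have {}e2 : gramdet ^+ l *: b = 0 by rewrite -[LHS]e2; apply: raddf0.
apply/ffunP=> S; have /ffunP/(_ S) := e2; rewrite !ffunE => /eqP.
by rewrite /GRing.scale /= mulf_eq0 expf_eq0 (negbTE (gramdet_neq0 kn)) andbF => /eqP.
Qed.

Lemma ThetaZ_inv l b : (k <= n)%N -> isdeg l b -> chinv false (Theta Zmx b) ->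
  forall S, pinv false (b S).
Proof.
move=> kn db inv S h oh rh; rewrite /chi expr0 mpolyC1 mul1r.
have := inv h oh rh; rewrite fa_ThetaZ // /chi expr0 mpolyC1 scale1r => e.
have : Theta Zmx (mapf (act h) b - b) = 0.
  have -> : Theta Zmx (mapf (act h) b - b) = Theta Zmx (mapf (act h) b) - Theta Zmx b by apply: raddfB.
  by rewrite e subrr.
move/(ThetaZ_inj kn (isdegB (isdeg_mapf _ db) db)) => /ffunP/(_ S).
by rewrite !ffunE mapfE => /eqP; rewrite subr_eq0 => /eqP.
Qed.

Lemma ThetaZ_chinv b : (forall S, pinv false (b S)) -> chinv false (Theta Zmx b).
Proof.
move=> ib h oh rh; rewrite fa_ThetaZ // /chi expr0 mpolyC1 scale1r; congr (Theta _ _).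
by apply/ffunP=> S; rewrite mapfE; apply: (etrans (ib S h oh rh)); rewrite /chi expr0 mpolyC1 mul1r.
Qed.

(** The matrix [E c] selects the rows of one window, so applying [Theta] of [E c] times an adjugate
    to Theta(b) gives the m-th power of that minor times b. Hence gramdet^m divides the products of
    b with the powers of both minors, and therefore b itself. Two windows of k rows require k <
    n. *)
Lemma covariants m eta : (k < n)%N -> chinv false eta -> isdeg m eta ->
  exists b, [/\ isdeg m b, forall S, pinv false (b S) & eta = Theta Zmx b].
Proof.
move=> kn inv deg; have [b db eb] := cov_gram inv deg.
have Mn0 : gramdet ^+ m != 0 by rewrite expf_neq0 // gramdet_neq0 // ltnW.
pose E (c : 'I_2) : 'M[P]_(n, k) := \matrix_(a, i) (a == wrow kn (leqnn k) c i)%:R.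
have ZE (c : 'I_2) : Zmx *m E c = (window C kn (leqnn k) c)^T.
  apply/matrixP=> j i; rewrite !mxE (bigD1 (wrow kn (leqnn k) c i)) //= big1 => [|a ai].
    by rewrite !mxE eqxx mulr1 addr0; congr zX; apply: val_inj.
  by rewrite !mxE (negbTE ai) mulr0.
have key (c : 'I_2) : wdet C kn (leqnn k) c ^+ m *: b =
    gramdet ^+ m *: Theta (E c *m \adj (Zmx *m E c)) eta.
  transitivity (Theta (E c *m \adj (Zmx *m E c)) (Theta Zmx b)).
    by rewrite Theta_comp mulmxA mul_mx_adj (Theta_scalar _ db) ZE det_tr.
  by rewrite -eb; apply: linearZ.
suff /boolp.choice [bb hb] : forall S : {set 'I_k}, exists p, b S = gramdet ^+ m * p; last first.
  move=> S.
  have keyS (c : 'I_2) : gramdet ^+ m * (Theta (E c *m \adj (Zmx *m E c)) eta) S =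
      wdet C kn (leqnn k) c ^+ m * b S.
    have /ffunP/(_ S) e := key c.
    exact (etrans (esym (scE _ _ S)) (etrans (esym e) (scE _ _ S))).
  exact: window_dvd Mn0 (keyS 0) (keyS 1).
pose b' : KF P k := [ffun S => bb S].
have bE : b = gramdet ^+ m *: b' by apply/ffunP=> S; rewrite !ffunE hb.
have db' : isdeg m b'.
  apply/isdegP=> S Sm; move/isdegP: db => /(_ S Sm) /eqP; rewrite hb mulf_eq0 (negbTE Mn0).
  by move/eqP; rewrite ffunE.
have eE : eta = Theta Zmx b'.
  have e2 : gramdet ^+ m *: eta = gramdet ^+ m *: Theta Zmx b'.
    by rewrite eb bE; apply: linearZ.
  apply/ffunP=> S; have /ffunP/(_ S) := e2; rewrite !ffunE; exact: (mulfI Mn0).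
exists b'; split=> //; apply: (ThetaZ_inv (ltnW kn) db'); by rewrite -eE.
Qed.

End Covariants.

Section SubstRules.
Variables (C : numClosedFieldType) (v : nat) (t : 'I_v -> {mpoly C[v]}).
Lemma subst_lin c p q : subst t (c *: p + q) = c%:MP * subst t p + subst t q.
Proof. by rewrite -mul_mpolyC rmorphD rmorphM /= substC. Qed.
Lemma subst_mulX l p : subst t ('X_l * p) = t l * subst t p.
Proof. by rewrite rmorphM /= substX. Qed.
End SubstRules.

Section VolumeForms.
Variables (C : numClosedFieldType) (n k : nat).
Local Notation P := {mpoly C[(n * k + k)%N]}.
Local Notation fa := (@fa C n k).
Local Notation act := (@act C n k).
Local Notation vol := (dlt P [set: 'I_n]).
Implicit Types (h : 'M[C]_n) (f g p q : P) (s : bool).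

Lemma fa_vol h f : fa h (f *: vol) = (act h f * (\det h)%:MP) *: vol.
Proof.
rewrite faZ -scalerA; congr (_ *: _); rewrite faE mapf_dlt Theta_det.
by rewrite /cm det_map_mx.
Qed.

Lemma volZ_inj f g : f *: vol = g *: vol -> f = g.
Proof. by move=> /ffunP /(_ setT); rewrite !ffunE eqxx /GRing.scale /= !mulr1. Qed.

Lemma chi_negb s h : orth h -> chi (~~ s) h = chi s h * \det h.
Proof. by move=> oh; rewrite /chi; case: s; rewrite ?expr1 ?expr0 ?mul1r ?orth_detsq. Qed.

(** vol itself transforms by det, so the two types are exchanged. *)
Lemma chinv_vol s f : chinv s (f *: vol) <-> pinv (~~ s) f.
Proof.
split=> inv h oh rh.
  have := inv h oh rh; rewrite fa_vol scalerA => /volZ_inj e.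
  rewrite chi_negb // rmorphM /= mulrAC -e -mulrA -rmorphM /= orth_detsq //.
  by rewrite mpolyC1 mulr1.
apply: (etrans (fa_vol h f)); rewrite (inv h oh rh); apply: etrans (esym (scalerA _ _ _)).
congr (_ *: _); rewrite chi_negb // rmorphM /=.
rewrite mulrAC -[_ * _ * (\det h)%:MP]mulrA -rmorphM /= orth_detsq //.
by rewrite mpolyC1 mulr1.
Qed.

Lemma isdeg_vol f : isdeg n (f *: vol).
Proof. by apply: isdegZ; have := isdeg_dlt P [set: 'I_n]; rewrite cardsT card_ord. Qed.

Lemma pinv_pihomog s d f : pinv s f -> pinv s (pihomog mdeg d f).
Proof.
move=> inv h oh rh; rewrite -pihomog_act inv // !mul_mpolyC.
exact: linearZ.
Qed.

End VolumeForms.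

(** * The case k = n: divisibility by the determinant *)

Section Determinant.
Variables (C : numClosedFieldType) (n' : nat).
Local Notation n := n'.+1.
Local Notation P := {mpoly C[(n * n + n)%N]}.
Local Notation act := (@act C n n).
Local Notation cM := (@cm C n n _ _).
Local Notation Zmx := (Zmx C n n).
Implicit Types (h : 'M[C]_n) (f g p q : P) (a c e : 'I_n) (i j : 'I_n).

Definition zdet : P := \det Zmx.
(** The cross product of the first n - 1 vectors, given by the cofactors of the last row of
    [Zmx]. *)
Definition zadj a : P := \adj Zmx a ord_max.

Lemma gramdet_zdet : gramdet C n n = zdet * zdet.
Proof. by rewrite /gramdet det_mulmx det_tr. Qed.
Lemma zdet_neq0 : zdet != 0.
Proof. by apply: contraNneq (gramdet_neq0 C (leqnn n)) => e; rewrite gramdet_zdet e mul0r. Qed.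

Lemma zadj_orth i : \sum_a zadj a * zX C a i = (i == ord_max)%:R * zdet.
Proof.
transitivity ((Zmx *m \adj Zmx) i ord_max).
  by rewrite mxE; apply: eq_bigr => a _; rewrite [Zmx _ _]mxE mulrC.
by rewrite mul_mx_adj mxE mulr_natl.
Qed.

(* A point with vanishing determinant, congruent to [zadj a] times the generic point
   modulo [zdet]; here [zadj] is orthogonal to all columns but the last. *)
Definition zsub a (l : 'I_(n * n + n)) : P := zadj a * 'X_l - (l == zidx a ord_max)%:R * zdet.

Lemma zsub_orth a i : \sum_c zadj c * zsub a (zidx c i) = 0.
Proof.
rewrite /zsub; under eq_bigr => c _ do rewrite mulrBr.
rewrite sumrB.
under eq_bigr => c _ do rewrite mulrCA -/(zX C c i).
rewrite -mulr_sumr zadj_orth (bigD1 a) //= big1 => [|c ca].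
  by rewrite addr0 zidx_eq eqxx /=; case: (i == ord_max); rewrite ?mul1r ?mul0r ?mulr0 subrr.
by rewrite zidx_eq (negbTE ca) mul0r mulr0.
Qed.

(** The n vectors of the point [zsub a] lie in the hyperplane normal to [zadj], so [pinv_eval0]
    applies wherever this normal is nonzero. The factor [zadj a] takes care of the points where it
    may vanish. *)
Lemma zsub_eq0 a f : pinv true f -> zadj a != 0 -> subst (zsub a) f = 0.
Proof.
move=> inv va0; apply: (mulfI va0); rewrite mulr0; apply: mpoly_nat_eq0 => y.
pose yy l : C := (y l)%:R; rewrite -/yy.
rewrite mevalM; have [->|ya] := eqVneq (zadj a).@[yy] 0; first by rewrite mul0r.
pose y' l : C := (zsub a l).@[yy].
have -> : (subst (zsub a) f).@[yy] = f.@[y'].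
  apply: (@rmorph_mpoly_ext C _ C (meval yy \o subst (zsub a))%FUN (meval y')) => [c|l] /=.
    by rewrite substC !mevalC.
  by rewrite substX mevalXU.
rewrite (@pinv_eval0 _ _ _ f y' (\row_c (zadj c).@[yy])) ?mulr0 //.
- move=> c; rewrite mxE.
  have e : map_mx (meval yy) (\adj Zmx) = \adj (\matrix_(j, a) yy (zidx a j)).
    by rewrite map_mx_adj map_Z.
  transitivity ((map_mx Num.conj (\adj (\matrix_(j, a) yy (zidx a j)))) c ord_max).
    by rewrite -e [RHS]mxE [in RHS]mxE.
  transitivity ((\adj (\matrix_(j, a) yy (zidx a j))) c ord_max); last by rewrite -e mxE.
  rewrite map_mx_adj; congr (\adj _ _ _); apply/matrixP=> j d.
  by rewrite !mxE /= /yy conjC_nat.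
- by apply: contraNneq ya => /rowP /(_ a); rewrite !mxE => ->.
move=> i; rewrite -[RHS](rmorph0 (meval yy)) -(zsub_orth a i) rmorph_sum.
by apply: eq_bigr => c _; rewrite mxE /= mevalM.
Qed.

Lemma zsub_mod a f : exists g, subst (zsub a) f = subst (fun l => zadj a * 'X_l) f + zdet * g.
Proof.
elim/mpoly_indX: f => [|c p q [g1 e1] [g2 e2]|l p [g e]].
- by exists 0; rewrite !rmorph1 mulr0 addr0.
- exists (c%:MP * g1 + g2); rewrite !subst_lin e1 e2.
  move: (subst _ p) (subst _ q) => x1 x2; ring.
exists (zadj a * 'X_l * g - (l == zidx a ord_max)%:R * (subst (fun l => zadj a * 'X_l) p + zdet * g)).
rewrite !subst_mulX e /zsub; move: (subst _ p) => x1; ring.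
Qed.

(** Modulo [zdet] the substitution [zsub a] scales every variable by [zadj a], so it multiplies a
    homogeneous f by a d-th power; its actual value is 0. *)
Lemma zadj_pow a d f : zadj a != 0 -> pinv true (pihomog mdeg d f) ->
  exists g, zadj a ^+ d * pihomog mdeg d f = zdet * g.
Proof.
move=> va0 inv; have [g e] := zsub_mod a (pihomog mdeg d f).
exists (- g); move: e; rewrite zsub_eq0 //.
rewrite (@pihomog_scale C n n (subst (fun l => zadj a * 'X_l)) 1%:M (zadj a)).
- by rewrite act1 => /esym /eqP; rewrite addr_eq0 => /eqP ->; rewrite mulrN.
- by move=> l; rewrite act1; exact: substX.
by move=> c; exact: substC.
Qed.

(** Deleting the last or the first coordinate of the first n - 1 vectors leaves the two windows of
    size n - 1, so two of the cofactors form a regular pair. *)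
Lemma zadj_wdet (c : 'I_2) : exists2 a, exists e : nat,
  zadj a = (-1) ^+ e * wdet C (ltnSn n') (leqnSn n') c & True.
Proof.
have lm (j : 'I_n') : lift ord_max j = wcol (leqnSn n') j.
  by apply: val_inj; rewrite /= /bump leqNgt ltn_ord.
pose a : 'I_n := if val c == 0%N then ord_max else ord0.
exists a => //; exists ((ord_max : 'I_n) + a)%N.
rewrite /zadj mxE /cofactor; congr (_ * _).
rewrite -det_tr /wdet; congr (\det _); apply/matrixP=> i j; rewrite !mxE lm; congr zX.
rewrite /a; clear a; apply: val_inj; case: c => [[|[|m]] hc] //=.
  by rewrite /bump leqNgt ltn_ord addn0.
by rewrite /bump leq0n addn1 add1n.
Qed.

Lemma zdet_dvd_homog d f : pinv true f -> exists g, pihomog mdeg d f = zdet * g.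
Proof.
move=> inv; have key (c : 'I_2) : exists p,
    zdet * p = wdet C (ltnSn n') (leqnSn n') c ^+ d * pihomog mdeg d f.
  have [a [e ea] _] := zadj_wdet c.
  have va0 : zadj a != 0 by rewrite ea mulf_neq0 ?signr_eq0 ?wdet_neq0.
  have [g eg] := zadj_pow va0 (pinv_pihomog d inv).
  exists ((-1) ^+ e ^+ d * g); rewrite mulrCA -eg ea exprMn.
  by rewrite !mulrA -exprMn -expr2 sqrr_sign expr1n mul1r.
have [p0 e0] := key 0; have [p1 e1] := key 1.
exact: window_dvd zdet_neq0 e0 e1.
Qed.

Lemma zdet_dvd f : pinv true f -> exists g, f = zdet * g.
Proof.
have [W] : exists W, (mmeasure mdeg f <= W)%N by eexists; exact: leqnn.
elim: W f => [|W IH] f.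
  by rewrite leqn0 mmeasure_poly_eq0 => /eqP -> _; exists 0; rewrite mulr0.
move=> hW inv; have [g1 e1] := zdet_dvd_homog W inv.
have inv' : pinv true (f - pihomog mdeg W f).
  move=> h oh rh; have -> : act h (f - pihomog mdeg W f) = act h f - act h (pihomog mdeg W f) by apply: raddfB.
  by rewrite inv // (pinv_pihomog W inv) // mulrBr.
have [|g2 e2] := IH _ _ inv'.
  apply: mmeasure_pihomog0; last by rewrite raddfB /= pihomog_idem subrr.
  apply: mmeasureD_leW => //; rewrite mmeasureN; exact: mmeasure_pihomog.
by exists (g1 + g2); rewrite mulrDr -e1 -e2 addrC subrK.
Qed.

Lemma act_zdet h : act h zdet = (\det h)%:MP * zdet.
Proof.
by rewrite /zdet -det_map_mx act_Z det_mulmx det_tr /cm det_map_mx mulrC.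
Qed.

Lemma pinv_div_zdet s f : pinv s (zdet * f) -> pinv (~~ s) f.
Proof.
move=> inv h oh rh; have := inv h oh rh; rewrite actM act_zdet => e.
have {}e : (\det h)%:MP * act h f = (chi s h)%:MP * f.
  by apply: (mulfI zdet_neq0); rewrite mulrCA mulrA e; ring.
rewrite chi_negb // rmorphM /= mulrAC -e mulrAC -rmorphM /= orth_detsq //.
by rewrite mpolyC1 mul1r.
Qed.

(** [Theta Zmx] sends the top form to zdet vol, so the claim is the divisibility of a
    det-semi-invariant polynomial by [zdet]. *)
Lemma covariants_det_top (eta : KF P n) : chinv false eta -> isdeg n eta ->
  exists b, [/\ isdeg n b, forall S, pinv false (b S) & eta = Theta Zmx b].
Proof.
move=> inv deg; have := inv; rewrite (isdegT deg); move: (eta setT) => f /chinv_vol /= inv2.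
have [g eg] := zdet_dvd inv2.
exists (g *: dlt P [set: 'I_n]); split; first exact: isdeg_vol.
  move=> S; rewrite ffunE /GRing.scale /= ffunE => h oh rh.
  rewrite actM rmorph_nat /chi expr0 mpolyC1 mul1r; congr (_ * _).
  have ig : pinv false g by apply: (@pinv_div_zdet true); rewrite -eg.
  by rewrite ig // /chi expr0 mpolyC1 mul1r.
have -> : Theta Zmx (g *: dlt P [set: 'I_n]) = g *: Theta Zmx (dlt P [set: 'I_n]) by apply: linearZ.
by rewrite Theta_det scalerA eg mulrC.
Qed.

(** Here gramdet eta = Theta(b), and [gramdet] is the square of [zdet]. The adjugate gives b = zdet
    Theta(adj) eta; as b is invariant, Theta(adj) eta is det-semi-invariant, hence divisible by
    [zdet] once more, which supplies the second factor. *)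
Lemma covariants_det1 (eta : KF P n) : chinv false eta -> isdeg 1 eta ->
  exists b, [/\ isdeg 1 b, forall S, pinv false (b S) & eta = Theta Zmx b].
Proof.
move=> inv deg; have [b db eb] := cov_gram inv deg.
have invM : pinv false (gramdet C n n).
  move=> h oh rh; rewrite gramdet_zdet actM act_zdet /chi expr0 mpolyC1 mul1r.
  rewrite mulrACA -rmorphM /= orth_detsq // mpolyC1 mul1r //.
rewrite expr1 in eb.
have ib : forall S, pinv false (b S).
  by apply: (ThetaZ_inv (leqnn n) db); rewrite -eb; apply: chinvZ.
have e1 : b = zdet *: Theta (\adj Zmx) eta.
  have : zdet *: b = zdet *: (zdet *: Theta (\adj Zmx) eta).
    rewrite scalerA -gramdet_zdet.
    transitivity (Theta (\adj Zmx) (Theta Zmx b)); last first.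
      by rewrite -eb; apply: linearZ.
    by rewrite Theta_comp mul_mx_adj (Theta_scalar _ db) expr1.
  move=> /ffunP e; apply/ffunP=> S; have := e S; rewrite !ffunE; exact: (mulfI zdet_neq0).
suff /boolp.choice [g hg] : forall S : {set 'I_n}, exists p, b S = gramdet C n n * p; last first.
  move=> S; have := ib S; rewrite {1}e1 ffunE => /pinv_div_zdet /zdet_dvd [g eg].
  by exists g; rewrite gramdet_zdet -mulrA -eg e1 ffunE.
pose b' : KF P n := [ffun S => g S].
have bE : b = gramdet C n n *: b' by apply/ffunP=> S; rewrite !ffunE hg.
have Mn0 := gramdet_neq0 C (leqnn n).
have db' : isdeg 1 b'.
  apply/isdegP=> S Sm; move/isdegP: db => /(_ S Sm) /eqP; rewrite hg mulf_eq0 (negbTE Mn0).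
  by move/eqP; rewrite ffunE.
have eE : eta = Theta Zmx b'.
  have e2 : gramdet C n n *: eta = gramdet C n n *: Theta Zmx b'.
    by rewrite eb bE; apply: linearZ.
  apply/ffunP=> S; have /ffunP/(_ S) := e2; rewrite !ffunE; exact: (mulfI Mn0).
exists b'; split=> //; apply: (ThetaZ_inv (leqnn n) db'); by rewrite -eE.
Qed.

End Determinant.

(** * Cohomology classes *)

(** The projector for the group of order 2 generated by one reflection; on SO(n)-invariant forms it
    projects on type [chi s] of O(n). *)
HB.lock Definition part (C : numClosedFieldType) (n k : nat) (a0 : 'I_n) (s : bool)
    (eta : KF {mpoly C[(n * k + k)%N]} n) : KF {mpoly C[(n * k + k)%N]} n :=
  (2^-1 : C)%:MP *: (eta + ((-1) ^+ s : C)%:MP *: fa (refl 2 (delta_mx 0 a0)) eta).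

Lemma isdeg1_intv (A : comNzRingType) N l x (eta : KF A N) : isdeg l eta -> isdeg1 l (intv x eta).
Proof.
case: l => [/dlt0_isdeg ->|l]; last by rewrite isdeg1S; apply: isdeg_intv.
by rewrite linearZ /= intv_dlt0 scaler0 isdeg10.
Qed.

Section Parts.
Variables (C : numClosedFieldType) (n k : nat) (a0 : 'I_n).
Local Notation P := {mpoly C[(n * k + k)%N]}.
Local Notation fa := (@fa C n k).
Local Notation qrow := (qrow C n k).
Local Notation d := (dop (@DL C n k)).
Implicit Types (h : 'M[C]_n) (f g : P) (s : bool) (eta theta : KF P n).

Definition flip : 'M[C]_n := refl 2 (delta_mx 0 a0).

Lemma flip_sqn : 2 * sqn (delta_mx 0 a0 : 'rV[C]_n) = 2.
Proof.
rewrite /sqn (bigD1 a0) //= mxE !eqxx big1 ?addr0 ?mulr1 // => c ca.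
by rewrite mxE (negbTE ca) andbF mulr0.
Qed.
Lemma flip_orth : orth flip. Proof. exact: refl_orth flip_sqn. Qed.
Lemma flip_real : realmx flip.
Proof. by apply: realmx_refl => [|c]; rewrite ?mxE conjC_nat. Qed.
Lemma flip_det : \det flip = -1. Proof. exact: det_refl flip_sqn. Qed.
Lemma chi_flip s : chi s flip = (-1) ^+ s. Proof. by rewrite /chi flip_det. Qed.

Local Notation part := (@part C n k a0).
Lemma partE s eta : part s eta = (2^-1 : C)%:MP *: (eta + ((-1) ^+ s : C)%:MP *: fa flip eta).
Proof. by rewrite part.unlock /flip. Qed.

Let faC h (x : C) eta : fa h (x%:MP *: eta) = x%:MP *: fa h eta.
Proof. by rewrite (faZ h _ eta) actC. Qed.
Let faB h eta theta : fa h (eta - theta) = fa h eta - fa h theta.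
Proof. exact: raddfB. Qed.
Let faD h eta theta : fa h (eta + theta) = fa h eta + fa h theta.
Proof. exact: raddfD. Qed.

Fact part_additive s : additive (part s).
Proof.
move=> u v; rewrite !partE faB -scalerBr; congr (_ *: _).
by rewrite scalerBr opprD addrACA.
Qed.
HB.instance Definition _ s := GRing.isAdditive.Build (KF P n) (KF P n) (part s) (part_additive s).

Lemma part_sum eta : part false eta + part true eta = eta.
Proof.
rewrite !partE -scalerDr expr0 expr1 mpolyC1 scale1r rmorphN /= mpolyC1 scaleN1r addrACA subrr addr0.
rewrite -mulr2n -scaler_nat scalerA -(rmorph_nat (@mpolyC _ C)) -rmorphM /= mulVf ?pnatr_eq0 //.
exact: scale1r.
Qed.

Lemma isdeg_part s l eta : isdeg l eta -> isdeg l (part s eta).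
Proof. by move=> deg; rewrite partE; exact: (isdegZ _ (isdegD deg (isdegZ _ (isdeg_fa _ deg)))). Qed.
Lemma isdeg1_part s l eta : isdeg1 l eta -> isdeg1 l (part s eta).
Proof.
case: l => [/isdeg1_0 ->|l]; first by rewrite raddf0 isdeg10.
by rewrite !isdeg1S; apply: isdeg_part.
Qed.

Lemma part_d s eta : part s (d eta) = d (part s eta).
Proof.
have dD u v : d (u + v) = d u + d v by apply: raddfD.
by rewrite !partE dopZC dD dopZC d_fa //; apply: flip_orth.
Qed.
Lemma part_q s eta : part s (extv qrow eta) = extv qrow (part s eta).
Proof.
have dD u v : extv qrow (u + v) = extv qrow u + extv qrow v by apply: raddfD.
by rewrite !partE extvZC dD extvZC q_fa //; apply: flip_orth.
Qed.
Lemma part_kpr s W eta : part s (kpr mdeg W eta) = kpr mdeg W (part s eta).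
Proof.
have dD u v : kpr mdeg W (u + v) = kpr mdeg W u + kpr mdeg W v by apply: raddfD.
by rewrite !partE kprZC dD kprZC kpr_fa.
Qed.

Lemma kle_scale W (x : C) eta : kle mdeg W eta -> kle mdeg W (x%:MP *: eta).
Proof.
move=> h S; rewrite scE mul_mpolyC; apply: leq_trans (h S); exact: mmeasureZ_le.
Qed.
Lemma kle_fa W h eta : kle mdeg W eta -> kle mdeg W (fa h eta).
Proof.
move=> hW; have [M] := kle_ex mdeg (fa h eta); elim: M => [|M IH] hM.
  by apply: kle_le hM.
have [MW|WM] := ltnP M W; first by apply: kle_le hM.
by apply/IH/kleS => //; rewrite kpr_fa (kpr0 (kle_le WM hW)) raddf0.
Qed.
Lemma kle_part s W eta : kle mdeg W eta -> kle mdeg W (part s eta).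
Proof.
by move=> hW; rewrite partE; apply: kle_scale; apply: kleD => //; apply: kle_scale; apply: kle_fa.
Qed.

Lemma part_id s eta : chinv s eta -> part s eta = eta.
Proof.
move=> inv; rewrite partE inv; [|exact: flip_orth|exact: flip_real].
rewrite chi_flip !scalerA -rmorphM /= -expr2 sqrr_sign mpolyC1 scale1r.
rewrite -mulr2n -scaler_nat scalerA -(rmorph_nat (@mpolyC _ C)) -rmorphM /= mulVf ?pnatr_eq0 //.
exact: scale1r.
Qed.
Lemma part_neg s eta : chinv (~~ s) eta -> part s eta = 0.
Proof.
move=> inv; rewrite partE inv; [|exact: flip_orth|exact: flip_real].
rewrite chi_flip !scalerA -rmorphM /= -signr_addb.
have -> : (s (+) ~~ s) = true by case: s {inv}.
by rewrite expr1 rmorphN /= mpolyC1 scaleN1r subrr scaler0.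
Qed.

(** On an SO(n)-invariant form all elements of determinant -1 act alike, namely as [flip]. *)
Lemma part_chinv s eta : SOinv eta -> chinv s (part s eta).
Proof.
move=> inv; have ss : flip *m flip = 1%:M by have := flip_orth; rewrite /orth refl_tr.
have of_ := flip_orth; have rf := flip_real.
have faN h : orth h -> realmx h -> \det h = -1 -> fa h eta = fa flip eta.
  move=> oh rh dh; have -> : h = (h *m flip) *m flip by rewrite -mulmxA ss mulmx1.
  rewrite -fa_comp (inv (h *m flip)) //; first exact: orth_mul.
    exact: realmx_mul.
  by rewrite det_mulmx dh flip_det mulrNN mulr1.
move=> h oh rh; rewrite partE faC faD faC fa_comp.
have oh2 := orth_mul of_ oh; have rh2 := realmx_mul rf rh.
rewrite scale_mpolyCA; congr (_ *: _); rewrite /chi.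
case: (orth_det oh) => dh; rewrite dh.
  rewrite (inv h) // (faN (flip *m h)) // ?det_mulmx ?dh ?flip_det ?mulr1 //.
  by rewrite expr1n mpolyC1 scale1r.
rewrite (faN h) // (inv (flip *m h)) // ?det_mulmx ?dh ?flip_det ?mulrNN ?mulr1 //.
by rewrite scalerDr scalerA -rmorphM /= -expr2 sqrr_sign mpolyC1 scale1r addrC.
Qed.

Lemma SOinvD eta theta : SOinv eta -> SOinv theta -> SOinv (eta + theta).
Proof. by move=> i1 i2 h oh rh dh; rewrite faD i1 ?i2. Qed.

Lemma SO_exact l eta : (forall s, q_acyclic C n k s l) -> SOinv eta -> isdeg l eta -> d eta = 0 ->
  exists2 theta, SOinv theta /\ isdeg1 l theta & eta = d theta.
Proof.
move=> ac inv deg z; have key s : exists2 theta, chinv s theta /\ isdeg1 l theta & part s eta = d theta.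
  apply: (d_acyclic (ac s)); [exact: part_chinv | exact: isdeg_part |].
  by rewrite -part_d z raddf0.
have [t0 [i0 d0] e0] := key false; have [t1 [i1 d1] e1] := key true.
exists (t0 + t1); last by rewrite raddfD /= -e0 -e1 part_sum.
by split; [apply: SOinvD; apply: chinv_SO; eassumption | exact: (isdeg1D d0 d1)].
Qed.

Lemma SO_lead l : (forall s l', l = l'.+1 -> q_acyclic C n k s l') -> forall W eta theta,
  kle mdeg W.+1 eta -> SOinv theta -> isdeg1 l theta -> eta = d theta ->
  exists2 theta', SOinv theta' /\ isdeg1 l theta' & kpr mdeg W eta = extv qrow theta'.
Proof.
move=> ac W eta theta hW inv deg e.
have key s : exists2 t, chinv s t /\ isdeg1 l t & part s (kpr mdeg W eta) = extv qrow t.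
  rewrite part_kpr; apply: (@d_lead C n k s l (ac s) W _ (part s theta)).
  - exact: kle_part.
  - exact: part_chinv.
  - exact: isdeg1_part.
  - by rewrite -part_d e.
have [t0 [i0 d0] e0] := key false; have [t1 [i1 d1] e1] := key true.
exists (t0 + t1); last by rewrite raddfD /= -e0 -e1 part_sum.
by split; [apply: SOinvD; apply: chinv_SO; eassumption | exact: (isdeg1D d0 d1)].
Qed.

Lemma SO_q_lift l eta theta : SOinv eta -> isdeg1 l theta -> eta = extv qrow theta ->
  exists2 theta', SOinv theta' /\ isdeg1 l theta' & eta = extv qrow theta'.
Proof.
move=> inv deg e.
have key s : exists2 t, chinv s t /\ isdeg1 l t & part s eta = extv qrow t.
  apply: (@chinv_q_lift C n k s l _ (part s theta)).
  - exact: part_chinv.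
  - exact: isdeg1_part.
  - by rewrite -part_q e.
have [t0 [i0 d0] e0] := key false; have [t1 [i1 d1] e1] := key true.
exists (t0 + t1); last by rewrite raddfD /= -e0 -e1 part_sum.
by split; [apply: SOinvD; apply: chinv_SO; eassumption | exact: (isdeg1D d0 d1)].
Qed.
End Parts.

Section Facts.
Variables (C : numClosedFieldType) (n k : nat).
Local Notation P := {mpoly C[(n * k + k)%N]}.
Local Notation fa := (@fa C n k).
Local Notation act := (@act C n k).
Local Notation qrow := (qrow C n k).
Local Notation crow := (crow C n k).
Local Notation Zmx := (Zmx C n k).
Local Notation vol := (dlt P [set: 'I_n]).
Local Notation d := (dop (@DL C n k)).
Implicit Types (h : 'M[C]_n) (f g : P) (s : bool) (eta theta : KF P n).

(** Kept as a hypothesis because k < n and k = n reach it by different routes, the latter for m = 1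
    and m = n. *)
Definition cov m := forall eta, chinv false eta -> isdeg m eta ->
  exists b : KF P k, [/\ isdeg m b, forall S, pinv false (b S) & eta = Theta Zmx b].

Lemma star_chinv s eta : chinv s eta -> chinv (~~ s) (star eta).
Proof.
move=> inv h oh rh.
have e : fa h (star eta) = (\det h)%:MP *: star (fa h eta).
  by rewrite star_fa // scalerA -rmorphM /= orth_detsq // mpolyC1 scale1r.
rewrite e (inv h oh rh).
have -> : star ((chi s h)%:MP *: eta) = (chi s h)%:MP *: star eta by apply: linearZ.
apply: (etrans (scalerA _ _ _)); congr (_ *: _).
by rewrite -rmorphM /= mulrC -chi_negb.
Qed.

(** The passage from q to c: with [Theta_intv], contraction of Theta(b) with q is Theta of the
    contraction of b with c. *)
Lemma qZ_crow : qrow *m Zmx^T = crow.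
Proof.
apply/rowP=> j; rewrite mxE [RHS]mxE /cX.
under eq_bigr => a _ do rewrite !mxE /qX mulr_suml.
rewrite exchange_big; apply: eq_bigr => i _; rewrite mulr_suml; apply: eq_bigr => a _.
ring.
Qed.

(** For l < k, which covers k = n, [q_exact] is enough. Otherwise [star eta] is O(n)-invariant,
    hence Theta(b), and q /\ eta = 0 says that the contraction of b with c vanishes. A second star,
    on the k generators, turns this into c /\ star b = 0, where [c_exact] applies. *)
Lemma acyclic_true l : (k <= n)%N -> (l < n)%N -> (k < n -> forall m, cov m)%N -> q_acyclic C n k true l.
Proof.
move=> kn ln hcov; case: (ltnP l k) => lk; first by apply: q_acyclic_small; rewrite (minn_idPr kn).
have {}hcov := hcov (leq_ltn_trans lk ln).
move=> eta inv deg z; suff [theta d1 e] : exists2 theta, isdeg1 l theta & eta = extv qrow theta.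
  exact: chinv_q_lift e.
have [b [db _ eb]] := hcov _ _ (star_chinv inv) (isdeg_star deg).
have zb : intv crow b = 0.
  have [m hm] : exists m, (n - l)%N = m.+1 by exists (n - l).-1; rewrite prednK // subn_gt0.
  apply: (ThetaZ_inj kn (isdeg_intv crow (_ : isdeg m.+1 b))); first by rewrite -hm.
  by rewrite -qZ_crow -Theta_intv -eb -star_extv z; apply: raddf0.
(* A form of degree n - l in fewer than n - l generators is zero. *)
have [lb|lb] := ltnP k (n - l).
  exists 0; first exact: isdeg10.
  have b0 : b = 0 := isdeg_gt lb db.
  have -> : extv qrow 0 = 0 :> KF P n by apply: raddf0.
  by apply: star_inj; rewrite eb b0; rewrite !raddf0.
(* The degree k - (n - l) of [star b] is below k because l < n; for l = n exactness fails and the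
   quotient by (c) appears. *)
have [||t dt et] := @c_exact C n k (k - (n - l))%N (star b) kn (isdeg_star db).
- have : (0 < n - l)%N by rewrite subn_gt0.
  by move: lb; lia.
- by rewrite -star_intv zb; apply: raddf0.
have bE : b = intv crow (vsgn P [set: 'I_k] *: star t).
  apply: star_inj; rewrite star_intv et; congr (extv crow _).
  by apply/esym/starKK.
exists (vsgn P [set: 'I_n] *: star (Theta Zmx (vsgn P [set: 'I_k] *: star t))).
  apply/isdeg1P=> S Sl; rewrite scE starE.
  suff -> : Theta Zmx (vsgn P [set: 'I_k] *: star t) (~: S) = 0 by rewrite !mulr0.
  have dst : isdeg (n - l).+1 (vsgn P [set: 'I_k] *: star t).
    apply/isdegP=> T hT; rewrite scE starE.
    move/isdeg1P: dt => -> ; first by rewrite !mulr0.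
    apply: contra hT => /eqP e; rewrite -(setCK T) cardsCs setCK card_ord.
    have := max_card (mem (~: T)); rewrite card_ord => h1.
    apply/eqP; move: e lb; set x := #|~: T|; lia.
  have := isdeg_Theta Zmx dst => /isdegP -> //.
  rewrite cardsCs setCK card_ord; apply: contra Sl => /eqP e; apply/eqP.
  by have := max_card (mem S); rewrite card_ord; move: e ln; lia.
apply: star_inj; rewrite star_extv.
have -> : star (vsgn P [set: 'I_n] *: star (Theta Zmx (vsgn P [set: 'I_k] *: star t))) = Theta Zmx (vsgn P [set: 'I_k] *: star t).
  exact: starKK.
by rewrite eb bE Theta_intv qZ_crow.
Qed.

(** Above degree k there are no covariants, since k generators have no nonzero product of more than
    k factors. Degree k carries the classes of [phi]. *)
Lemma acyclic_false l : (k < n)%N -> l != k -> (forall m, cov m) -> q_acyclic C n k false l.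
Proof.
move=> kn lk hcov; case: (ltngtP l k) lk => // lk _.
  by apply: q_acyclic_small; rewrite (minn_idPr (ltnW kn)).
move=> eta inv deg _; have [b [db _ ->]] := hcov _ _ inv deg.
have -> : b = 0 := isdeg_gt lk db.
exists 0; first by split; [exact: chinv0 | exact: isdeg10].
by rewrite !raddf0.
Qed.

Definition cid f := exists2 t : 'I_k -> P, forall j, pinv false (t j) & f = \sum_j cX C n j * t j.
Definition qid f := exists t : 'I_n -> P, f = \sum_a qX C k a * t a.

Lemma q_intv_vol (x : 'rV[P]_n) : extv qrow (intv x vol) = (\sum_a x 0 a * qrow 0 a) *: vol.
Proof.
have z : extv qrow vol = 0.
  apply: (@isdeg_gt P n n.+1); first exact: ltnSn.
  by apply: isdeg_extv; have := isdeg_dlt P [set: 'I_n]; rewrite cardsT card_ord.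
have := intv_extv x qrow vol; rewrite z.
have -> : intv x (0 : KF P n) = 0 by apply: raddf0.
by move/esym/eqP; rewrite subr_eq0 => /eqP.
Qed.

(** A combination of the q_a is the pairing of q with a vector x, and q /\ (x contracted with vol)
    is this pairing times vol. *)
Lemma qid_vol f : qid f <-> exists2 theta, isdeg1 n theta & f *: vol = extv qrow theta.
Proof.
split=> [[t ->]|[theta _]].
  exists (intv (\row_a t a) vol).
    by apply: isdeg1_intv; have := isdeg_dlt P [set: 'I_n]; rewrite cardsT card_ord.
  rewrite q_intv_vol; congr (_ *: _); apply: eq_bigr => a _; rewrite !mxE mulrC //.
move=> /ffunP /(_ setT); rewrite scE ffunE eqxx mulr1 extvE sum_ffunE => ->.
exists (fun a => ext a theta setT); apply: eq_bigr => a _; by rewrite scE mxE.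
Qed.
End Facts.

Section CIdeal.
Variables (C : numClosedFieldType) (n k : nat).
Local Notation P := {mpoly C[(n * k + k)%N]}.
Local Notation qrow := (qrow C n k).
Local Notation crow := (crow C n k).
Local Notation Zmx := (Zmx C n k).
Local Notation vol := (dlt P [set: 'I_n]).
Implicit Types (f g : P).

Lemma sg_set0 (A : comNzRingType) N (a : 'I_N) : sg A a set0 = 1.
Proof. by rewrite /sg (_ : [set b in _ | _] = set0) ?cards0 //; apply/setP=> t; rewrite !inE. Qed.

(** As c = q Z^T, an element of (c) is the pairing of q with a combination of the k vectors, and the
    resulting primitive can be made semi-invariant. Conversely [star theta] is an O(n)-invariant
    1-form Theta(b), and contracting b with c writes f in (c) with invariant coefficients. *)
Lemma cid_vol f : (0 < n)%N -> cov C n k 1 -> pinv false f ->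
  cid f <-> exists2 theta, chinv true theta /\ isdeg1 n theta & f *: vol = extv qrow theta.
Proof.
move=> n0 hcov inv; split=> [[t _ ef]|[theta [i1 d1] e]].
  pose x := (\row_j t j) *m Zmx.
  apply: (@chinv_q_lift C n k true n (f *: vol) (intv x vol)).
  - by apply/chinv_vol.
  - by apply: isdeg1_intv; have := isdeg_dlt P [set: 'I_n]; rewrite cardsT card_ord.
  rewrite q_intv_vol; congr (_ *: _).
  transitivity ((x *m qrow^T) 0 0); last by rewrite mxE; apply: eq_bigr => a _; rewrite [qrow^T _ _]mxE.
  have -> : x *m qrow^T = (\row_j t j) *m crow^T.
    by rewrite /x -mulmxA -qZ_crow trmx_mul trmxK.
  by rewrite mxE ef; apply: eq_bigr => j _; rewrite !mxE mulrC.
have dst : isdeg 1 (star theta).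
  have d2 : isdeg n.-1 theta.
    apply/isdegP=> S Sn; move/isdeg1P: d1 => -> //; apply: contra Sn => /eqP e1.
    by rewrite -[in X in _ == X]e1.
  have := isdeg_star d2; have -> : (n - n.-1)%N = 1%N by lia.
  by [].
have [b [db ib eb]] := hcov _ (star_chinv i1) dst.
have : star (f *: vol) = Theta Zmx (intv crow b).
  by rewrite e star_extv eb Theta_intv qZ_crow.
have -> : star (f *: vol) = f *: star vol by apply: linearZ.
have d0 := dlt0_isdeg (isdeg_intv crow db); rewrite d0.
have -> : Theta Zmx (intv crow b set0 *: dlt P set0) = intv crow b set0 *: Theta Zmx (dlt P set0) by apply: linearZ.
rewrite Theta0 => /ffunP /(_ set0); rewrite !scE starE !ffunE setC0 !eqxx !mulr1.
have -> : vsgn P (set0 : {set 'I_n}) = 1 by rewrite /vsgn big_set0.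
rewrite mulr1 intvE sum_ffunE => ->.
exists (fun j => b [set j]) => [j|]; first exact: ib.
apply: eq_bigr => j _; rewrite scE intE inE sg_set0 mul1r setU0 mxE.
by [].
Qed.

Lemma phi_top b : isdeg k b -> Theta Zmx b = b setT *: Theta Zmx (dlt P [set: 'I_k]).
Proof. by move=> db; rewrite {1}(isdegT db); apply: linearZ. Qed.
End CIdeal.

(** * Representatives orthogonal to an ideal *)

Section FischerProjection.
Variables (C : numClosedFieldType) (v : nat).
Local Notation P := {mpoly C[v]}.
Implicit Types (f g p w : P) (W : P -> Prop).

Lemma fis_proj W f : subspace W -> (forall m w, W w -> W (pihomog mdeg m w)) ->
  exists p, is_proj (@fis C v) W f p /\ (msize p <= msize f)%N.
Proof.
(* A polynomial is a form over an empty index set, so that [homog_proj] applies. *)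
move=> sW hW; pose emb (f : P) : {ffun {set 'I_0} -> P} := [ffun=> f].
have kE (u w : {ffun {set 'I_0} -> P}) : kip u w = fis (u set0) (w set0).
  rewrite /kip (bigD1 set0) //= big1 ?addr0 // => S; case/negP; apply/eqP/setP=> -[] //.
have sW' : subspace (fun u : {ffun {set 'I_0} -> P} => W (u set0)).
  by split=> [|c u w Wu Ww]; rewrite !ffunE; [case: sW | case: sW => _; apply].
have [||p [Wp hp] Mp] := @homog_proj C v 0 _ sW' _ (msize f) (emb f).
- by move=> m w Ww; rewrite kprE; apply: hW.
- by move=> S; rewrite ffunE.
exists (p set0); split; last exact: Mp.
split=> // w Ww; have := hp (emb w); rewrite kE !ffunE; exact.
Qed.
End FischerProjection.

Section TopDegree.
Variables (C : numClosedFieldType) (v n : nat).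
Local Notation P := {mpoly C[v]}.
Local Notation vol := (dlt P [set: 'I_n]).
Variables (A W num : P -> Prop) (cob : KF P n -> Prop).
Implicit Types (f g p w : P).
Hypothesis sW : subspace W.
Hypothesis hW : forall m w, W w -> W (pihomog mdeg m w).
Hypothesis sA : subspace A.
Hypothesis num_A : forall f p, num f -> is_proj (@fis C v) W f p -> A (f - p).
Hypothesis A_num : forall f, A f -> num f.
Hypothesis cob0 : cob 0.
Hypothesis cobB : forall x y, cob x -> cob y -> cob (x - y).
Hypothesis lead : forall m f, A f -> (msize f <= m.+1)%N -> cob (f *: vol) -> W (pihomog mdeg m f).
Hypothesis reduce : forall m w, A w -> W w -> (msize w <= m.+1)%N ->
  exists g, [/\ A g, (msize g <= m)%N & cob ((w - g) *: vol)].

(** Take psi f = f - p with p the projection of f on W. If psi f is a coboundary, its top component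
    lies in W by [lead]; being orthogonal to psi f, it is orthogonal to itself, so psi f = 0. For
    surjectivity, [reduce] replaces p by a cohomologous polynomial of smaller degree, which is
    treated by induction. *)
Lemma top_degree : exists psi : P -> P,
  [/\ linear psi, forall f, num f -> A (psi f),
      forall f, num f -> (cob (psi f *: vol) <-> W f),
      forall g, A g -> exists2 f, num f & cob ((g - psi f) *: vol) &
      forall f, A f -> exists h, [/\ A h, (msize h <= (msize f).-1)%N & cob ((psi f - (f + h)) *: vol)]].
Proof.
have /boolp.choice [q hq] := fun f => fis_proj f sW hW.
have qp f : is_proj (@fis C v) W f (q f) by case: (hq f).
have qs f : (msize (q f) <= msize f)%N by case: (hq f).
have uniq f p : is_proj (@fis C v) W f p -> q f = p.
  by move=> pp; apply: (is_proj_uniq (@fisDZ C v) (@fis_eq0 C v) sW (qp f) pp).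
have cobN x : cob x -> cob (- x) by rewrite -sub0r; apply: cobB.
have cobD x y : cob x -> cob y -> cob (x + y) by move=> cx /cobN cy; rewrite -[y]opprK; apply: cobB.
pose psi f := f - q f.
have lin : linear psi.
  move=> c f g; rewrite /psi (uniq (c *: f + g) (c *: q f + q g)).
    by rewrite scalerBr opprD addrACA.
  exact: (is_proj_linear (@fisDZ C v) c sW (qp f) (qp g)).
have Aq f : A f -> A (q f).
  move=> Af; have -> : q f = f - (f - q f) by rewrite opprB addrC subrK.
  by apply: (subspaceB sA) => //; apply: num_A => //; apply: A_num.
exists psi; split=> //.
- by move=> f nf; apply: num_A.
- move=> f nf; split=> [cf|Wf]; last first.
    rewrite /psi (uniq f f) ?subrr ?scale0r //; split=> // w _.
    rewrite subrr; exact: fis0l.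
  suff z : psi f = 0.
    by move/eqP: z; rewrite subr_eq0 => /eqP ->; case: (qp f).
  apply/eqP/negP=> /negP nz; have [m sm] : exists m, msize (psi f) = m.+1.
    by exists (msize (psi f)).-1; rewrite prednK // lt0n mmeasure_poly_eq0.
  have Wm : W (pihomog mdeg m (psi f)).
    by apply: lead; rewrite ?sm //; apply: num_A.
  have pm0 : pihomog mdeg m (psi f) = 0.
    apply: fis_eq0; have := (proj2 (qp f)) _ Wm; rewrite -/(psi f) => e.
    have e2 : psi f = pihomog mdeg m (psi f) + (psi f - pihomog mdeg m (psi f)) by rewrite addrC subrK.
    move: e; rewrite {1}e2 fisDl [X in _ + X]fis_disj ?addr0 // => mm.
    by rewrite mcoeffB !mcoeff_pihomog; case: ifP => // _; rewrite subrr eqxx.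
  by have := mmeasure_pihomog0 (eq_leq sm) pm0; rewrite sm ltnn.
- suff key M g : (msize g <= M)%N -> A g -> exists2 f, A f & cob ((g - psi f) *: vol).
    by move=> g /(key _ g (leqnn _)) [f /A_num nf cf]; exists f.
  elim: M g => [|M IH] g.
    rewrite leqn0 mmeasure_poly_eq0 => /eqP -> A0; exists 0 => //.
    have -> : psi 0 = 0 by have := lin (-1) 0 0; rewrite scaler0 addr0 scaleN1r addNr.
    by rewrite subrr scale0r.
  move=> gM Ag; have [g2 [Ag2 sg2 c2]] := reduce (Aq g Ag) (proj1 (qp g)) (leq_trans (qs g) gM).
  have [f2 Af2 cf2] := IH g2 sg2 Ag2.
  (* psi g differs from g by the projection of g, which is cohomologous to g2, and g2 is reached by
     psi f2. *)
  exists (g + f2); first exact: subspaceD.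
  have -> : psi (g + f2) = psi g + psi f2 by have := lin 1 g f2; rewrite !scale1r.
  have -> : g - (psi g + psi f2) = (q g - g2) + (g2 - psi f2).
    rewrite /psi; ring.
  by rewrite scalerDl; apply: cobD.
move=> f Af; have [f0|f0] := eqVneq f 0.
  exists 0; split; [by case: sA | by rewrite mmeasure0 |].
  rewrite f0 addr0 subr0; have -> : psi 0 = 0 by have := lin (-1) 0 0; rewrite scaler0 addr0 scaleN1r addNr.
  by rewrite scale0r.
have [m sm] : exists m, msize f = m.+1.
  by exists (msize f).-1; rewrite prednK // lt0n mmeasure_poly_eq0.
have [|g [Ag sg cg]] := @reduce m _ (Aq f Af) (proj1 (qp f)); first by rewrite -sm.
exists (- g); split; [by rewrite -scaleN1r; apply: subspaceZ | by rewrite mmeasureN sm |].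
have -> : psi f - (f - g) = - (q f - g) by rewrite /psi; ring.
by rewrite scaleNr; apply: cobN.
Qed.
End TopDegree.

Section Cohomology.
Variables (C : numClosedFieldType) (n k : nat).
Local Notation P := {mpoly C[(n * k + k)%N]}.
Local Notation fa := (@fa C n k).
Local Notation act := (@act C n k).
Local Notation qrow := (qrow C n k).
Local Notation Zmx := (Zmx C n k).
Local Notation vol := (dlt P [set: 'I_n]).
Local Notation d := (dop (@DL C n k)).
Implicit Types (h : 'M[C]_n) (f g r w : P) (s : bool) (eta theta : KF P n).

Definition cob l eta := exists2 theta, SOinv theta /\ isdeg1 l theta & eta = d theta.

Lemma cob0 l : cob l 0.
Proof. by exists 0; [split; [exact: (chinv_SO (@chinv0 C n k false)) | exact: isdeg10] | rewrite raddf0]. Qed.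
Lemma cobB l x y : cob l x -> cob l y -> cob l (x - y).
Proof.
move=> [t [i1 d1] ->] [u [i2 d2] ->]; exists (t - u); last by rewrite raddfB.
by split; [exact: SOinvB | exact: (isdeg1B d1 d2)].
Qed.
Lemma cobN l x : cob l x -> cob l (- x).
Proof. by move=> cx; rewrite -sub0r; apply: cobB => //; apply: cob0. Qed.
Lemma cobD l x y : cob l x -> cob l y -> cob l (x + y).
Proof. by move=> cx /cobN cy; rewrite -[y]opprK; apply: cobB. Qed.
Lemma cob_chinv s l theta : chinv s theta -> isdeg1 l theta -> cob l (d theta).
Proof. by move=> i1 d1; exists theta => //; split=> //; apply: chinv_SO i1. Qed.

(** Since d has leading part - q /\ _, adding d of the component of theta of degree W - 2 cancels
    the top component of eta. *)
Lemma lower W eta theta : kle mdeg W.+1 eta -> kpr mdeg W eta = kpr mdeg W (extv qrow theta) ->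
  exists2 theta', theta' = 0 \/ (exists W', theta' = kpr mdeg W' theta) & kle mdeg W (eta + d theta').
Proof.
move=> hW e2.
(* A multiple of q has no component of degree below 2, so nothing is to be cancelled. *)
have [W2|W2] := ltnP W 2.
  exists 0; first by left.
  have -> : eta + d 0 = eta by rewrite raddf0 addr0.
  by apply: kleS => //; rewrite e2 kpr_q0.
have WE : W = (W - 2 + 2)%N by rewrite subnK.
exists (kpr mdeg (W - 2) theta); first by right; exists (W - 2)%N.
have := kle_d (kle_kpr mdeg (W - 2) theta); have := kpr_d (kle_kpr mdeg (W - 2) theta).
rewrite -WE kprI => e3 k3; apply: kleS; first exact: kleD.
have -> : kpr mdeg W (eta + d (kpr mdeg (W - 2) theta)) =
    kpr mdeg W eta + kpr mdeg W (d (kpr mdeg (W - 2) theta)) by apply: raddfD.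
by rewrite e3 e2 [in X in X + _]WE kpr_q subrr.
Qed.

Lemma vanish l eta : (n < l)%N \/ (forall s, q_acyclic C n k s l) -> 'I_n ->
  SOinv eta -> isdeg l eta -> d eta = 0 -> cob l eta.
Proof.
move=> hl a0 inv deg z; case: hl => [nl|ac].
  by rewrite (isdeg_gt nl deg); apply: cob0.
by have [t t1 t2] := SO_exact a0 ac inv deg z; exists t.
Qed.

(** * Setting w = 0 *)

Definition wzero : P -> P := subst (fun l => if split l is inl _ then 'X_l else 0).
HB.instance Definition _ := GRing.RMorphism.on wzero.

Lemma wzero_z a j : wzero (zX C a j) = zX C a j.
Proof. by apply: etrans (substX _ _) _; rewrite /zidx (unsplitK (inl _)). Qed.
Lemma wzero_w j : wzero (wX C n j) = 0.
Proof. by apply: etrans (substX _ _) _; rewrite /widx (unsplitK (inr _)). Qed.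
Lemma wzeroC (c : C) : wzero c%:MP = c%:MP.
Proof. exact: substC. Qed.

Definition wfree (m : 'X_{1..(n * k + k)}) := [forall i : 'I_k, m (widx n i) == 0%N].

Lemma wzeroX m : wzero 'X_[m] = if wfree m then 'X_[m] else 0.
Proof.
rewrite mpolyXE_id rmorph_prod /=; case: ifP => [/forallP hm|/negbT].
  apply: eq_bigr => l _; rewrite rmorphXn /=.
  case: (var_case l) => [[a [j ->]]|[j ->]]; last by rewrite (eqP (hm j)) !expr0.
  by rewrite -[mpolyX _ _]/(zX C a j) wzero_z.
rewrite negb_forall => /existsP[i hi]; rewrite (bigD1 (widx n i)) //= rmorphXn /=.
by rewrite -[mpolyX _ _]/(wX C n i) wzero_w expr0n (negbTE hi) mul0r.
Qed.

Lemma mcoeff_wzero f m : (wzero f)@_m = if wfree m then f@_m else 0.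
Proof.
rewrite {1}[f]mpolyE rmorph_sum raddf_sum /=.
under eq_bigr => m' _ do rewrite -mul_mpolyC rmorphM /= wzeroC wzeroX mul_mpolyC mcoeffZ.
case: ifP => wm.
  rewrite [RHS](_ : _ = (\sum_(m' <- msupp f) f@_m' *: 'X_[m'])@_m); last by rewrite -mpolyE.
  rewrite raddf_sum /=; apply: eq_bigr => m' _; rewrite mcoeffZ; case: ifP => // wm'.
  rewrite mcoeff0 mcoeffX; case: eqP => [e|_]; last by [].
  by rewrite e wm in wm'.
rewrite big1 // => m' _; case: ifP => wm'; rewrite ?mcoeff0 ?mulr0 // mcoeffX.
by case: eqP => [e|_]; rewrite ?mulr0 // -e wm' in wm *.
Qed.

Definition zonly f := forall m, m \in msupp f -> forall i : 'I_k, m (widx n i) = 0%N.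

Lemma zonlyP f : zonly f <-> wzero f = f.
Proof.
split=> h.
  apply/mpolyP=> m; rewrite mcoeff_wzero; case: ifP => // /negbT.
  rewrite negb_forall => /existsP[i hi]; apply/esym/eqP; rewrite mcoeff_eq0.
  by apply: contra hi => /h ->.
move=> m; rewrite -h mcoeff_msupp mcoeff_wzero; case: ifP => [/forallP hm _ i|]; first exact/eqP.
by rewrite eqxx.
Qed.

Lemma wzero_idem f : wzero (wzero f) = wzero f.
Proof. by apply/mpolyP=> m; rewrite !mcoeff_wzero; case: (wfree m). Qed.

Lemma mderiv_wzero j f : mderiv (widx n j) (wzero f) = 0.
Proof.
apply/mpolyP=> m; rewrite mcoeff_deriv mcoeff_wzero mcoeff0; case: ifP => [/forallP /(_ j)|_]; last by rewrite mul0rn.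
by rewrite mnmDE mnm1E eqxx addn1.
Qed.

Lemma wzero_act h f : act h (wzero f) = wzero (act h f).
Proof.
apply: (@rmorph_mpoly_ext C _ P (act h \o wzero)%FUN (wzero \o act h)%FUN) => [c|l] /=.
  by rewrite wzeroC actC wzeroC.
case: (var_case l) => [[a [j ->]]|[j ->]].
  rewrite -[mpolyX _ _]/(zX C a j) wzero_z act_z rmorph_sum; apply: eq_bigr => c _.
  by rewrite rmorphM /= wzeroC wzero_z.
rewrite -[mpolyX _ _]/(wX C n j) act_w wzero_w; exact: rmorph0.
Qed.

Lemma kpr_wzero N W (eta : KF P N) : kpr mdeg W (mapf wzero eta) = mapf wzero (kpr mdeg W eta).
Proof.
apply/ffunP=> S; rewrite kprE !mapfE kprE; apply/mpolyP=> m.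
rewrite mcoeff_pihomog !mcoeff_wzero mcoeff_pihomog.
by case: ifP; case: ifP.
Qed.

Lemma wzero_ideal f : exists t : 'I_k -> P, f - wzero f = \sum_j wX C n j * t j.
Proof.
elim/mpoly_indX: f => [|c p q [t1 e1] [t2 e2]|l p [t e]].
- by exists (fun=> 0); rewrite rmorph1 subrr big1 // => j _; rewrite mulr0.
- exists (fun j => c%:MP * t1 j + t2 j).
  rewrite -mul_mpolyC rmorphD rmorphM /= wzeroC.
  have -> : c%:MP * p + q - (c%:MP * wzero p + wzero q) = c%:MP * (p - wzero p) + (q - wzero q) by ring.
  rewrite e1 e2 mulr_sumr -big_split; apply: eq_bigr => j _ /=; ring.
rewrite rmorphM /=; case: (var_case l) => [[a [j ->]]|[j ->]].
  rewrite -[mpolyX _ _]/(zX C a j) wzero_z -mulrBr e mulr_sumr.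
  exists (fun i => zX C a j * t i); apply: eq_bigr => i _; ring.
rewrite -[mpolyX _ _]/(wX C n j) wzero_w mul0r subr0.
exists (fun i => (i == j)%:R * p); rewrite (bigD1 j) //= eqxx mul1r big1 ?addr0 // => i ij.
by rewrite (negbTE ij) mul0r mulr0.
Qed.

(** * The classes of the Kudla-Millson cocycle *)

Definition phi : KF P n := Theta Zmx (dlt P [set: 'I_k]).

Lemma isdeg_phi f : isdeg k (f *: phi).
Proof.
by apply: isdegZ; apply: isdeg_Theta; have := isdeg_dlt P [set: 'I_k]; rewrite cardsT card_ord.
Qed.
Lemma phi_Theta f : f *: phi = Theta Zmx (f *: dlt P [set: 'I_k]).
Proof. by apply/esym; apply: linearZ. Qed.
Lemma chinv_phi f : pinv false f -> chinv false (f *: phi).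
Proof.
move=> inv; rewrite phi_Theta; apply: ThetaZ_chinv => S h oh rh.
rewrite scE ffunE actM rmorph_nat inv //; ring.
Qed.
Lemma phi_inj f : (k <= n)%N -> f *: phi = 0 -> f = 0.
Proof.
move=> kn; have deg : isdeg k (f *: dlt P [set: 'I_k]).
  by apply: isdegZ; have := isdeg_dlt P [set: 'I_k]; rewrite cardsT card_ord.
rewrite phi_Theta => /(ThetaZ_inj kn deg) /ffunP /(_ setT).
by rewrite scE !ffunE eqxx mulr1.
Qed.

Lemma wzero_Z : map_mx wzero Zmx = Zmx.
Proof. by apply/matrixP=> j a; rewrite !mxE wzero_z. Qed.
Lemma wzero_phi f : mapf wzero (f *: phi) = wzero f *: phi.
Proof. by rewrite mapfZ /phi mapf_Theta mapf_dlt wzero_Z. Qed.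
Lemma wzero_q eta : mapf wzero (extv qrow eta) = 0.
Proof.
rewrite mapf_extv; have -> : map_mx wzero qrow = 0.
  apply/rowP=> a; rewrite !mxE /qX rmorph_sum big1 // => i _.
  by rewrite rmorphM /= wzero_w mulr0.
by rewrite extvE big1 // => a _; rewrite mxE scale0r.
Qed.

(** Every term of L differentiates in some w_j and kills forms free of w. *)
Lemma wzero_d eta : mapf wzero eta = eta -> d eta = - extv qrow eta.
Proof.
move=> e; rewrite DL_split big1 ?addr0 // => a _.
have -> : cw (@Lop C n k a) eta = 0; last exact: raddf0.
apply/ffunP=> S; rewrite cwE ffunE /Lop big1 // => j _.
by rewrite -e mapfE mderiv_wzero raddf0.
Qed.

Definition wvec : 'rV[P]_k := \row_j wX C n j.
Lemma wvec_Z : wvec *m Zmx = qrow.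
Proof. by apply/rowP=> a; rewrite !mxE; apply: eq_bigr => j _; rewrite !mxE mulrC. Qed.

(** As q = w Z, this is the image under [Theta] of w times the top form in k generators, which is
    zero. *)
Lemma q_phi f : extv qrow (f *: phi) = 0.
Proof.
rewrite phi_Theta -wvec_Z -Theta_extv.
have -> : extv wvec (f *: dlt P [set: 'I_k]) = 0; last exact: raddf0.
apply: (@isdeg_gt P k k.+1); first exact: ltnSn.
apply: isdeg_extv; apply: isdegZ.
by have := isdeg_dlt P [set: 'I_k]; rewrite cardsT card_ord.
Qed.

(** On the k generators, a pairing with w times the top form is w /\ (a contraction of the top
    form); [Theta Zmx] turns w into q. *)
Lemma w_phi (t : 'I_k -> P) : (\sum_j wX C n j * t j) *: phi =
  extv qrow (Theta Zmx (intv (\row_j t j) (dlt P [set: 'I_k]))).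
Proof.
rewrite -wvec_Z -Theta_extv phi_Theta; congr (Theta _ _).
have z : extv wvec (dlt P [set: 'I_k]) = 0.
  apply: (@isdeg_gt P k k.+1); first exact: ltnSn.
  by apply: isdeg_extv; have := isdeg_dlt P [set: 'I_k]; rewrite cardsT card_ord.
have := intv_extv (\row_j t j) wvec (dlt P [set: 'I_k]); rewrite z.
have -> : intv (\row_j t j) (0 : KF P k) = 0 by apply: raddf0.
move/esym/eqP; rewrite subr_eq0 => /eqP <-; congr (_ *: _).
by apply: eq_bigr => j _; rewrite !mxE mulrC.
Qed.

End Cohomology.

Lemma sub_shift (V : zmodType) (x y z t : V) : x - (y + z) = (x - y + t - z) - t.
Proof. by rewrite -!addrA; congr (_ + _); rewrite opprD; congr (_ + _); rewrite addrCA subrr addr0. Qed.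

Lemma isdeg1_Theta (A : comNzRingType) K N l (h : 'M[A]_(K, N)) b :
  isdeg1 l b -> isdeg1 l (Theta h b).
Proof.
case: l => [/isdeg1_0 ->|l]; first by rewrite raddf0 isdeg10.
by rewrite !isdeg1S; apply: isdeg_Theta.
Qed.

Section Classes.
Variables (C : numClosedFieldType) (n k : nat).
Local Notation P := {mpoly C[(n * k + k)%N]}.
Local Notation fa := (@fa C n k).
Local Notation act := (@act C n k).
Local Notation qrow := (qrow C n k).
Local Notation Zmx := (Zmx C n k).
Local Notation vol := (dlt P [set: 'I_n]).
Local Notation d := (dop (@DL C n k)).
Local Notation phi := (phi C n k).
Local Notation cob := (@cob C n k).
Implicit Types (h : 'M[C]_n) (f g r w : P) (s : bool) (eta theta : KF P n).

Definition inR f := zonly f /\ pinv false f.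

Lemma pinvD s f g : pinv s f -> pinv s g -> pinv s (f + g).
Proof. by move=> i1 i2 h oh rh; rewrite rmorphD /= i1 // i2 // mulrDr. Qed.
Lemma pinvN s f : pinv s f -> pinv s (- f).
Proof. by move=> i1 h oh rh; rewrite rmorphN /= i1 // mulrN. Qed.
Lemma pinv0 s : pinv s (0 : P).
Proof. by move=> h oh rh; rewrite rmorph0 mulr0. Qed.
Lemma pinvZ s (c : C) f : pinv s f -> pinv s (c *: f).
Proof. by move=> i1 h oh rh; rewrite -mul_mpolyC rmorphM /= actC i1 //; ring. Qed.
Lemma pinv_wzero s f : pinv s f -> pinv s (wzero f).
Proof. by move=> i1 h oh rh; rewrite wzero_act i1 // rmorphM /= wzeroC. Qed.

Lemma phi_closed f : zonly f -> d (f *: phi) = 0.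
Proof.
by move=> /zonlyP zf; rewrite wzero_d ?q_phi ?oppr0 // wzero_phi zf.
Qed.

(** The top component of a coboundary is a multiple of q by [SO_lead], so it vanishes at w = 0. As f
    phi is free of w, its top component is zero in every degree, and f = 0 by injectivity. *)
Lemma phi_cob f (a0 : 'I_n) : (0 < k)%N -> (k <= n)%N -> zonly f -> cob k (f *: phi) -> f = 0.
Proof.
move=> k0 kn /zonlyP zf [theta [inv deg] e]; apply: (phi_inj kn).
have key W : kle mdeg W (f *: phi) -> f *: phi = 0.
  elim: W => [|W IH]; first exact: kle0.
  move=> hW; apply/IH/kleS => //.
  have [|t _ et] := @SO_lead C n k a0 k _ W _ theta hW inv deg e.
    by move=> s l' kl; apply: q_acyclic_small; rewrite (minn_idPr kn) kl.
  have : mapf (@wzero C n k) (kpr mdeg W (f *: phi)) = 0 by rewrite et wzero_q.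
  by rewrite -kpr_wzero wzero_phi zf.
have [W hW] := kle_ex mdeg (f *: phi); exact: key hW.
Qed.

(** The top component of eta is f phi with f invariant. Modulo the ideal (w) one may set w = 0 in f,
    since (w) phi consists of multiples of q by [w_phi], and these are traded for lower degree by a
    coboundary. *)
Lemma phi_cover : (k <= n)%N -> cov C n k k -> forall eta, chinv false eta -> isdeg k eta ->
  exists2 r, inR r & cob k (eta - r *: phi).
Proof.
move=> kn hcov eta; have [W] := kle_ex mdeg eta.
elim: W eta => [|W IH] eta hW inv deg.
  exists 0; first by split; [move=> m; rewrite msupp0 | exact: pinv0].
  by rewrite (kle0 hW) scale0r subrr; apply: cob0.
have toS zeta : chinv false zeta -> isdeg k zeta -> exists2 f, pinv false f & zeta = f *: phi.
  move=> iz dz; have [b [db ib ->]] := hcov _ iz dz.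
  by exists (b setT); [exact: ib | apply: phi_top].
have [f invf ef] := toS _ (chinv_kpr W inv) (isdeg_kpr mdeg W deg).
(* The component of degree W of f phi at w = 0, written again as a multiple of phi; going through
   [toS] avoids comparing degrees with that of phi. *)
have [f3 invf3 ef3] := toS _ (chinv_kpr W (chinv_phi (pinv_wzero invf))) (isdeg_kpr mdeg W (isdeg_phi _)).
have z3 : zonly f3.
  apply/zonlyP/eqP; rewrite -subr_eq0; apply/eqP/(phi_inj kn).
  by rewrite scalerBl -wzero_phi -ef3 -kpr_wzero wzero_phi wzero_idem subrr.
have [t et] := wzero_ideal f.
have dT : isdeg1 k (Theta Zmx (intv (\row_j t j) (dlt P [set: 'I_k]))).
  have : isdeg1 k (intv (\row_j t j) (dlt P [set: 'I_k])).
    by apply: isdeg1_intv; have := isdeg_dlt P [set: 'I_k]; rewrite cardsT card_ord.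
  exact: isdeg1_Theta.
have [theta [i1 d1] eT] := @chinv_q_lift C n k false k ((f - wzero f) *: phi) _
  (chinv_phi (pinvD invf (pinvN (pinv_wzero invf)))) dT (etrans (congr1 (fun g => g *: phi) et) (w_phi t)).
have e1 : kpr mdeg W (eta - f3 *: phi) = kpr mdeg W (extv qrow theta).
  have kB x y : kpr mdeg W (x - y) = kpr mdeg W x - kpr mdeg W y :> KF P n by apply: raddfB.
  have a1 : kpr mdeg W (f *: phi) = kpr mdeg W eta by rewrite -ef kprI.
  have a2 : kpr mdeg W (f3 *: phi) = f3 *: phi by rewrite -ef3 kprI.
  apply: (etrans (kB _ _)); rewrite a2 -a1 -ef3 -eT scalerBl; apply/esym/kB.
have h1 : kle mdeg W.+1 (eta - f3 *: phi) by apply: kleB => //; rewrite -ef3; apply: kle_kpr.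
have [theta' ht k'] := lower h1 e1.
have [i' d'] : chinv false theta' /\ isdeg1 k theta'.
  case: ht => [->|[W' ->]]; first by split; [exact: chinv0 | exact: isdeg10].
  by split; [exact: chinv_kpr | exact: isdeg1_kpr].
have [||r' [zr' ir'] cr'] := IH _ k'.
- by apply: chinvD; [apply: chinvB => //; apply: chinv_phi | apply: chinv_d].
- by apply: isdegD; [apply: isdegB => //; apply: isdeg_phi | apply: isdeg1_dop].
exists (f3 + r').
  split; last exact: pinvD.
  by apply/zonlyP; rewrite rmorphD /= (proj1 (zonlyP _) z3) (proj1 (zonlyP _) zr').
have -> : eta - (f3 + r') *: phi = (eta - f3 *: phi + d theta' - r' *: phi) - d theta'.
  by rewrite scalerDl; apply: sub_shift.
by apply: cobB => //; apply: cob_chinv i' d'.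
Qed.

(** * Classes in degree n *)

Lemma kpr_vol m f : kpr mdeg m (f *: vol) = pihomog mdeg m f *: vol.
Proof.
apply/ffunP=> S; rewrite kprE !scE ffunE; case: (S == setT); first by rewrite !mulr1.
by rewrite !mulr0 raddf0.
Qed.
Lemma kle_vol m f : kle mdeg m (f *: vol) <-> (msize f <= m)%N.
Proof.
split=> [/(_ setT)|h S]; first by rewrite scE ffunE eqxx mulr1.
rewrite scE ffunE; case: (S == setT); first by rewrite mulr1.
by rewrite mulr0 mmeasure0.
Qed.

Lemma qid_subspace : subspace (@qid C n k).
Proof.
split=> [|c u w [t1 ->] [t2 ->]]; first by exists (fun=> 0); rewrite big1 // => a _; rewrite mulr0.
exists (fun a => c *: t1 a + t2 a); rewrite scaler_sumr -big_split; apply: eq_bigr => a _ /=.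
by rewrite mulrDr scalerAr.
Qed.

Lemma qid_homog m f : qid f -> qid (pihomog mdeg m f).
Proof.
move=> /qid_vol [theta d1 e]; apply/qid_vol; rewrite -kpr_vol e.
have [m2|m2] := ltnP m 2.
  by exists 0; [exact: isdeg10 | rewrite kpr_q0 // raddf0].
exists (kpr mdeg (m - 2) theta); first exact: isdeg1_kpr.
by rewrite -kpr_q subnK.
Qed.

(** [top_degree] for a class G of forms: the det-semi-invariant ones when k <= n, where f vol
    corresponds to an O(n)-invariant f, and all SO(n)-invariant ones when k > n. *)
Lemma top_classes (G : KF P n -> Prop) (W num : P -> Prop) :
  G 0 -> (forall x y, G x -> G y -> G (x - y)) -> (forall m x, G x -> G (kpr mdeg m x)) ->
  (forall c x, G x -> G (c%:MP *: x)) ->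
  (forall x, G x -> G (d x)) -> (forall x, G x -> SOinv x) ->
  (forall x theta, G x -> isdeg1 n theta -> x = extv qrow theta ->
     exists2 theta', G theta' /\ isdeg1 n theta' & x = extv qrow theta') ->
  (forall m x, G x -> kle mdeg m.+1 x -> cob n x ->
     exists2 theta, isdeg1 n theta & kpr mdeg m x = extv qrow theta) ->
  subspace W -> (forall m w, W w -> W (pihomog mdeg m w)) ->
  (forall f, G (f *: vol) -> (W f <-> qid f)) ->
  (forall f p, num f -> is_proj (@fis C _) W f p -> G ((f - p) *: vol)) ->
  (forall f, G (f *: vol) -> num f) ->
  exists psi : P -> P,
  [/\ linear psi, forall f, num f -> G (psi f *: vol),
      forall f, num f -> (cob n (psi f *: vol) <-> W f),
      forall g, G (g *: vol) -> exists2 f, num f & cob n ((g - psi f) *: vol) &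
      forall f, G (f *: vol) -> exists r, [/\ G (r *: vol), (msize r <= (msize f).-1)%N &
         cob n ((psi f - (f + r)) *: vol)]].
Proof.
move=> G0 GB Gk GZ Gd GS Glift Glead sW hW Wq nA An.
have GN x : G x -> G (- x) by rewrite -sub0r; apply: GB.
have GD x y : G x -> G y -> G (x + y) by move=> gx /GN gy; rewrite -[y]opprK; apply: GB.
apply: (@top_degree C _ n (fun f => G (f *: vol)) W num (cob n)) => //.
- split=> [|c u w Gu Gw]; first by rewrite scale0r.
  rewrite scalerDl -mul_mpolyC -scalerA; exact: (GD _ _ (GZ c _ Gu) Gw).
- exact: cob0.
- exact: cobB.
- move=> m f Gf sf cf; have [theta d1 e] := Glead m _ Gf (proj2 (kle_vol _ _) sf) cf.
  have Gp : G (pihomog mdeg m f *: vol) by rewrite -kpr_vol; apply: Gk.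
  by apply/(Wq _ Gp)/qid_vol; exists theta => //; rewrite -kpr_vol.
move=> m w Gw Ww sw; have /(Wq _ Gw) /qid_vol [theta0 d0 e0] := Ww.
have [theta [Gt d1] e] := Glift _ _ Gw d0 e0.
(* For w in W the form w vol equals q /\ theta with theta in G, so a coboundary moves it to lower
   degree. *)
have [theta' ht k'] := lower (proj2 (kle_vol _ _) sw) (congr1 (kpr mdeg m) e).
have [G' d'] : G theta' /\ isdeg1 n theta'.
  case: ht => [->|[W' ->]]; first by split; [exact: G0 | exact: isdeg10].
  by split; [exact: Gk | exact: isdeg1_kpr].
have deg : isdeg n (w *: vol + d theta').
  by apply: isdegD; [exact: isdeg_vol | exact: isdeg1_dop].
exists ((w *: vol + d theta') setT); rewrite -(isdegT deg); split.
- by apply: GD => //; apply: Gd.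
- by apply/kle_vol; rewrite -(isdegT deg).
have -> : (w - (w *: vol + d theta') setT) *: vol = - d theta'.
  rewrite scalerBl; apply: (etrans (congr1 (fun z => w *: vol - z) (esym (isdegT deg)))).
  by rewrite opprD addrA subrr sub0r.
by apply: cobN; exists theta' => //; split=> //; apply: GS.
Qed.

Lemma act_crow h : orth h -> map_mx (act h) (crow C n k) = crow C n k.
Proof.
move=> oh; rewrite -qZ_crow map_mxM -map_trmx act_Z trmx_mul trmxK mulmxA; congr (_ *m _).
have -> : map_mx (act h) qrow = qrow *m (cm n k h)^T.
  by apply/rowP=> a; rewrite !mxE act_q; apply: eq_bigr => c _; rewrite !mxE mulrC.
rewrite -mulmxA; have := cm_orth k (orth_tr oh); rewrite cm_tr trmxK => ->.
exact: mulmx1.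
Qed.

(** Both sides say that f vol is a multiple of q, by [cid_vol] and [qid_vol]; semi-invariance of the
    cofactor comes from [chinv_q_lift]. Homogeneity of (c) is then inherited from (q). *)
Lemma cid_iff f : (0 < n)%N -> cov C n k 1 -> cid f <-> pinv false f /\ qid f.
Proof.
move=> n0 hcov; split=> [ci|[inv qi]].
  have inv : pinv false f.
    case: ci => t it -> h oh rh; rewrite rmorph_sum /chi expr0 mpolyC1 mul1r.
    apply: eq_bigr => j _; rewrite rmorphM /= (it j h oh rh) /chi expr0 mpolyC1 mul1r; congr (_ * _).
    by have /rowP /(_ j) := act_crow oh; rewrite !mxE.
  split=> //; apply/qid_vol; have [theta [_ d1] e] := proj1 (cid_vol n0 hcov inv) ci.
  by exists theta.
apply/(cid_vol n0 hcov inv); have /qid_vol [theta d1 e] := qi.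
by apply: chinv_q_lift e => //; apply/chinv_vol.
Qed.

Definition SOpinv f := forall h, orth h -> realmx h -> \det h = 1 -> act h f = f.

Lemma SOinv_vol f : SOinv (f *: vol) <-> SOpinv f.
Proof.
split=> inv h oh rh dh; first by have := inv h oh rh dh; rewrite fa_vol dh mpolyC1 mulr1 => /volZ_inj.
by rewrite fa_vol dh mpolyC1 mulr1 inv.
Qed.

Lemma SOinvZC (c : C) eta : SOinv eta -> SOinv (c%:MP *: eta).
Proof. by move=> inv h oh rh dh; rewrite (faZ h _ eta) actC inv. Qed.

Lemma psi_c (a0 : 'I_n) : (k <= n)%N -> cov C n k 1 -> (k < n -> forall m, cov C n k m)%N ->
  exists psi : P -> P,
  [/\ linear psi, forall f, pinv false f -> pinv false (psi f),
      forall f, pinv false f -> (cob n (psi f *: vol) <-> cid f),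
      forall g, pinv false g -> exists2 f, pinv false f & cob n ((g - psi f) *: vol) &
      forall f, pinv false f -> exists r, [/\ pinv false r, (msize r <= (msize f).-1)%N &
         cob n ((psi f - (f + r)) *: vol)]].
Proof.
move=> kn cov1 hcov; have n0 : (0 < n)%N by case: n a0 => [[]|].
have cv f : chinv true (f *: vol) <-> pinv false f by apply: chinv_vol.
have [|||||||||||||psi [p1 p2 p3 p4 p5]] := @top_classes (@chinv C n k true) (@cid C n k) (pinv false).
- exact: chinv0.
- by move=> x y; apply: chinvB.
- by move=> m x; apply: chinv_kpr.
- by move=> c x; apply: chinvZC.
- by move=> x; apply: chinv_d.
- by move=> x; apply: chinv_SO.
- by move=> x theta ix dt e; apply: chinv_q_lift ix dt e.
- move=> m x ix kx [theta [it dt] e].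
  have [||||theta' [_ d'] e'] := @d_lead C n k true n _ m x (part a0 true theta) kx.
  (* Leading terms of coboundaries require exactness in degree n - 1, which is below n as
     [acyclic_true] demands. *)
  + by move=> l' nl; apply: acyclic_true => //; rewrite nl.
  + exact: part_chinv.
  + exact: isdeg1_part.
  + by rewrite -part_d -e part_id.
  by exists theta'.
- have [q0 qD] := qid_subspace.
  split=> [|c u w /(cid_iff _ n0 cov1) [iu qu] /(cid_iff _ n0 cov1) [iw qw]]; apply/(cid_iff _ n0 cov1).
    by split; [exact: pinv0 | exact: q0].
  by split; [apply: pinvD => //; apply: pinvZ | apply: qD].
- move=> m w /(cid_iff _ n0 cov1) [iw qw]; apply/(cid_iff _ n0 cov1).
  by split; [exact: pinv_pihomog | exact: qid_homog].
- by move=> f /cv inv; split=> [/(cid_iff _ n0 cov1) []|qf] //; apply/(cid_iff _ n0 cov1).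
- by move=> f p inv [/(cid_iff _ n0 cov1) [ip _] _]; apply/cv; apply: pinvD => //; apply: pinvN.
- by move=> f /cv.
exists psi; split=> //.
- by move=> f /p2 /cv.
- by move=> g /cv /p4.
- by move=> f /cv /p5 [h [/cv h1 h2 h3]]; exists h.
Qed.

Lemma qid_act h f : qid f -> qid (act h f).
Proof.
case=> t ->; exists (fun c => \sum_a (h a c)%:MP * act h (t a)).
rewrite rmorph_sum /=; under eq_bigr => a _ do rewrite rmorphM /= act_q mulr_suml.
rewrite exchange_big; apply: eq_bigr => c _; rewrite mulr_sumr; apply: eq_bigr => a _.
ring.
Qed.

(** For n < k the map q /\ _ is exact in all degrees below n already on all forms, so the ideal (q)
    of the full polynomial ring takes the place of (c). *)
Lemma psi_q (a0 : 'I_n) : (n < k)%N ->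
  exists psi : P -> P,
  [/\ linear psi,
      forall f, (forall h, orth h -> realmx h -> \det h = 1 -> qid (act h f - f)) -> SOpinv (psi f),
      forall f, (forall h, orth h -> realmx h -> \det h = 1 -> qid (act h f - f)) ->
        (cob n (psi f *: vol) <-> qid f),
      forall g, SOpinv g -> exists2 f,
        (forall h, orth h -> realmx h -> \det h = 1 -> qid (act h f - f)) & cob n ((g - psi f) *: vol) &
      forall f, SOpinv f -> exists r, [/\ SOpinv r, (msize r <= (msize f).-1)%N &
         cob n ((psi f - (f + r)) *: vol)]].
Proof.
move=> nk; pose num f := forall h, orth h -> realmx h -> \det h = 1 -> qid (act h f - f).
have n0 : (0 < n)%N by case: n a0 => [[]|].
have [|||||||||||||psi [p1 p2 p3 p4 p5]] := @top_classes (@SOinv C n k) (@qid C n k) num.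
- exact: (chinv_SO (@chinv0 C n k false)).
- by move=> x y; apply: SOinvB.
- by move=> m x; apply: SOinv_kpr.
- by move=> c x; apply: SOinvZC.
- by move=> x ix h oh rh dh; rewrite -d_fa // ix.
- by [].
- by move=> x theta ix dt e; apply: (SO_q_lift a0) ix dt e.
- move=> m x ix kx [theta [it dt] e].
  have [|theta' [_ d'] e'] := @SO_lead C n k a0 n _ m x theta kx it dt e.
    by move=> s l' nl; apply: q_acyclic_small; rewrite (minn_idPl (ltnW nk)) nl.
  by exists theta'.
- exact: qid_subspace.
- by move=> m w; apply: qid_homog.
- by [].
- move=> f p nf pp; apply/SOinv_vol => h oh rh dh.
  (* f is fixed only modulo (q), but its component orthogonal to (q) is fixed itself; thus [psi]
     takes values in the invariants. *)
  apply: (@proj_fixed C _ (@fis C _) (@fisDZ C _) (@fis_eq0 C _) (@qid C n k) f p (act h) qid_subspace pp).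
  + by move=> u w; apply: fis_act.
  + by move=> u w; apply: raddfB.
  + by move=> w; apply: qid_act.
  + move=> w qw; exists (act h^T w); first exact: qid_act.
    by rewrite act_comp (mulmx1C oh) act1.
  exact: nf.
- move=> f /SOinv_vol inv h oh rh dh; rewrite inv // subrr.
  by case: qid_subspace.
exists psi; split=> //.
- by move=> f /p2 /SOinv_vol.
- by move=> g /SOinv_vol /p4.
- by move=> f /SOinv_vol /p5 [h [/SOinv_vol h1 h2 h3]]; exists h.
Qed.
End Classes.

(** * Comparison with the definitions *)

Section ExteriorProduct.
Variables (A : comNzRingType) (N : nat).
Implicit Types (eta theta : KF A N) (U S T : {set 'I_N}) (x : 'rV[A]_N).

(* [wedge] over an arbitrary coefficient ring. *)
Definition gwedge (eta theta : KF A N) : KF A N :=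
  [ffun U : {set 'I_N} => \sum_(S : {set 'I_N} | S \subset U)
     (-1) ^+ inversions S (U :\: S) * (eta S * theta (U :\: S))].

(** The inversions between the singleton of a and the rest of U are the elements of U below a, so
    the two sign conventions agree. *)
Lemma gwedge_ext a eta : gwedge (ext a (dlt A set0)) eta = ext a eta.
Proof.
apply/ffunP=> U; rewrite ffunE extE.
have oE S : ext a (dlt A set0) S = (S == [set a])%:R.
  by rewrite ext_dlt in_set0 scE setU0 ffunE sg_set0 mul1r.
under eq_bigr => S _ do rewrite oE.
case: ifP => aU; last first.
  rewrite big1 // => S SU; case: eqP => [e|_]; last by rewrite mul0r mulr0.
  by move: SU; rewrite e sub1set aU.
rewrite (bigD1 [set a]) ?sub1set //= eqxx mul1r big1 ?addr0 => [|S /andP[_ /negbTE ->]]; last first.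
  by rewrite mul0r mulr0.
congr (_ ^+ _ * _); rewrite /inversions.
rewrite -(card_imset [set b in U | (b < a)%N] (f := fun b => (a, b))) => [|b c []] //.
apply: eq_card => -[c b]; rewrite !inE /=; apply/idP/imsetP => [/and3P[/eqP -> /andP[_ bU] ba]|[b' ]].
  by exists b => //; rewrite inE bU.
by rewrite !inE => /andP[bU ba] [-> ->]; rewrite eqxx bU ba andbT neq_ltn ba.
Qed.

Lemma gwedge_extv x eta : gwedge (extv x (dlt A set0)) eta = extv x eta.
Proof.
rewrite extvE [RHS]extvE.
transitivity (\sum_a x 0 a *: gwedge (ext a (dlt A set0)) eta); last first.
  by apply: eq_bigr => a _; rewrite gwedge_ext.
apply/ffunP=> U; rewrite ffunE sum_ffunE.
under [RHS]eq_bigr => a _ do rewrite scE ffunE mulr_sumr.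
rewrite exchange_big; apply: eq_bigr => S _.
rewrite sum_ffunE mulr_suml mulr_sumr; apply: eq_bigr => a _.
by rewrite scE -[_ * _ * eta _]mulrA mulrCA.
Qed.

Lemma big_gwedge K (h : 'M[A]_(K, N)) (J : {set 'I_K}) :
  \big[gwedge/dlt A set0]_(j in J) extv (row j h) (dlt A set0) = wprod h J.
Proof.
have eJ : enum J = [seq j <- index_enum 'I_K | j \in J] by rewrite /enum_mem [index_enum _]unlock.
rewrite wprodE eJ -big_filter; elim: (filter _ _) => [|j s IH]; first by rewrite big_nil.
by rewrite big_cons IH gwedge_extv.
Qed.

Lemma big_gwedgeT K (h : 'M[A]_(K, N)) :
  \big[gwedge/dlt A set0]_(j < K) extv (row j h) (dlt A set0) = wprod h setT.
Proof. by rewrite -big_gwedge; apply: eq_bigl => j; rewrite inE. Qed.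

End ExteriorProduct.

Section Substitution.
Variables (C : numClosedFieldType) (n k : nat).
Local Notation P := {mpoly C[(n * k + k)%N]}.

Lemma comp_act (x : 'rV[P]_(n * k + k)) (h : 'M[C]_n) (f : P) :
  (forall a i, x 0 (zidx a i) = \sum_b (h a b)%:MP * zX C b i) ->
  (forall i, x 0 (widx n i) = wX C n i) ->
  f \mPo [tuple x 0 l | l < (n * k + k)%N] = act h f.
Proof.
move=> xz xw; apply: (@rmorph_mpoly_ext C _ P (comp_mpoly [tuple x 0 l | l < (n * k + k)%N]) (act h)) => [c|l] /=.
  by rewrite comp_mpolyC actC.
rewrite comp_mpolyXU -tnth_nth tnth_mktuple.
case: (var_case l) => [[a [j ->]]|[j ->]]; first by rewrite xz -act_z.
by rewrite xw -(act_w h).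
Qed.

Lemma dop_sum (eta : KF P n) : dop (@DL C n k) eta =
  \sum_j \sum_a gwedge (ext a (dlt P set0))
     [ffun S => mderiv (zidx a j) (mderiv (widx n j) (eta S)) - zX C a j * wX C n j * eta S].
Proof.
rewrite exchange_big dopE; apply: eq_bigr => a _.
under eq_bigr => j _ do rewrite gwedge_ext.
rewrite -raddf_sum; congr (ext a _); apply/ffunP=> S.
rewrite cwE sum_ffunE /= /DX /Lop /qX mulr_suml -sumrB; apply: eq_bigr => j _.
by rewrite ffunE.
Qed.

Lemma omega_ext (a : 'I_n) : ext a (dlt P (set0 : {set 'I_n})) = [ffun S => (S == [set a])%:R].
Proof.
apply/ffunP=> S; rewrite ext_dlt in_set0 scE setU0 !ffunE sg_set0 mul1r.
by [].
Qed.

Local Notation FF := {ffun {set 'I_n} -> P}.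
Local Notation om a := ([ffun S => (S == [set a])%:R] : FF).

Lemma gform_act (h : 'M[C]_n) (u : 'I_n -> 'I_n -> C) (pa : P -> P) (eta : KF P n) :
  (forall a b, u a b = h a b) -> (forall f, pa f = act h f) ->
  \sum_S [ffun T => pa (eta S) * (\big[@gwedge P n/dlt P set0]_(a in S) \sum_b u a b *: om b) T] = fa h eta.
Proof.
move=> uh ph; rewrite faE ThetaE; apply: eq_bigr => S _; apply/ffunP=> T.
have eb : \big[@gwedge P n/dlt P set0]_(a in S) \sum_b u a b *: om b = wprod (cm n k h) S.
  rewrite -big_gwedge; apply: eq_bigr => a _; rewrite extvE; apply: eq_bigr => b _.
  by rewrite uh scaleCE omega_ext !mxE.
by rewrite ffunE scE mapfE ph eb.
Qed.

Lemma gvol : \big[@gwedge P n/dlt P set0]_(a < n) om a = dlt P setT.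
Proof.
rewrite -[RHS]Theta_id Theta_dlt -big_gwedgeT; apply: eq_bigr => a _.
by rewrite row1 extv_delta omega_ext.
Qed.

Lemma gphi : \big[@gwedge P n/dlt P set0]_(i < k) \sum_a ([ffun S => zX C a i * om a S] : FF) = phi C n k.
Proof.
rewrite /phi Theta_dlt -big_gwedgeT; apply: eq_bigr => i _.
rewrite extvE; apply: eq_bigr => a _; apply/ffunP=> S.
by rewrite scE omega_ext !ffunE !mxE.
Qed.

End Substitution.

Section Bridge.
Variables (R : realType) (n k : nat).
Local Notation C := (R[i] : numClosedFieldType).
Local Notation rc := (real_complex R).
Local Notation Pk := (Pk R n k).
Local Notation cmx g := (map_mx rc (invmx g) : 'M[C]_n).

Lemma orthogonal_inv (g : 'M[R]_n) : orthogonal_mx g -> invmx g = g^T.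
Proof.
by move=> og; have [ug _] := mulmx1_unit og; rewrite -[LHS]mulmx1 -og mulmxA mulVmx ?mul1mx.
Qed.

Lemma orthogonal_orth (g : 'M[R]_n) : orthogonal_mx g -> orth (cmx g).
Proof.
move=> og; rewrite /orth (orthogonal_inv og) map_trmx -map_mxM trmxK (mulmx1C og).
exact: map_mx1.
Qed.

Lemma orthogonal_real (g : 'M[R]_n) : realmx (cmx g).
Proof. by move=> a b; rewrite mxE; apply: conjc_real. Qed.

Lemma orthogonal_det (g : 'M[R]_n) : orthogonal_mx g -> \det (cmx g) = rc (\det g).
Proof. by move=> og; rewrite det_map_mx (orthogonal_inv og) det_tr. Qed.

Lemma real_fixed (x : C) : x^* = x -> x = rc (complex.Re x).
Proof.
case: x => a b [] /eqP; rewrite -subr_eq0 -opprD oppr_eq0 -mulr2n mulrn_eq0 /= => /eqP ->.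
by [].
Qed.

(** A matrix fixed by conjugation has real entries, so the group used so far is the given O(n). The
    transpose occurs because [poly_act g] substitutes the inverse of g. *)
Lemma orth_orthogonal (h : 'M[C]_n) : orth h -> realmx h ->
  exists2 g : 'M[R]_n, orthogonal_mx g & h = cmx g.
Proof.
move=> oh rh; pose g : 'M[R]_n := (map_mx (@complex.Re R) h)^T.
have hE : h = map_mx rc g^T.
  by apply/matrixP=> a b; rewrite !mxE; apply: real_fixed; apply: rh.
have og : orthogonal_mx g.
  have e : map_mx rc (g *m g^T) = map_mx rc 1%:M.
    rewrite map_mxM map_mx1 -hE.
    have -> : map_mx rc g = h^T by rewrite hE -map_trmx trmxK.
    exact: (mulmx1C oh).
  apply/matrixP=> a b; apply: (@complexI R).
  by have /matrixP/(_ a b) := e; rewrite [LHS]mxE [RHS]mxE.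
by exists g => //; rewrite orthogonal_inv.
Qed.

Lemma poly_actE (g : 'M[R]_n) (f : Pk) : poly_act g f = act (cmx g) f.
Proof.
apply: (@comp_act C n k (inv_coords k g) (cmx g) f) => [a i|i].
  rewrite /inv_coords /zidx row_mxEl mxvecE mxE; apply: eq_bigr => b _.
  by rewrite !mxE.
by rewrite /inv_coords /widx row_mxEr mxE.
Qed.

Lemma O_invariantE (f : Pk) : O_invariant f <-> @pinv C n k false f.
Proof.
split=> inv => [h oh rh|g og]; last first.
  rewrite poly_actE (inv _ (orthogonal_orth og) (orthogonal_real g)) /chi expr0 mpolyC1.
  exact: mul1r.
have [g og ->] := orth_orthogonal oh rh.
rewrite -poly_actE inv // /chi expr0 mpolyC1; exact/esym/mul1r.
Qed.

Lemma special_orth (g : 'M[R]_n) : special_orthogonal_mx g ->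
  [/\ orth (cmx g), realmx (cmx g) & \det (cmx g) = 1].
Proof.
case=> og dg; split; [exact: orthogonal_orth | exact: orthogonal_real |].
by rewrite orthogonal_det // dg.
Qed.
Lemma orth_special (h : 'M[C]_n) : orth h -> realmx h -> \det h = 1 ->
  exists2 g : 'M[R]_n, special_orthogonal_mx g & h = cmx g.
Proof.
move=> oh rh dh; have [g og hg] := orth_orthogonal oh rh; exists g => //; split=> //.
by apply: (@complexI R); rewrite -orthogonal_det // -hg dh.
Qed.

Lemma SO_invariantE (f : Pk) : SO_invariant f <-> @SOpinv C n k f.
Proof.
split=> inv => [h oh rh dh|g sg].
  by have [g sg ->] := orth_special oh rh dh; rewrite -poly_actE; apply: inv.
by have [o r e] := special_orth sg; rewrite poly_actE; apply: inv.
Qed.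

Lemma form_actE (g : 'M[R]_n) (eta : forms R n k) : form_act g eta = @fa C n k (cmx g) eta.
Proof.
apply: (@gform_act C n k (cmx g) (fun a b => rc (invmx g a b)) (poly_act g) eta) => [a b|f].
  by rewrite mxE.
exact: poly_actE.
Qed.

Lemma has_degreeE l (eta : forms R n k) : has_degree l eta <-> @isdeg _ n l (eta : KF {mpoly C[(n * k + k)%N]} n).
Proof.
split=> [h|/isdegP h S]; last by apply: contraNeq => /h ->.
by apply/isdegP=> S Sl; apply: contraNeq Sl => /h ->.
Qed.

Lemma cochainE l (eta : forms R n k) : cochain l eta <-> @isdeg _ n l (eta : KF {mpoly C[(n * k + k)%N]} n) /\ @SOinv C n k eta.
Proof.
split=> [[/has_degreeE d inv]|[d inv]]; split=> //; last 1 first.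
- by move=> g sg; have [o r e] := special_orth sg; rewrite form_actE; apply: inv.
- by move=> h oh rh dh; have [g sg ->] := orth_special oh rh dh; rewrite -form_actE; apply: inv.
by apply/has_degreeE.
Qed.

Lemma dformE (eta : forms R n k) : dform eta = dop (@DL C n k) eta.
Proof.
rewrite (@dop_sum C n k eta); apply: eq_bigr => j _; apply: eq_bigr => a _.
by rewrite omega_ext.
Qed.

Lemma volE : vol R n k = dlt {mpoly C[(n * k + k)%N]} setT.
Proof. exact: (@gvol C n k). Qed.
Lemma phikE : phik R n k = phi C n k.
Proof. exact: (@gphi C n k). Qed.

Lemma pscaleE (p : Pk) (eta : forms R n k) :
  pscale p eta = (p : {mpoly C[(n * k + k)%N]}) *: (eta : KF {mpoly C[(n * k + k)%N]} n).
Proof. by apply/ffunP=> S; rewrite [LHS]ffunE; apply/esym/scE. Qed.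

Lemma coboundaryE l (eta : forms R n k) : coboundary l eta <-> @cob C n k l eta.
Proof.
case: l => [|l]; split=> /=.
- by move=> ->; apply: cob0.
- by case=> theta [_ /isdeg1_0 ->] ->; apply: raddf0.
- case=> theta /cochainE [d inv] ->; exists theta; last exact: dformE.
  by split=> //; rewrite isdeg1S.
case=> theta [inv]; rewrite isdeg1S => d ->; exists theta; last by rewrite dformE.
by apply/cochainE.
Qed.

Lemma c_idealE (f : Pk) : c_ideal f <-> @cid C n k f.
Proof.
split=> [[s [hs e]]|[t ht e]].
  by exists s => // j; apply/O_invariantE; apply: hs.
by exists t; split=> // j; apply/O_invariantE; apply: ht.
Qed.

End Bridge.

Lemma sub_mid (V : zmodType) (x y z t : V) : x - (y + z) + (z - t) = x - (y + t).
Proof. by rewrite !opprD !addrA subrK. Qed.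

(** * Splitting classes by their type under O(n) *)

Section GenericClasses.
Variables (C : numClosedFieldType) (n k : nat) (a0 : 'I_n).
Local Notation P := {mpoly C[(n * k + k)%N]}.
Local Notation vol := (dlt P [set: 'I_n]).
Local Notation d := (dop (@DL C n k)).
Local Notation phi := (phi C n k).
Local Notation cob := (@cob C n k).
Implicit Types (f g r : P) .

Lemma cob_part s l eta : cob l eta -> cob l (part a0 s eta).
Proof.
case=> theta [inv deg] ->; rewrite part_d.
by apply: (@cob_chinv _ _ _ s); [exact: part_chinv | exact: isdeg1_part].
Qed.

Lemma part_vol eta : SOinv eta -> isdeg n eta ->
  exists2 g, pinv false g & part a0 true eta = g *: vol.
Proof.
move=> inv deg; have e := isdegT (isdeg_part a0 true deg).
exists (part a0 true eta setT) => //.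
by apply/(@chinv_vol _ _ _ true); rewrite -e; apply: part_chinv.
Qed.

(** The det-semi-invariant part is exact by [acyclic_true], as k < n; the O(n)-invariant part is a
    multiple of [phi] up to coboundaries. *)
Lemma class_mid eta : (k < n)%N -> (forall m, cov C n k m) ->
  SOinv eta -> isdeg k eta -> d eta = 0 -> exists2 r, inR r & cob k (eta - r *: phi).
Proof.
move=> kn hcov inv deg z; have kn' := ltnW kn.
have [r ir cr] := phi_cover kn' (hcov k) (part_chinv a0 false inv) (isdeg_part a0 false deg).
exists r => //; rewrite -(part_sum a0 eta) addrAC; apply: cobD => //.
have ac : q_acyclic C n k true k by apply: acyclic_true.
have [|theta [i1 d1] ->] := d_acyclic ac (part_chinv a0 true inv) (isdeg_part a0 true deg).
  by rewrite -part_d z raddf0.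
exact: cob_chinv i1 d1.
Qed.

(** The O(n)-invariant part is Theta of a form of degree n in k < n generators, hence zero. *)
Lemma class_top_lt eta : (k < n)%N -> (forall m, cov C n k m) ->
  SOinv eta -> isdeg n eta -> exists2 g, pinv false g & eta = g *: vol.
Proof.
move=> kn hcov inv deg; have [g ig eg] := part_vol inv deg; exists g => //.
have [b [db _ eb]] := hcov _ _ (part_chinv a0 false inv) (isdeg_part a0 false deg).
have b0 : b = 0 := isdeg_gt kn db.
by rewrite -(part_sum a0 eta) eb b0 eg raddf0 add0r.
Qed.

Lemma class_top_eq eta : k = n -> cov C n k k -> SOinv eta -> isdeg n eta ->
  exists r g, [/\ inR r, pinv false g & cob n (eta - (r *: phi + g *: vol))].
Proof.
move=> kn hcov inv deg; have [g ig eg] := part_vol inv deg.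
have deg' : isdeg k (part a0 false eta).
  by have := isdeg_part a0 false deg; rewrite -[X in isdeg X _ -> _]kn.
have [r ir cr] := phi_cover (eq_leq kn) hcov (part_chinv a0 false inv) deg'.
exists r, g; split=> //; rewrite -{1}(part_sum a0 eta) eg opprD addrACA subrr addr0.
by rewrite -[X in cob X]kn.
Qed.

(** The two summands have different types, and d commutes with the projectors [part]; this makes the
    sum in degree n = k direct. *)
Lemma top_eq_split r g l : inR r -> pinv false g -> cob l (r *: phi + g *: vol) ->
  cob l (r *: phi) /\ cob l (g *: vol).
Proof.
move=> [_ ir] ig c; have iv : chinv true (g *: vol) by apply/chinv_vol.
have ip : chinv false (r *: phi) := chinv_phi ir.
have pD s x y : part a0 s (x + y) = part a0 s x + part a0 s y by apply: raddfD.
split.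
  by have := cob_part false c; rewrite pD (part_id a0 ip) (@part_neg _ _ _ a0 false _ iv) addr0.
by have := cob_part true c; rewrite pD (part_id a0 iv) (@part_neg _ _ _ a0 true _ ip) add0r.
Qed.

Lemma d_top eta : isdeg n eta -> d eta = 0.
Proof. by move=> deg; apply: (isdeg_gt (ltnSn n)); apply: isdeg_dop. Qed.

Lemma acyclic_wide s l : (n <= k)%N -> (l < n)%N -> q_acyclic C n k s l.
Proof. by move=> nk ln; apply: q_acyclic_small; rewrite (minn_idPl nk). Qed.

Lemma acyclic_narrow s l : (k < n)%N -> (forall m, cov C n k m) -> l != k -> (l < n)%N ->
  q_acyclic C n k s l.
Proof.
move=> kn hcov lk ln; case: s; last exact: acyclic_false.
by apply: acyclic_true => //; apply: ltnW.
Qed.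

Lemma d_add0 eta1 eta2 : d eta1 = 0 -> d eta2 = 0 -> d (eta1 + eta2) = 0.
Proof. by move=> z1 z2; rewrite raddfD /= z1 z2 addr0. Qed.

Lemma sub_split eta r g p : cob n (eta - (r *: phi + g *: vol)) -> cob n ((g - p) *: vol) ->
  cob n (eta - (r *: phi + p *: vol)).
Proof.
move=> c1 c2; have e : eta - (r *: phi + g *: vol) + (g - p) *: vol = eta - (r *: phi + p *: vol).
  by rewrite scalerBl; apply: sub_mid.
by rewrite -e; apply: cobD.
Qed.
End GenericClasses.

Lemma cov_diag (C : numClosedFieldType) (n k : nat) : (0 < n)%N -> k = n ->
  cov C n k 1 /\ cov C n k k.
Proof.
move=> n0 e; subst k; case: n n0 => // n' _; split.
  exact: covariants_det1.
exact: covariants_det_top.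
Qed.

Lemma pscale_linear (C : numClosedFieldType) (v N : nat) (T : {ffun {set 'I_N} -> {mpoly C[v]}})
    (psi : {mpoly C[v]} -> {mpoly C[v]}) : linear psi ->
  linear (fun p => [ffun S => psi p * T S] : {ffun {set 'I_N} -> {mpoly C[v]}}).
Proof.
by move=> lin c p q; apply/ffunP=> S; rewrite !ffunE lin mulrDl scalerAl.
Qed.

(** * Transfer to the given complex *)

Section Assembly.
Variables (R : realType) (n k : nat).
Local Notation C := (R[i] : numClosedFieldType).
Local Notation Pk := (Pk R n k).
Local Notation gvol := (dlt {mpoly C[(n * k + k)%N]} [set: 'I_n]).

Lemma Psi_linear (psi : Pk -> Pk) (T : forms R n k) : linear psi -> linear (fun f => pscale (psi f) T).
Proof. exact: (@pscale_linear C _ _ T psi). Qed.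

Lemma cob_scale l (p : Pk) : coboundary l (pscale p (vol R n k)) <-> @cob C n k l ((p : {mpoly C[(n * k + k)%N]}) *: gvol).
Proof. by rewrite pscaleE volE; apply: coboundaryE. Qed.

Lemma pscaleBl (p q : Pk) (T : forms R n k) : pscale p T - pscale q T = pscale (p - q) T.
Proof. by apply/ffunP=> S; rewrite !ffunE mulrBl. Qed.

Lemma cocycle_vol (p : Pk) : @SOpinv C n k p -> cocycle n (pscale p (vol R n k)).
Proof.
move=> inv; rewrite pscaleE volE; split.
  by apply/cochainE; split; [exact: isdeg_vol | apply/SOinv_vol].
rewrite dformE; apply: d_top; exact: isdeg_vol.
Qed.

Lemma cocycle_add l (x y : forms R n k) : cocycle l x -> cocycle l y -> cocycle l (x + y).
Proof.
move=> [/cochainE [d1 i1] z1] [/cochainE [d2 i2] z2]; split.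
  by apply/cochainE; split; [exact (isdegD d1 d2) | exact (SOinvD i1 i2)].
move: z1 z2; rewrite !dformE => z1 z2.
exact (@d_add0 C n k x y z1 z2).
Qed.

Lemma pinv_SOpinv (p : Pk) : @pinv C n k false p -> @SOpinv C n k p.
Proof. by move=> inv h oh rh _; rewrite inv // /chi expr0 mpolyC1; apply: mul1r. Qed.

Lemma vanishing (a0 : 'I_n) l : (n < l)%N \/ (forall s, q_acyclic C n k s l) -> sq_zero (cohom R n k l).
Proof.
move=> ac eta [/cochainE [deg inv] z]; apply/coboundaryE.
by apply: vanish => //; rewrite -dformE.
Qed.

Lemma cocycle_phik (r : Pk) : inRk r -> cocycle k (pscale r (phik R n k)).
Proof.
case=> zr /O_invariantE ir; rewrite pscaleE phikE; split.
  apply/cochainE; split; first exact: isdeg_phi.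
  exact: chinv_SO (chinv_phi ir).
by rewrite dformE; apply: phi_closed.
Qed.

Lemma coboundary_phik (a0 : 'I_n) (r : Pk) : (0 < k)%N -> (k <= n)%N -> inRk r ->
  coboundary k (pscale r (phik R n k)) -> r = 0.
Proof.
move=> k0 kn [zr _]; rewrite pscaleE phikE => /coboundaryE.
exact: phi_cob.
Qed.

Lemma leading (A : Pk -> Prop) (psi : Pk -> Pk) :
  (forall f, A f -> exists r, [/\ A r, (msize r <= (msize f).-1)%N &
      @cob C n k n (((psi f - (f + r)) : {mpoly C[(n * k + k)%N]}) *: gvol)]) ->
  leading_term_vol A (fun f => pscale (psi f) (vol R n k)).
Proof.
move=> h f /h [r [Ar sr cr]]; exists r; split=> //.
by rewrite pscaleBl; apply/cob_scale.
Qed.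

Lemma inRkE (r : Pk) : inRk r <-> @inR C n k r.
Proof. by split=> -[zr ir]; split=> //; apply/O_invariantE. Qed.

Lemma cob_sub (g p : Pk) : @cob C n k n (((g - p) : {mpoly C[(n * k + k)%N]}) *: gvol) ->
  coboundary n (((g : {mpoly C[(n * k + k)%N]}) *: gvol : forms R n k) - pscale p (vol R n k)).
Proof.
have -> : ((g : {mpoly C[(n * k + k)%N]}) *: gvol : forms R n k) = pscale g (vol R n k).
  by rewrite pscaleE volE.
by rewrite pscaleBl => c; apply/cob_scale.
Qed.

Lemma cob_split (eta : forms R n k) (r g p : Pk) :
  @cob C n k n ((eta : KF {mpoly C[(n * k + k)%N]} n) -
     ((r : {mpoly C[(n * k + k)%N]}) *: phi C n k + (g : {mpoly C[(n * k + k)%N]}) *: gvol)) ->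
  @cob C n k n (((g - p) : {mpoly C[(n * k + k)%N]}) *: gvol) ->
  coboundary n (eta - (pscale r (phik R n k) + pscale p (vol R n k))).
Proof.
move=> c1 c2; rewrite !pscaleE phikE volE; apply/coboundaryE.
exact (@sub_split C n k eta r g p c1 c2).
Qed.

End Assembly.

Theorem theorem1p0p7 (R : realType) (n k : nat) (hn : (1 <= n)%N) (hk : (1 <= k)%N) :
  [/\ (k < n)%N ->
        [/\ sq_iso (Rk R n k) (cohom R n k k) (fun r => pscale r (phik R n k)),
            exists Psi : Pk R n k -> forms R n k,
              sq_iso (Sk_mod_c R n k) (cohom R n k n) Psi /\
              leading_term_vol (@inSk R n k) Psi &
            forall l : nat, l != k -> l != n -> sq_zero (cohom R n k l)],
      k = n ->
        (exists Psi : Pk R n k -> forms R n k,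
           sq_iso (sq_prod (Rk R n k) (Sk_mod_c R n k)) (cohom R n k n)
             (fun p : Pk R n k * Pk R n k =>
                pscale p.1 (phik R n k) + Psi p.2) /\
           leading_term_vol (@inSk R n k) Psi) /\
        (forall l : nat, l != n -> sq_zero (cohom R n k l)) &
      (n < k)%N ->
        (exists Psi : Pk R n k -> forms R n k,
           sq_iso (Pk_mod_q_K R n k) (cohom R n k n) Psi /\
           leading_term_vol (@SO_invariant R n k) Psi) /\
        (forall l : nat, l != n -> sq_zero (cohom R n k l))].
Proof.
pose a0 : 'I_n := Ordinal hn.
have pid T : linear (fun r : Pk R n k => pscale r T) by apply: (@Psi_linear R n k idfun).
have zero_phik : coboundary k (pscale 0 (phik R n k)).
  by rewrite pscaleE scale0r; apply/coboundaryE; apply: cob0.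
split.
- move=> kn; have hcov m : cov R[i] n k m by move=> eta; apply: covariants.
  have [psi [p1 p2 p3 p4 p5]] := psi_c a0 (ltnW kn) (hcov 1%N) (fun _ => hcov).
  split.
  + split; first exact: pid.
    * by move=> r; apply: cocycle_phik.
    * move=> r hr; split; first exact: (coboundary_phik a0 hk (ltnW kn) hr).
      by move=> /= ->; apply: zero_phik.
    move=> eta [/cochainE [deg inv] z]; rewrite dformE in z.
    have [r ir cr] := class_mid a0 kn hcov inv deg z.
    exists r; first by apply/inRkE.
    by apply/coboundaryE; rewrite pscaleE phikE.
  + exists (fun f => pscale (psi f) (vol R n k)); split; last first.
      apply: leading => f /O_invariantE /p5 [r [ir sr cr]].
      by exists r; split=> //; apply/O_invariantE.
    split.
    * exact: Psi_linear.
    * by move=> f /O_invariantE /p2 /pinv_SOpinv; apply: cocycle_vol.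
    * by move=> f /O_invariantE inv; split=> [/cob_scale /(p3 _ inv) /c_idealE|/c_idealE /(p3 _ inv) /cob_scale].
    move=> eta [/cochainE [deg inv] _].
    have [g ig ->] := class_top_lt a0 kn hcov inv deg; have [f inf cf] := p4 g ig.
    exists f; first by apply/O_invariantE.
    exact: cob_sub cf.
  move=> l lk ln; apply: (vanishing a0).
  (* Below n and away from k both types are exact; above n there are no forms. *)
  by case: (ltngtP l n) ln => // l_n _; [right=> s; apply: acyclic_narrow | left].
- move=> kn; have [cov1 covk] := cov_diag R[i] hn kn.
  have kn' : (k <= n)%N by rewrite kn.
  (* Vacuous here: for k = n the covariants of degrees 1 and n come from [cov_diag]. *)
  have nok : (k < n)%N -> forall m, cov R[i] n k m by rewrite kn ltnn.
  have [psi [p1 p2 p3 p4 p5]] := psi_c a0 kn' cov1 nok.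
  split; last first.
    move=> l ln; apply: (vanishing a0).
    case: (ltngtP l n) ln => // l_n _; last by left.
    by right=> s; apply: acyclic_wide => //; rewrite kn.
  exists (fun f => pscale (psi f) (vol R n k)); split; last first.
    apply: leading => f /O_invariantE /p5 [r [ir sr cr]].
    by exists r; split=> //; apply/O_invariantE.
  have lin := Psi_linear (vol R n k) p1.
  split.
  + move=> c [r1 f1] [r2 f2] /=; rewrite pid lin scalerDr addrACA.
    by [].
  + move=> [r f] [/= ir /O_invariantE /p2 /pinv_SOpinv cf].
    apply: cocycle_add; last exact: cocycle_vol.
    by rewrite -[X in cocycle X _]kn; apply: cocycle_phik.
  + move=> [r f] [/= ir /O_invariantE inf]; split.
      move=> /coboundaryE; rewrite !pscaleE phikE volE => c.
      have [] := top_eq_split a0 (proj1 (inRkE _) ir) (p2 _ inf) c.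
      rewrite -[X in cob X _]kn => cr cf; split; last by apply/c_idealE/(p3 _ inf).
      by apply: (coboundary_phik a0 hk kn' ir); rewrite pscaleE phikE; apply/coboundaryE.
    move=> [/= -> /c_idealE /(p3 _ inf) cf]; apply/coboundaryE.
    rewrite /= pscaleE scale0r add0r pscaleE volE.
    exact: cf.
  move=> eta [/cochainE [deg inv] _].
  have [r [g [ir ig cr]]] := class_top_eq a0 kn covk inv deg.
  have [f inf cf] := p4 g ig.
  exists (r, f) => /=; first by split; [apply/inRkE | apply/O_invariantE].
  exact: cob_split cr cf.
move=> nk; have [psi [p1 p2 p3 p4 p5]] := psi_q R[i] a0 nk.
have numE f : (forall g : 'M[R]_n, special_orthogonal_mx g -> q_ideal (poly_act g f - f)) <->
    (forall h : 'M[R[i]]_n, orth h -> realmx h -> \det h = 1 -> qid (act h f - f)).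
  split=> hf => [h oh rh dh|g sg].
    by have [g sg ->] := orth_special oh rh dh; have := hf g sg; rewrite poly_actE.
  by have [o r e] := special_orth sg; rewrite poly_actE; apply: hf.
split; last first.
  move=> l ln; apply: (vanishing a0).
  case: (ltngtP l n) ln => // l_n _; last by left.
  by right=> s; apply: acyclic_wide => //; apply: ltnW.
exists (fun f => pscale (psi f) (vol R n k)); split; last first.
  apply: leading => f /SO_invariantE /p5 [r [ir sr cr]].
  by exists r; split=> //; apply/SO_invariantE.
split.
- exact: Psi_linear.
- by move=> f /numE /p2; apply: cocycle_vol.
- by move=> f /numE nf; split=> [/cob_scale /(p3 _ nf)|/(p3 _ nf) /cob_scale].
move=> eta [/cochainE [deg inv] _]; have e := isdegT deg; move: inv.
rewrite e => /SOinv_vol /p4 [f nf cf].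
exists f; first exact/numE.
exact: cob_sub cf.
Qed.
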